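(* Let $M\subset Z$ be a compact $G$-stable subset and let $\Psi^M$ be the Kempf-Ness function of $(M,G,K)$ associated with the gradient map $\mu_{\mathfrak p}$. The function $$\Psi^{\mathscr P}:\mathscr P(M)\times G\to\mathbb R,\qquad \Psi^{\mathscr P}(\nu,g)=\int_M\Psi^M(x,g)\,d\nu(x),$$ is a Kempf-Ness function for $(\mathscr P(M),G,K)$, i.e. it satisfies (P1)-(P5); since $M$ is compact, it also satisfies (P6). Moreover, with $X=G/K$, the associated functions on $X$ are $$\psi^{\mathscr P}_\nu:X\to\mathbb R,\qquad \psi^{\mathscr P}_\nu(gK)=\Psi^{\mathscr P}(\nu,g^{-1})=\int_M\psi^M_x(gK)\,d\nu(x),$$ where $\psi^M_x(gK)=\Psi^M(x,g^{-1})$, and the gradient map is $$\mathfrak F:\mathscr P(M)\to\mathfrak p^*,\qquad \mathfrak F(\nu)=\int_M\mu_{\mathfrak p}(x)\,d\nu(x).$$ Finally, if $\exp(\mathbb R\beta)\subset G_\nu$ for some $\beta\in\mathfrak p$, then $\mathfrak F(\nu)\in\mathfrak p^\beta$.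
   Context: $U$ is a compact connected Lie group with Lie algebra $\mathfrak u$ and complexification $U^{\mathbb C}$. $(Z,\omega)$ is a Kähler manifold on which $U^{\mathbb C}$ acts holomorphically, $\omega$ is $U$-invariant, and $U$ acts in a Hamiltonian fashion with momentum map $\mu:Z\to\mathfrak u^*$: $\mu$ is $U$-equivariant and, for $\xi\in\mathfrak u$, the gradient of $\mu^\xi=\mu(\cdot)(\xi)$ is $J\xi_Z$, where $\xi_Z(p)=\frac{d}{dt}|_{t=0}\exp(t\xi)p$. $G\subset U^{\mathbb C}$ is a closed connected compatible subgroup: $G=K\exp(\mathfrak p)$ with $K=U\cap G$, $\mathfrak p=\mathfrak g\cap i\mathfrak u$, $\mathfrak g=\mathfrak k\oplus\mathfrak p$. A fixed $\mathrm{Ad}(U^{\mathbb C})$-invariant non-degenerate real bilinear form on $\mathfrak u^{\mathbb C}$, positive definite on $i\mathfrak u$, negative definite on $\mathfrak u$, with $\mathfrak u\perp i\mathfrak u$, gives a scalar product $\langle\cdot,\cdot\rangle$ on $\mathfrak p$ (used to identify $\mathfrak p\cong\mathfrak p^*$) and a $G$-invariant Riemannian metric on $X=G/K$. The gradient map $\mu_{\mathfrak p}:M\to\mathfrak p$ is defined by $\langle\mu_{\mathfrak p}(z),\beta\rangle=-\mu(z)(i\beta)$ for $\beta\in\mathfrak p$. $\Psi^M:M\times G\to\mathbb R$ is the function such that, for each $x\in M$, $\Psi^M(x,e)=0$ and the differential of $\Psi^M(x,\cdot)$ at $g$ is $v\mapsto\langle\mu_{\mathfrak p}(gx),\pi_{\mathfrak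 p}(dR_{g^{-1}}v)\rangle$ for $v\in T_gG$, with $\pi_{\mathfrak p}:\mathfrak g\to\mathfrak p$ the projection along $\mathfrak k$ and $R$ right translation; it is a Kempf-Ness function for $(M,G,K)$. $\mathscr P(M)$ is the set of Borel probability measures on $M$ with the weak topology (weak-$*$ topology as a subset of the dual of $C(M)$), on which $G$ acts continuously by push-forward, $(g,\nu)\mapsto g_*\nu$; $G_\nu$ is the stabilizer of $\nu$. $\mathfrak p^\beta=\{u\in\mathfrak p:[u,\beta]=0\}$. For a Hausdorff space $\mathscr M$ with a continuous $G$-action, a Kempf-Ness function for $(\mathscr M,G,K)$ is $\Psi:\mathscr M\times G\to\mathbb R$ such that: (P1) for every $x\in\mathscr M$, $\Psi(x,\cdot)$ is smooth on $G$; (P2) $\Psi(x,kg)=\Psi(x,g)$ for all $k\in K$, $g\in G$; (P3) for all $x\in\mathscr M$, $v\in\mathfrak p$, $t\in\mathbb R$: $\frac{d^2}{dt^2}\Psi(x,\exp(tv))\ge 0$, and $\frac{d^2}{dt^2}\big|_{t=0}\Psi(x,\exp(tv))=0$ if and only if $\exp(\mathbb R v)\subset G_x$; (P4) $\Psi(x,g)+\Psi(gx,h)=\Psi(x,hg)$ for all $x\in\mathscr M$, $g,h\in G$; (P5) the gradient map $\mathfrak F:\mathscr M\to\mathfrak p^*$, $\langle\mathfrak F(x),v\rangle=\frac{d}{dt}\big|_{t=0}\Psi(x,\exp(tv))$, is continuous. Condition (P6): for every $x$, the function $\psi_x:X\to\mathbb R$, $\psi_x(gK)=\Psi(x,g^{-1})$,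 is globally Lipschitz on $X$. *)

(* Defs.v *)
From HB Require Import structures.
From mathcomp Require Import all_boot all_order all_algebra.
From mathcomp Require Import all_classical all_reals all_analysis.

Set Implicit Arguments.
Unset Strict Implicit.
Unset Printing Implicit Defensive.

Import Order.TTheory GRing.Theory Num.Theory.
Import numFieldNormedType.Exports.

Local Open Scope classical_set_scope.
Local Open Scope ring_scope.

(* C^k on an open set O of a finite dimensional space: all iterated directional
   derivatives up to order k exist and are continuous. *)
Fixpoint Ck (R : realType) (V W : normedModType R) (k : nat) (O : set V)
    (f : V -> W) : Prop :=
  (forall x, O x -> {for x, continuous f}) /\
  (if k is k'.+1 then
     forall v, (forall x, O x -> derivable f x v) /\ Ck k' O ('D_v f)
   else True).

Definition smooth_on (R : realType) (V W : normedModType R) (O : set V)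
    (f : V -> W) : Prop :=
  forall k, Ck k O f.

(* [coord] is meaningful on [cdom] and [param] on its image only. *)
Record chart (E T : Type) := Chart {
  cdom : set T;
  coord : T -> E;
  param : E -> T }.

Definition cimage (E T : Type) (c : chart E T) : set E := coord c @` cdom c.

Definition is_chart (R : realType) (E : normedModType R) (T : topologicalType)
    (c : chart E T) : Prop :=
  [/\ open (cdom c),
      open (cimage c),
      (forall x, cdom c x -> param c (coord c x) = x),
      (forall x, cdom c x -> {for x, continuous (coord c)})
    & (forall y, cimage c y -> {for y, continuous (param c)})].

Definition overlap (E T : Type) (c d : chart E T) : set E :=
  [set y | cimage c y /\ cdom d (param c y)].

(* Smooth manifolds modelled on E.  [chart_at x] is a preferred chart around x;
   it identifies the tangent space at x with E. *)
HB.mixin Record isManifold (R : realType) (E : normedModType R) T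
    of Topological T := {
  atlas : set (chart E T);
  chart_at : T -> chart E T;
  atlas_chart : forall c, atlas c -> is_chart c;
  chart_at_atlas : forall x, atlas (chart_at x);
  chart_at_dom : forall x, cdom (chart_at x) x;
  atlas_smooth : forall c d, atlas c -> atlas d ->
    smooth_on (overlap c d) (coord d \o param c);
  manifold_hausdorff : hausdorff_space T;
  manifold_second_countable : @second_countable T }.

#[short(type="manifoldType")]
HB.structure Definition Manifold (R : realType) (E : normedModType R) :=
  {T of Topological T & isManifold R E T}.

Section SmoothMaps.
Context (R : realType) (E F D : normedModType R).
Context (M : manifoldType E) (N : manifoldType F) (P : manifoldType D).

Definition smooth_map_on (O : set M) (f : M -> N) : Prop :=
  (forall x, O x -> {for x, continuous f}) /\
  forall (c : chart E M) (d : chart F N), atlas c -> atlas d ->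
    smooth_on [set y | [/\ cimage c y, O (param c y) & cdom d (f (param c y))]]
      (fun y => coord d (f (param c y))).

Definition smooth_map (f : M -> N) : Prop := smooth_map_on setT f.

(* smoothness on the product manifold M x N, read in product charts *)
Definition smooth_map2 (f : M -> N -> P) : Prop :=
  continuous (fun p : M * N => f p.1 p.2) /\
  forall (c : chart E M) (d : chart F N) (e : chart D P),
    atlas c -> atlas d -> atlas e ->
    smooth_on
      [set y : E * F | [/\ cimage c y.1, cimage d y.2
                         & cdom e (f (param c y.1) (param d y.2))]]
      (fun y : E * F => coord e (f (param c y.1) (param d y.2))).

Definition smooth_fun (f : M -> R) : Prop :=
  forall c : chart E M, atlas c -> smooth_on (cimage c) (fun y => f (param c y)).

Definition mfderiv (f : M -> N) (x : M) (v : E) : F :=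
  'D_v (fun y => coord (chart_at (f x)) (f (param (chart_at x) y)))
    (coord (chart_at x) x).

Definition mfdiff (f : M -> R) (x : M) (v : E) : R :=
  'D_v (fun y => f (param (chart_at x) y)) (coord (chart_at x) x).

Definition velocity (gamma : R -> M) (t : R) : E :=
  derive1 (fun s => coord (chart_at (gamma t)) (gamma s)) t.

Definition C1_curve (gamma : R -> M) : Prop :=
  continuous gamma /\
  forall c : chart E M, atlas c ->
    Ck 1 [set t : R^o | cdom c (gamma t)] (fun t : R^o => coord c (gamma t)).

(* Covariant 2-tensors: [w x] is a form on the tangent space at x, i.e. on E
   through [chart_at x]; [tensor_in c w] is the expression of w in the chart c. *)
Definition tensor_in (c : chart E M) (w : M -> E -> E -> R) (y u v : E) : R :=
  let tau := fun y' => coord (chart_at (param c y)) (param c y') in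
  w (param c y) ('D_u tau y) ('D_v tau y).

Definition bilinear_tensor (w : M -> E -> E -> R) : Prop :=
  forall x u, scalar (w x u) /\ scalar (fun v => w x v u).

Definition smooth_tensor (w : M -> E -> E -> R) : Prop :=
  forall (c : chart E M) u v, atlas c ->
    smooth_on (cimage c) (fun y => tensor_in c w y u v).

Definition closed_2form (w : M -> E -> E -> R) : Prop :=
  forall (c : chart E M) y u v t, atlas c -> cimage c y ->
    'D_u (fun y' => tensor_in c w y' v t) y
    + 'D_v (fun y' => tensor_in c w y' t u) y
    + 'D_t (fun y' => tensor_in c w y' u v) y = 0.

End SmoothMaps.

Definition preserves_tensor (R : realType) (E : normedModType R)
    (M : manifoldType E) (w : M -> E -> E -> R) (f : M -> M) : Prop :=
  forall x u v, w (f x) (mfderiv f x u) (mfderiv f x v) = w x u v.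

Section Riemannian.
Context (R : realType) (E : normedModType R) (M : manifoldType E).

Definition riemannian_metric (h : M -> E -> E -> R) : Prop :=
  [/\ bilinear_tensor h, smooth_tensor h, (forall x u v, h x u v = h x v u)
    & (forall x u, u != 0 -> 0 < h x u u)].

Definition curve_length (h : M -> E -> E -> R) (gamma : R -> M) : R :=
  \int[lebesgue_measure]_(t in `[0, 1])
    Num.sqrt (h (gamma t) (velocity gamma t) (velocity gamma t)).

(* [pw_path h x y l]: some piecewise C^1 path from x to y has length l.  Each
   piece is the restriction to [0, 1] of a C^1 curve defined on R. *)
Inductive pw_path (h : M -> E -> E -> R) : M -> M -> R -> Prop :=
| pw_nil x : pw_path h x x 0
| pw_cons gamma y l : C1_curve gamma -> pw_path h (gamma 1) y l ->
    pw_path h (gamma 0) y (curve_length h gamma + l).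

Definition riemannian_dist (h : M -> E -> E -> R) (x y : M) : R :=
  inf [set l | pw_path h x y l].

Definition globally_lipschitz (h : M -> E -> E -> R) (f : M -> R) : Prop :=
  exists L, forall x y, `|f x - f y| <= L * riemannian_dist h x y.

End Riemannian.

(* Complex manifolds of dimension n are modelled on C^n seen as
   R^n + iR^n = 'rV[R]_(n + n), where i is [Jmx]. *)
Definition Jmx (R : realType) (n : nat) (v : 'rV[R]_(n + n)) : 'rV[R]_(n + n) :=
  row_mx (- rsubmx v) (lsubmx v).

HB.mixin Record isComplexManifold (R : realType) (n : nat) T
    of Manifold R 'rV[R]_(n + n) T := {
  atlas_holomorphic : forall c d : chart 'rV[R]_(n + n) T, atlas c -> atlas d ->
    forall y v, overlap c d y ->
      'D_(Jmx v) (coord d \o param c) y = Jmx ('D_v (coord d \o param c) y) }.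

#[short(type="complexManifoldType")]
HB.structure Definition ComplexManifold (R : realType) (n : nat) :=
  {T of Manifold R 'rV[R]_(n + n) T & isComplexManifold R n T}.

Section Holomorphic.
Context (R : realType) (m n p : nat).
Context (M : complexManifoldType R m) (N : complexManifoldType R n).
Context (P : complexManifoldType R p).

Definition complex_linear_diff (f : M -> N) : Prop :=
  forall x v, mfderiv f x (Jmx v) = Jmx (mfderiv f x v).

Definition holomorphic (f : M -> N) : Prop :=
  smooth_map f /\ complex_linear_diff f.

End Holomorphic.

(* holomorphic on the product manifold: the differential at (x, y) is
   (u, v) |-> d(f _ y) u + d(f x _) v *)
Definition holomorphic2 (R : realType) (m n p : nat)
    (M : complexManifoldType R m) (N : complexManifoldType R n)
    (P : complexManifoldType R p) (f : M -> N -> P) : Prop :=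
  [/\ smooth_map2 f, (forall x, complex_linear_diff (f x))
    & (forall y, complex_linear_diff (f^~ y))].

(* (Z, w) is Kaehler, with Riemannian metric (u, v) |-> w(u, Jv) *)
Definition kahler_metric (R : realType) (m : nat) (Z : complexManifoldType R m)
    (w : Z -> 'rV[R]_(m + m) -> 'rV[R]_(m + m) -> R) z u v : R :=
  w z u (Jmx v).

Definition kahler_form (R : realType) (m : nat) (Z : complexManifoldType R m)
    (w : Z -> 'rV[R]_(m + m) -> 'rV[R]_(m + m) -> R) : Prop :=
  [/\ bilinear_tensor w /\ (forall z u v, w z u v = - w z v u),
      smooth_tensor w,
      closed_2form w,
      (forall z u v, w z (Jmx u) (Jmx v) = w z u v)
    & (forall z u, u != 0 -> 0 < kahler_metric w z u u)].

#[short(type="topGroupType")]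
HB.structure Definition TopGroup := {T of Topological T & Group T}.

#[short(type="manifoldGroupType")]
HB.structure Definition ManifoldGroup (R : realType) (E : normedModType R) :=
  {T of TopGroup T & Manifold R E T}.

(* Real Lie groups of dimension d; the Lie algebra is the tangent space at 1,
   i.e. 'rV[R]_d through [chart_at 1].  The exponential map, which every Lie
   group has and which the last three axioms determine, is part of the
   structure. *)
HB.mixin Record isLieGroup (R : realType) (d : nat) T
    of ManifoldGroup R 'rV[R]_d T := {
  divg_smooth : smooth_map2 (fun g h : T => (g * h^-1)%g);
  lexp : 'rV[R]_d -> T;
  lexp_smooth : continuous lexp /\
    forall c : chart 'rV[R]_d T, atlas c ->
      smooth_on [set v | cdom c (lexp v)] (fun v => coord c (lexp v));
  lexpD : forall (s t : R) v,
    lexp ((s + t) *: v) = (lexp (s *: v) * lexp (t *: v))%g;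
  lexp_velocity : forall v, velocity (fun t : R => lexp (t *: v)) 0 = v }.

#[short(type="lieGroupType")]
HB.structure Definition LieGroup (R : realType) (d : nat) :=
  {T of ManifoldGroup R 'rV[R]_d T & isLieGroup R d T}.

HB.mixin Record isComplexLieGroup (R : realType) (n : nat) T
    of LieGroup R (n + n) T & ComplexManifold R n T := {
  divg_holomorphic : holomorphic2 (fun g h : T => (g * h^-1)%g) }.

#[short(type="complexLieGroupType")]
HB.structure Definition ComplexLieGroup (R : realType) (n : nat) :=
  {T of LieGroup R (n + n) T & ComplexManifold R n T & isComplexLieGroup R n T}.

Definition is_ghom (G H : groupType) (f : G -> H) : Prop :=
  forall g h, f (g * h)%g = (f g * f h)%g.

Section LieAlgebra.
Context (R : realType) (d : nat) (G : lieGroupType R d).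

Definition Ad (g : G) (v : 'rV[R]_d) : 'rV[R]_d :=
  mfderiv (fun h : G => (g * h * g^-1)%g) 1%g v.

Definition lbracket (u v : 'rV[R]_d) : 'rV[R]_d :=
  derive1 (fun t : R => Ad (lexp (t *: u)) v) 0.

End LieAlgebra.

Definition lie_hom (R : realType) (d e : nat) (G : lieGroupType R d)
    (H : lieGroupType R e) (f : G -> H) : Prop :=
  is_ghom f /\ smooth_map f.

Definition lie_diff (R : realType) (d e : nat) (G : lieGroupType R d)
    (H : lieGroupType R e) (f : G -> H) (v : 'rV[R]_d) : 'rV[R]_e :=
  mfderiv f 1%g v.

(* f identifies G with a closed subgroup of H (an injective continuous closed
   map is a homeomorphism onto a closed subspace) *)
Definition closed_lie_embedding (R : realType) (d e : nat)
    (G : lieGroupType R d) (H : lieGroupType R e) (f : G -> H) : Prop :=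
  [/\ lie_hom f, injective f, injective (lie_diff f)
    & (forall A : set G, closed A -> closed (f @` A))].

(* universal property of the complexification iota : U -> U^C *)
Definition is_complexification (R : realType) (d n : nat)
    (U : lieGroupType R d) (UC : complexLieGroupType R n) (iota : U -> UC)
    : Prop :=
  lie_hom iota /\
  forall (p : nat) (L : complexLieGroupType R p) (f : U -> L), lie_hom f ->
    exists! F : UC -> L,
      [/\ is_ghom F, holomorphic F & forall u, F (iota u) = f u].

Definition is_action (G : groupType) (T : Type) (a : G -> T -> T) : Prop :=
  (forall x, a 1%g x = x) /\ (forall g h x, a (g * h)%g x = a g (a h x)).

Definition fundamental_field (R : realType) (d : nat) (U : lieGroupType R d)
    (E : normedModType R) (Z : manifoldType E) (a : U -> Z -> Z)
    (xi : 'rV[R]_d) (z : Z) : E :=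
  velocity (fun t : R => a (lexp (t *: xi)) z) 0.

Definition momentum_map (R : realType) (d m : nat) (U : lieGroupType R d)
    (Z : complexManifoldType R m) (a : U -> Z -> Z)
    (w : Z -> 'rV[R]_(m + m) -> 'rV[R]_(m + m) -> R)
    (mu : Z -> 'rV[R]_d -> R) : Prop :=
  [/\ (forall z, scalar (mu z)),
      (forall xi, smooth_fun (mu^~ xi)),
      (forall u z xi, mu (a u z) (Ad u xi) = mu z xi)
    & (forall xi z v, mfdiff (mu^~ xi) z v =
         kahler_metric w z (Jmx (fundamental_field a xi z)) v)].

(* U and G are subgroups of UC through iU and iG.  Both differentials are
   linear, so [linfun] does not change them. *)
Section CompatibleSubgroup.
Context (R : realType) (dU n d : nat) (U : lieGroupType R dU).
Context (UC : complexLieGroupType R n) (G : lieGroupType R d).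
Context (iU : U -> UC) (iG : G -> UC).

Definition K_of : set G := [set g | range iU (iG g)].

Definition lie_k : {vspace 'rV[R]_d} :=
  (linfun (lie_diff iG) @^-1: limg (linfun (lie_diff iU)))%VS.

Definition lie_p : {vspace 'rV[R]_d} :=
  (linfun (lie_diff iG) @^-1: limg (linfun (fun xi => Jmx (lie_diff iU xi))))%VS.

Definition compatible : Prop :=
  [/\ (forall g : G, exists k v,
         [/\ K_of k, v \in lie_p & g = (k * lexp v)%g]),
      (lie_k + lie_p = fullv)%VS & (lie_k :&: lie_p = 0)%VS].

Definition proj_p : 'rV[R]_d -> 'rV[R]_d := daddv_pi lie_p lie_k.

Definition invariant_form
    (B : 'rV[R]_(n + n) -> 'rV[R]_(n + n) -> R) : Prop :=
  [/\ (forall u, scalar (B u)) /\ (forall u v, B u v = B v u),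
      (forall u, (forall v, B u v = 0) -> u = 0),
      (forall (h : UC) u v, B (Ad h u) (Ad h v) = B u v),
      (forall xi, lie_diff iU xi != 0 ->
         B (lie_diff iU xi) (lie_diff iU xi) < 0 /\
         0 < B (Jmx (lie_diff iU xi)) (Jmx (lie_diff iU xi)))
    & (forall xi eta, B (lie_diff iU xi) (Jmx (lie_diff iU eta)) = 0)].

Definition ip (B : 'rV[R]_(n + n) -> 'rV[R]_(n + n) -> R) (u v : 'rV[R]_d) : R :=
  B (lie_diff iG u) (lie_diff iG v).

(* i beta lies in the Lie algebra of U; eta is the corresponding vector *)
Definition gradient_map (B : 'rV[R]_(n + n) -> 'rV[R]_(n + n) -> R)
    (T : Type) (mu : T -> 'rV[R]_dU -> R) (mup : T -> 'rV[R]_d) : Prop :=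
  forall z, mup z \in lie_p /\
    forall beta eta, beta \in lie_p ->
      lie_diff iU eta = Jmx (lie_diff iG beta) ->
      ip B (mup z) beta = - mu z eta.

(* the centralizer of beta in p *)
Definition p_centralizer (beta : 'rV[R]_d) : set 'rV[R]_d :=
  [set u | u \in lie_p /\ lbracket G u beta = 0].

End CompatibleSubgroup.

(* q : G -> X exhibits X as the homogeneous manifold G/K: its fibres are the
   left cosets of K and it is a surjective submersion, i.e. it has smooth local
   sections through all points. *)
Definition homogeneous_quotient (R : realType) (d e : nat)
    (G : lieGroupType R d) (K : set G) (X : manifoldType 'rV[R]_e)
    (q : G -> X) : Prop :=
  [/\ smooth_map q,
      (forall x, exists g, q g = x),
      (forall g h, q g = q h <-> K (g^-1 * h)%g)
    & (forall g, exists (O : set X) (s : X -> G),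
         [/\ open O, O (q g), smooth_map_on O s, s (q g) = g
           & forall x, O x -> q (s x) = x])].

(* the G-invariant metric on X = G/K given by the scalar product on p *)
Definition invariant_metric (R : realType) (d e : nat) (G : lieGroupType R d)
    (p : {vspace 'rV[R]_d}) (scal : 'rV[R]_d -> 'rV[R]_d -> R)
    (X : manifoldType 'rV[R]_e) (q : G -> X)
    (h : X -> 'rV[R]_e -> 'rV[R]_e -> R) : Prop :=
  [/\ riemannian_metric h,
      (forall (g : G) (a : X -> X), (forall g', a (q g') = q (g * g')%g) ->
         preserves_tensor h a)
    & (forall u v, u \in p -> v \in p ->
         h (q 1%g) (mfderiv q 1%g u) (mfderiv q 1%g v) = scal u v)].

Section KempfNess.
Context (R : realType) (d : nat) (G : lieGroupType R d).
Context (K : set G) (p : {vspace 'rV[R]_d}).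
Context (T : topologicalType) (a : G -> T -> T) (Psi : T -> G -> R).

Definition kn_gradient (x : T) (v : 'rV[R]_d) : R :=
  derive1 (fun t : R => Psi x (lexp (t *: v))) 0.

(* continuity of the gradient map into the finite dimensional space p^* is
   continuity of its pairing with every v in p *)
Record kempf_ness : Prop := KempfNess {
  kn_hausdorff : hausdorff_space T;
  kn_action : is_action a;
  kn_action_continuous : continuous (fun gx : G * T => a gx.1 gx.2);
  kn_P1 : forall x, smooth_fun (Psi x);
  kn_P2 : forall x k g, K k -> Psi x (k * g)%g = Psi x g;
  kn_P3 : forall x v, v \in p ->
    (forall t, 0 <= derive1n 2 (fun s : R => Psi x (lexp (s *: v))) t) /\
    (derive1n 2 (fun s : R => Psi x (lexp (s *: v))) 0 = 0 <->
     forall t : R, a (lexp (t *: v)) x = x);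
  kn_P4 : forall x g h, Psi x g + Psi (a g x) h = Psi x (h * g)%g;
  kn_P5 : forall v, v \in p -> continuous (fun x => kn_gradient x v) }.

(* psi_x : X -> R with psi_x (g K) = Psi (x, g^-1) *)
Definition kn_quotient (X : Type) (q : G -> X) (x : T) (y : X) : R :=
  Psi x (xget 1%g [set g | q g = y])^-1%g.

Definition kn_P6 (e : nat) (X : manifoldType 'rV[R]_e) (q : G -> X)
    (h : X -> 'rV[R]_e -> 'rV[R]_e -> R) : Prop :=
  forall x, globally_lipschitz h (kn_quotient q x).

End KempfNess.

(* M with its subspace topology; the base point is only there because the
   library's measurable types are pointed *)
Definition subspace_at (T : topologicalType) (M : set T) (m0 : M) : Type := M.

HB.instance Definition _ (T : topologicalType) (M : set T) (m0 : M) :=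
  Topological.on (subspace_at m0).
HB.instance Definition _ (T : topologicalType) (M : set T) (m0 : M) :=
  isPointed.Build (subspace_at m0) m0.

Definition sub_action (G T : Type) (M : set T) (a : G -> T -> T)
    (aM : forall g x, M x -> M (a g x)) (g : G) (x : M) : M :=
  exist _ (a g (set_val x)) (mem_set (aM g _ (set_valP x))).

Definition borelType (T : ptopologicalType) := g_sigma_algebraType (@open T).

(* Library measures are functions on all subsets; requiring the value 0 outside
   the Borel sets makes Leibniz equality the equality of Borel measures. *)
Record borel_prob (R : realType) (T : ptopologicalType) := BorelProb {
  bp_measure :> probability (borelType T) R;
  bp_outside : forall A : set (borelType T), ~ measurable A ->
    bp_measure A = 0%E }.

HB.instance Definition _ (R : realType) (T : ptopologicalType) :=
  gen_eqMixin (borel_prob R T).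
HB.instance Definition _ (R : realType) (T : ptopologicalType) :=
  gen_choiceMixin (borel_prob R T).

(* integrals of the continuous functions on T *)
Definition bp_eval (R : realType) (T : ptopologicalType) (nu : borel_prob R T) :
    prod_topology (fun _ : {f : T -> R | continuous f} => R) :=
  fun f => \int[bp_measure nu]_x (sval f x).

(* the weak topology *)
HB.instance Definition _ (R : realType) (T : ptopologicalType) :=
  Topological.copy (borel_prob R T) (initial_topology (@bp_eval R T)).

(* the push-forward of nu by f, for f Borel *)
Definition bp_push (R : realType) (T : ptopologicalType) (f : T -> T)
    (nu : borel_prob R T) : borel_prob R T :=
  xget nu [set nu' : borel_prob R T | forall A : set (borelType T),
    measurable A ->
    bp_measure nu' A =
      pushforward (bp_measure nu) (f : borelType T -> borelType T) A].

Definition bp_vint (R : realType) (d : nat) (T : ptopologicalType)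
    (nu : borel_prob R T) (f : T -> 'rV[R]_d) : 'rV[R]_d :=
  \row_j \int[bp_measure nu]_x (f x 0 j).

Definition Psi_prob (R : realType) (T : ptopologicalType) (G : Type)
    (Psi : T -> G -> R) (nu : borel_prob R T) (g : G) : R :=
  \int[bp_measure nu]_x (Psi x g).

(* Main.v *)
(* Along a smooth family in G, the derivatives of Psi^M(x, .) are polynomial in the right
   logarithmic derivative of the family and in functions x |-> mu(g x)^b, hence jointly
   continuous.  As M is compact one may differentiate under the integral sign, so that
   (P1)-(P5) pass from points to measures.  In (P3), the second derivative at 0 of
   t |-> Psi^P(nu, exp(t v)) is the integral of a nonnegative continuous function; if it is 0,
   then exp(R v) fixes nu-almost every point, hence nu.  Conversely, if exp(R v) fixes nu, the
   function is additive in t.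

   For (P6), the speed of a C^1 curve in X = G/K is the norm of the p-part of the right
   logarithmic derivative of the inverse of a local lift to G, so by Cauchy-Schwarz the
   derivative of psi_nu along the curve is at most sup |mu_p| times the speed.

   Finally, let exp(R beta) fix nu and write beta = i b.  For nu-almost every x, exp(R beta)
   fixes x; since the action is holomorphic so does exp(R b), and equivariance of mu gives
   mu(x)([b, xi]) = 0 for all xi.  Integrating, F(nu) is orthogonal to [beta, [beta, F(nu)]],
   so [beta, F(nu)], which lies in k, is isotropic for a form that is negative definite
   there. *)

Require Import Defs.
From HB Require Import structures.
From mathcomp Require Import all_boot all_order all_algebra.
From mathcomp Require Import all_classical all_reals all_analysis.
From mathcomp Require Import measurable_realfun.

Set Implicit Arguments.
Unset Strict Implicit.
Unset Printing Implicit Defensive.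

Import Order.TTheory GRing.Theory Num.Theory.
Import numFieldNormedType.Exports.

Local Open Scope classical_set_scope.
Local Open Scope ring_scope.

(** * C^k maps between finite dimensional spaces *)

(** [M] is a mere compact subset of [Z], so nothing can be differentiated in the point x. Regularity
    is therefore recorded by [jCk]: derivatives are taken in the other variable alone, and each is
    required to be continuous jointly with x. For the gradient map this comes from [Z]: if the
    p-part of w is i b, its pairing with mu_p(g x) is mu(g x)(b), the restriction of a function
    smooth on [Z]. The Kempf-Ness function has no such extension; its regularity is rebuilt from its
    differential.

    Smoothness is stated through iterated directional derivatives, which do not by themselves yield
    a chain rule. Finite dimension does, hence the class [finDim] in most hypotheses. On manifolds
    everything is phrased for plots, that is C^k families with values in the manifold, so that
    identities in a Lie group become identities between families, differentiated at one point.

    Compactness lets uniform estimates in x replace dominated convergence, and together with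
    separation and a countable base it makes a Borel probability determined by the integrals of
    continuous functions. *)

Definition linear_of (R : pzRingType) (V W : lmodType R) (f : V -> W)
  (lf : linear f) : {linear V -> W} :=
  HB.pack f (GRing.isLinear.Build _ _ _ _ f lf).

Section LinearFunctions.
Context (R : pzRingType) (V W : lmodType R) (l : V -> W) (ll : linear l).

Lemma linfD u v : l (u + v) = l u + l v.
Proof. exact: (raddfD (linear_of ll)). Qed.

Lemma linfZ a v : l (a *: v) = a *: l v.
Proof. exact: (linearZ_LR (linear_of ll)). Qed.

Lemma linfN v : l (- v) = - l v.
Proof. exact: (raddfN (linear_of ll)). Qed.

Lemma linf0 : l 0 = 0.
Proof. exact: (raddf0 (linear_of ll)). Qed.

Lemma linf_sum (I : Type) (r : seq I) (P : pred I) (F : I -> V) :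
  l (\sum_(i <- r | P i) F i) = \sum_(i <- r | P i) l (F i).
Proof. exact: (raddf_sum (linear_of ll)). Qed.

End LinearFunctions.

Section Derive.
Context (R : realType).
Implicit Types V W : normedModType R.

Lemma derive_line V W (f : V -> W) (y v : V) (s : R) :
  (fun h : R => h^-1 *: (f (y + (h *: 1 + s) *: v) - f (y + s *: v))) =
  (fun h : R => h^-1 *: (f (h *: v + (y + s *: v)) - f (y + s *: v))).
Proof.
apply/funext => h; congr (_ *: (f _ - _)).
by rewrite scalerDl addrCA [h *: 1]mulr1.
Qed.

Lemma derivable_line V W (f : V -> W) (y v : V) (s : R) :
  derivable (fun t : R => f (y + t *: v)) s 1 <-> derivable f (y + s *: v) v.
Proof. by rewrite /derivable derive_line. Qed.

Lemma derive_lineE V W (f : V -> W) (y v : V) (s : R) :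
  'D_1 (fun t : R => f (y + t *: v)) s = 'D_v f (y + s *: v).
Proof. by rewrite /derive derive_line. Qed.

(** The point [s] is located only by [|s| <= |t|], which allows [t] of either sign; derivability is
    asked on the same range, so that the lemma applies inside a ball. *)
Lemma mvt_line V (f : V -> R) (y v : V) (t : R) :
  (forall s : R, `|s| <= `|t| -> derivable f (y + s *: v) v) ->
  exists2 s, `|s| <= `|t| & f (y + t *: v) - f y = t * 'D_v f (y + s *: v).
Proof.
move=> df; pose g := fun s : R => f (y + s *: v).
have dg (s : R) : `|s| <= `|t| -> is_derive s 1 g ('D_v f (y + s *: v)).
  move=> st; apply: DeriveDef; first by apply/derivable_line; exact: df.
  exact: derive_lineE.
have cg (s : R) : `|s| <= `|t| -> {for s, continuous g}.
  move=> st; apply: differentiable_continuous; apply/derivable1_diffP.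
  by have [] := dg s st.
have cgi (a b : R) : (forall s, s \in `[a, b] -> `|s| <= `|t|) ->
    {within `[a, b], continuous g}.
  move=> ab; apply: continuous_in_subspaceT => s /set_mem sab.
  exact/cg/ab.
have [t0|t0] := leP 0 t.
  have st (s : R) : s \in `[0, t] -> `|s| <= `|t|.
    by rewrite in_itv/= => /andP[s0 st]; rewrite !ger0_norm.
  have [c ct gt] := MVT_segment t0 (fun s h => dg s (st s (subset_itv_oo_cc h)))
    (cgi _ _ st).
  exists c; first exact: st.
  by rewrite mulrC -[t in RHS]subr0 -gt /g scale0r addr0.
have st (s : R) : s \in `[t, 0] -> `|s| <= `|t|.
  by rewrite in_itv/= => /andP[ts s0]; rewrite !ler0_norm ?lerN2// ltW.
have [c ct gt] := MVT_segment (ltW t0)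
  (fun s h => dg s (st s (subset_itv_oo_cc h))) (cgi _ _ st).
exists c; first exact: st.
move: gt; rewrite sub0r mulrN /g scale0r addr0 => /eqP.
by rewrite -eqr_oppLR opprB mulrC => /eqP.
Qed.

Lemma is_derive_linear V W W' (l : {linear W -> W'}) (f : V -> W) x v df :
  continuous l -> is_derive x v f df -> is_derive x v (l \o f) (l df).
Proof.
move=> cl [dfv <-].
have E : (fun h : R => h^-1 *: (((l \o f) \o shift x) (h *: v) - (l \o f) x)) =
    l \o (fun h => h^-1 *: ((f \o shift x) (h *: v) - f x)).
  by apply/funext => h /=; rewrite -(linearB l) (linearZ_LR l).
have C : l \o (fun h => h^-1 *: ((f \o shift x) (h *: v) - f x)) @ 0^' -->
    l ('D_v f x) by apply: continuous_cvg => //; exact: cl.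
by split; rewrite /derivable /derive E; [apply/cvg_ex; exists (l ('D_v f x))
  | apply: cvg_lim].
Qed.

Lemma is_derive_scale V W (a : V -> R) (f : V -> W) x v da df :
  is_derive x v a da -> is_derive x v f df ->
  is_derive x v (fun y => a y *: f y) (a x *: df + da *: f x).
Proof.
move=> [dav <-] [dfv <-].
pose qa (h : R) := h^-1 *: ((a \o shift x) (h *: v) - a x).
pose qf (h : R) := h^-1 *: ((f \o shift x) (h *: v) - f x).
(* Expanding both factors around [x] leaves the remainder [(h * qa h) *: qf h], which tends to 0.
   Continuity of [a] or [f] at [x] is thus avoided; derivability in the single direction [v] would
   not give it. *)
have C : (fun h => a x *: qf h + qa h *: f x + (h * qa h) *: qf h) @ 0^' -->
    a x *: 'D_v f x + 'D_v a x *: f x + (0 * 'D_v a x) *: 'D_v f x.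
  apply: cvgD; first apply: cvgD.
  - exact: cvgZl_tmp.
  - exact: cvgZr_tmp.
  - apply: cvgZ => //; apply: (@cvgM R _ _ _ id) => //.
    exact: cvg_within.
rewrite mul0r scale0r addr0 in C.
set g := fun y => _.
have E : (fun h => a x *: qf h + qa h *: f x + (h * qa h) *: qf h) =
   (fun h : R => h^-1 *: ((g \o shift x) (h *: v) - g x)).
  apply/funext => h; rewrite /qa /qf /g /=.
  have [->|h0] := eqVneq h 0.
    by rewrite invr0 !scale0r mul0r scale0r scaler0 !addr0.
  set a' := a (_ + _); set f' := f (_ + _).
  rewrite -[h^-1 *: (a' - a x)]/(h^-1 * (a' - a x)).
  rewrite mulrA mulfV// mul1r scalerA [a x * _]mulrC -!scalerA -!scalerDr.
  rewrite !scalerA [(a' - a x) / h]mulrC -!scalerA -!scalerDr; congr (_ *: _).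
  rewrite addrAC -scalerDl [a x + _]addrC subrK scalerBr scalerBl.
  by rewrite addrA subrK.
by split; rewrite /derivable /derive -E; [apply/cvg_ex; eexists; exact: C
  | apply: cvg_lim].
Qed.

End Derive.

(** A basis with continuous coordinate functionals reduces vector-valued statements to real ones and
    a differential to finitely many partial derivatives. As a class it is inferred for [R], for row
    vectors and for products. *)
Class finDim (R : realType) (V : normedModType R) : Prop := FinDim {
  findim_basis : exists n (b : 'I_n -> V) (c : 'I_n -> {linear V -> R}),
    (forall i, continuous (c i)) /\ (forall v, v = \sum_i c i v *: b i) }.

#[global] Instance finDim_R (R : realType) : finDim (R^o).
Proof.
split; exists 1%N, (fun=> 1), (fun=> idfun); split=> [_ x|v]; first exact: cvg_id.
by rewrite big_ord1 /= [_ *: _]mulr1.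
Qed.

(** The field with the normed module structure inferred from [R] itself; instance search does not
    identify it with [R^o]. *)
#[global] Instance finDim_real (R : realType) :
  @finDim R (Real_sort__canonical__normed_module_NormedModule R).
Proof.
split; exists 1%N, (fun=> 1), (fun=> idfun); split=> [_ x|v]; first exact: cvg_id.
by rewrite big_ord1 /= [_ *: _]mulr1.
Qed.

#[global] Instance finDim_rV (R : realType) n : finDim 'rV[R]_n.
Proof.
pose c (i : 'I_n) (v : 'rV[R]_n) : R := v 0 i.
have lc i : linear (c i) by move=> a u v; rewrite /c !mxE.
pose C i : {linear 'rV[R]_n -> R} :=
  linear_of (lc i).
split; exists n, (fun i => delta_mx 0 i), C; split=> [i x|v].
  exact: coord_continuous.
exact: row_sum_delta.
Qed.

#[global] Instance finDim_prod (R : realType) (V W : normedModType R) :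
  finDim V -> finDim W -> finDim (V * W)%type.
Proof.
move=> [[n [b [c [cc bc]]]]] [[n' [b' [c' [cc' bc']]]]].
pose B (i : 'I_(n + n')) : V * W :=
  match fintype.split i with inl j => (b j, 0) | inr j => (0, b' j) end.
pose C (i : 'I_(n + n')) (p : V * W) : R :=
  match fintype.split i with inl j => c j p.1 | inr j => c' j p.2 end.
have lC i : linear (C i).
  by move=> a u v; rewrite /C; case: (fintype.split i) => j; rewrite linearP.
pose C' i : {linear (V * W)%type -> R} :=
  linear_of (lC i).
split; exists (n + n')%N, B, C'; split=> [i x|[v w]].
  rewrite /= /C; case: (fintype.split i) => j.
    by apply: (@continuous_comp _ _ _ fst (c j)); [exact: cvg_fst|exact: cc].
  by apply: (@continuous_comp _ _ _ snd (c' j)); [exact: cvg_snd|exact: cc'].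
rewrite big_split_ord /=.
have -> : \sum_(i < n) C (lshift n' i) (v, w) *: B (lshift n' i) = (v, 0).
  rewrite [in RHS](bc v); elim/big_rec2: _ => // i y1 y2 _ ->.
  rewrite /C /B (unsplitK (inl i) : fintype.split (lshift n' i) = inl i).
  by congr pair => /=; rewrite scaler0 addr0.
have -> : \sum_(i < n') C (rshift n i) (v, w) *: B (rshift n i) = (0, w).
  rewrite [in RHS](bc' w); elim/big_rec2: _ => // i y1 y2 _ ->.
  rewrite /C /B (unsplitK (inr i) : fintype.split (rshift n i) = inr i).
  by congr pair => /=; rewrite scaler0 addr0.
by congr pair; rewrite /= ?addr0 ?add0r.
Qed.

Section Ck.
Context (R : realType).
Implicit Types V W : normedModType R.

Lemma Ck_continuous V W k (O : set V) (f : V -> W) :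
  Ck k O f -> forall x, O x -> {for x, continuous f}.
Proof. by case: k => [|k] []. Qed.

Lemma Ck_derivable V W k (O : set V) (f : V -> W) :
  Ck k.+1 O f -> forall x v, O x -> derivable f x v.
Proof. by move=> [_ +] x v Ox => /(_ v)[+ _]; apply. Qed.

Lemma Ck_derive V W k (O : set V) (f : V -> W) v :
  Ck k.+1 O f -> Ck k O ('D_v f).
Proof. by move=> [_ +] => /(_ v)[]. Qed.

Lemma CkS V W k (O : set V) (f : V -> W) : Ck k.+1 O f -> Ck k O f.
Proof.
elim: k f => [|k IH] f Cf; first by split=> //; exact: Ck_continuous Cf.
split=> [|v]; first exact: Ck_continuous Cf.
split=> [x Ox|]; first exact: Ck_derivable Cf _ _ Ox.
exact/IH/Ck_derive.
Qed.

Lemma Ck_le V W j k (O : set V) (f : V -> W) : (j <= k)%N -> Ck k O f -> Ck j O f.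
Proof.
elim: k => [|k IH]; first by rewrite leqn0 => /eqP ->.
by rewrite leq_eqVlt => /predU1P[->//|/IH H] /CkS.
Qed.

Lemma Ck_sub V W k (O O' : set V) (f : V -> W) :
  O' `<=` O -> Ck k O f -> Ck k O' f.
Proof.
move=> OO'; elim: k f => [|k IH] f Cf.
  by split=> // x /OO' Ox; exact: Ck_continuous Cf _ Ox.
split=> [x /OO' Ox|v]; first exact: Ck_continuous Cf _ Ox.
split=> [x /OO' Ox|]; first exact: Ck_derivable Cf _ _ Ox.
exact/IH/Ck_derive.
Qed.

Lemma Ck_local V W k (O : set V) (f : V -> W) :
  (forall x, O x -> exists O', O' x /\ Ck k O' f) -> Ck k O f.
Proof.
elim: k f => [|k IH] f Cf.
  split=> // x /Cf[P [Px CP]]; exact: Ck_continuous CP _ Px.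
split=> [x /Cf[P [Px CP]]|v]; first exact: Ck_continuous CP _ Px.
split=> [x /Cf[P [Px CP]]|]; first exact: Ck_derivable CP _ _ Px.
by apply: IH => x /Cf[P [Px CP]]; exists P; split=> //; exact: Ck_derive.
Qed.

Lemma open_near V (O : set V) x : open O -> O x -> \forall y \near x, O y.
Proof. by move=> oO Ox; exact: open_nbhs_nbhs. Qed.

Lemma Ck_eq V W k (O : set V) (f g : V -> W) :
  open O -> (forall x, O x -> f x = g x) -> Ck k O f -> Ck k O g.
Proof.
move=> oO; elim: k f g => [|k IH] f g fg Cf.
  split=> // x Ox; rewrite /prop_for /continuous_at -fg//.
  apply: cvg_trans (Ck_continuous Cf Ox).
  by apply: near_eq_cvg; near do apply: fg; exact: open_near.
have nfg x : O x -> \forall y \near x, f y = g y.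
  by move=> Ox; near do apply: fg; exact: open_near.
split=> [x Ox|v].
  rewrite /prop_for /continuous_at -fg//.
  apply: cvg_trans (Ck_continuous Cf Ox).
  exact/near_eq_cvg/nfg.
split=> [x Ox|].
  exact: near_eq_derivable (nfg _ Ox) (Ck_derivable Cf Ox).
apply: IH (Ck_derive v Cf) => x Ox.
exact/near_eq_derive/nfg.
Unshelve. all: by end_near. Qed.

Lemma Ck_cst V W k (O : set V) (w : W) : Ck k O (cst w).
Proof.
elim: k w => [|k IH] w; first by split=> // x _; exact: cst_continuous.
split=> [x _|v]; first exact: cst_continuous.
split=> [x _|]; first exact: derivable_cst.
suff -> : 'D_v (cst w) = cst (0 : W) :> (V -> W) by exact: IH.
by apply/funext => x; rewrite derive_cst.
Qed.

Lemma CkD V W k (O : set V) (f g : V -> W) :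
  open O -> Ck k O f -> Ck k O g -> Ck k O (fun x => f x + g x).
Proof.
move=> oO; elim: k f g => [|k IH] f g Cf Cg.
  by split=> // x Ox; apply: cvgD; [exact: Ck_continuous Cf _ Ox
    | exact: Ck_continuous Cg _ Ox].
split=> [x Ox|v].
  by apply: cvgD; [exact: Ck_continuous Cf _ Ox| exact: Ck_continuous Cg _ Ox].
split=> [x Ox|].
  by apply: derivableD; [exact: Ck_derivable Cf _ _ Ox
    | exact: Ck_derivable Cg _ _ Ox].
apply: Ck_eq (IH _ _ (Ck_derive v Cf) (Ck_derive v Cg)) => // x Ox.
by rewrite deriveD//; [exact: Ck_derivable Cf _ _ Ox
    | exact: Ck_derivable Cg _ _ Ox].
Qed.

Lemma Ck_sum V W k (O : set V) n (f : 'I_n -> V -> W) :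
  open O -> (forall i, Ck k O (f i)) -> Ck k O (fun x => \sum_i f i x).
Proof.
move=> oO; elim: n f => [|n IH] f Cf.
  by apply: Ck_eq (Ck_cst k O 0) => // x _; rewrite big_ord0.
apply: Ck_eq (CkD oO (IH (fun i => f (widen_ord (leqnSn n) i)) _) (Cf ord_max)).
- by [].
- by move=> x _; rewrite big_ord_recr.
- by move=> i; exact: Cf.
Qed.

Lemma Ck_scale V W k (O : set V) (a : V -> R) (f : V -> W) :
  open O -> Ck k O a -> Ck k O f -> Ck k O (fun x => a x *: f x).
Proof.
move=> oO; elim: k a f => [|k IH] a f Ca Cf.
  by split=> // x Ox; apply: cvgZ; [exact: Ck_continuous Ca _ Ox
    | exact: Ck_continuous Cf _ Ox].
have H x v : O x -> is_derive x v (fun x => a x *: f x)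
    (a x *: 'D_v f x + 'D_v a x *: f x).
  by move=> Ox; apply: is_derive_scale; apply: derivableP;
    [exact: Ck_derivable Ca _ _ Ox | exact: Ck_derivable Cf _ _ Ox].
split=> [x Ox|v].
  by apply: cvgZ; [exact: Ck_continuous Ca _ Ox| exact: Ck_continuous Cf _ Ox].
split=> [x Ox|]; first by have [] := H x v Ox.
have C := CkD oO (IH _ _ (CkS Ca) (Ck_derive v Cf))
  (IH _ _ (Ck_derive v Ca) (CkS Cf)).
by apply: Ck_eq C => // x Ox; have [] := H x v Ox.
Qed.

Lemma Ck_lincomp V W W' k (O : set V) (l : {linear W -> W'}) (f : V -> W) :
  continuous l -> open O -> Ck k O f -> Ck k O (l \o f).
Proof.
move=> cl oO; elim: k f => [|k IH] f Cf.
  by split=> // x Ox; apply: continuous_comp;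
    [exact: Ck_continuous Cf _ Ox|exact: cl].
have H x v : O x -> is_derive x v (l \o f) (l ('D_v f x)).
  by move=> Ox; apply: is_derive_linear => //; apply: derivableP;
    exact: Ck_derivable Cf _ _ Ox.
split=> [x Ox|v].
  by apply: continuous_comp; [exact: Ck_continuous Cf _ Ox|exact: cl].
split=> [x Ox|]; first by have [] := H x v Ox.
by apply: Ck_eq (IH _ (Ck_derive v Cf)) => // x Ox; have [] := H x v Ox.
Qed.

Lemma Ck_id V k (O : set V) : Ck k O id.
Proof.
case: k => [|k]; first by split=> // x _; exact: cvg_id.
split=> [x _|v]; first exact: cvg_id.
split=> [x _|]; first exact: derivable_id.
suff -> : 'D_v id = cst v :> (V -> V) by exact: Ck_cst.
by apply/funext => x; rewrite derive_id.
Qed.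

Lemma Ck_linear V W k (O : set V) (l : {linear V -> W}) :
  continuous l -> open O -> Ck k O l.
Proof. by move=> cl oO; exact: (Ck_lincomp cl oO (Ck_id k O)). Qed.

End Ck.

(** * Total differentials and the chain rule in finite dimension *)

Section ChainRule.
Context (R : realType).
Implicit Types U V W : normedModType R.

(** Continuous partial derivatives give a total differential: the increment telescopes along the
    partial sums [p j] of the coordinate expansion of [h], the mean value theorem treats each
    segment, and continuity of the partials at [x] bounds the error. *)
Lemma C1_differentiable_scalar V {fV : finDim V} (O : set V) (f : V -> R) x :
  open O -> Ck 1 O f -> O x -> differentiable f x.
Proof.
move=> oO Cf Ox; have [[n [b [c [cc bc]]]]] := fV.
pose d (h : V) : R := \sum_i c i h * 'D_(b i) f x.
have ld : linear d.
  move=> a u v; rewrite /d scaler_sumr -big_split; apply: eq_bigr => i _ /=.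
  by rewrite linearP mulrDl [_ *: (_ * _)]mulrA.
pose df : {linear V -> R} := linear_of ld.
have cd : continuous df.
  move=> y; apply: (@Ck_continuous R V R 0 setT d) => //.
  apply: Ck_sum; first exact: openT.
  move=> i; apply: Ck_scale; [exact: openT| |exact: Ck_cst].
  exact: (Ck_linear _ (cc i) openT).
suff E : f \o shift x = cst (f x) + df +o_ 0 id.
  by apply/diff_locallyP; rewrite (diff_unique cd E).
apply/eqaddoP => _/posnumP[eps].
have kP i : exists k : R, 0 <= k /\ forall h, `|c i h| <= k * `|h|.
  by have [k k0 H] := linear_lipschitz (cc i); exists k; split=> //; exact: ltW.
have [k kH] := choice kP.
(* With [k i] a Lipschitz constant of the i-th coordinate, [K] controls the accumulated error and
   [Bm] the norm of the intermediate points; later [+ 1] keeps the divisors positive. *)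
pose K := \sum_i k i; pose Bm := \sum_i k i * `|b i|.
have K0 : 0 <= K by apply: sumr_ge0 => i _; have [] := kH i.
have Bm0 : 0 <= Bm.
  by apply: sumr_ge0 => i _; rewrite mulr_ge0//; have [] := kH i.
have eta0 : 0 < eps%:num / (K + 1) by rewrite divr_gt0// ltr_wpDl.
have H : \forall y \near x, O y /\
    forall i : 'I_n, `|'D_(b i) f x - 'D_(b i) f y| <= eps%:num / (K + 1).
  apply: filterI; first exact: open_near.
  apply: filter_forall => i.
  have /cvgrPdist_le := Ck_continuous (Ck_derive (b i) Cf) Ox.
  exact.
have /nbhs_ballP[del /= del0 Hd] := H.
near=> h.
have hdel : (Bm + 1) * `|h| < del.
  rewrite mulrC -ltr_pdivlMr ?ltr_wpDl//.
  by near: h; apply: nbhs0_lt; rewrite divr_gt0// ltr_wpDl.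
pose p (j : nat) := \sum_(i < n | (i < j)%N) c i h *: b i.
have pS (j : 'I_n) : p j.+1 = p j + c j h *: b j.
  rewrite /p (bigD1 j)//= addrC; congr (_ + _); apply: eq_bigl => i.
  by rewrite ltnS ltn_neqAle andbC.
have pb (j : 'I_n) (s : R) : `|s| <= `|c j h| -> `|p j + s *: b j| < del.
  move=> sc; apply: le_lt_trans hdel.
  have : `|p j + s *: b j| <= \sum_(i < n) `|c i h| * `|b i|.
    rewrite (bigID (fun i : 'I_n => (i < j)%N)) /=.
    apply: (le_trans (ler_normD _ _)); apply: lerD.
      apply: (le_trans (ler_norm_sum _ _ _)).
      by apply: ler_sum => i _; rewrite normrZ.
    rewrite (bigD1 j)/= ?ltnn// normrZ.
    apply: (le_trans (ler_wpM2r _ sc)) => //.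
    by rewrite lerDl sumr_ge0// => i _; rewrite mulr_ge0.
  move/le_trans; apply.
  rewrite mulrDl mul1r; apply: (@le_trans _ _ (Bm * `|h|)); last by rewrite lerDl.
  rewrite /Bm mulr_suml; apply: ler_sum => i _.
  by rewrite mulrAC ler_wpM2r//; have [] := kH i.
have step (j : 'I_n) : `|f (x + p j.+1) - f (x + p j) - c j h * 'D_(b j) f x| <=
    k j * `|h| * (eps%:num / (K + 1)).
  have inb (s : R) : `|s| <= `|c j h| -> ball x del (x + p j + s *: b j).
    move=> /pb; rewrite -ball_normE /ball_/= -addrA opprD addNKr normrN.
    exact.
  have [s sc E] := @mvt_line R V f (x + p j) (b j) (c j h)
    (fun s sc => Ck_derivable Cf (Hd _ (inb s sc)).1).
  rewrite pS addrA E -mulrBr normrM; have [kj /(_ h) ch] := kH j.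
  apply: ler_pM => //; rewrite distrC.
  by have [_] := Hd _ (inb s sc); exact.
rewrite /= -[(_ - _) h]/(f (h + x) - (f x + d h)).
have -> : f (h + x) - (f x + d h) =
    \sum_(j < n) (f (x + p j.+1) - f (x + p j) - c j h * 'D_(b j) f x).
  rewrite big_split /= sumrN -/(d h) opprD addrA; congr (_ - _).
  rewrite -(big_mkord xpredT (fun j => f (x + p j.+1) - f (x + p j))).
  have pn : p n = h.
    by rewrite [RHS]bc /p; apply: eq_bigl => i; rewrite ltn_ord.
  have p0 : p 0%N = 0 by rewrite /p big_pred0.
  by rewrite (telescope_sumr _ (leq0n n)) pn p0 addr0 [h + x]addrC.
apply: (le_trans (ler_norm_sum _ _ _)); apply: (le_trans (ler_sum _ _)) => [j _|].
  exact: step.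
rewrite -mulr_suml -mulr_suml -/K mulrAC; apply: ler_wpM2r => //.
rewrite mulrA ler_pdivrMr ?ltr_wpDl// mulrC ler_wpM2l// lerDl.
exact: ler01.
Unshelve. all: by end_near. Qed.

Lemma C1_differentiable V W {fV : finDim V} {fW : finDim W} (O : set V)
  (f : V -> W) x : open O -> Ck 1 O f -> O x -> differentiable f x.
Proof.
move=> oO Cf Ox; have [[n [b [c [cc bc]]]]] := fW.
have -> : f = \sum_i (fun y => c i (f y) *: b i).
  by apply/funext => y; rewrite fct_sumE; exact: bc.
apply: differentiable_sum => i.
apply: (@differentiableZl R V W (c i \o f)).
apply: (C1_differentiable_scalar oO) => //.
exact: (Ck_lincomp (cc i)).
Qed.

Lemma is_derive_comp U V W (g : V -> W) (f : U -> V) x v df :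
  differentiable g (f x) -> is_derive x v f df ->
  is_derive x v (g \o f) ('d g (f x) df).
Proof.
move=> dg [dfv <-]; pose phi (t : R) := f (x + t *: v).
have phi0 : phi 0 = f x by rewrite /phi scale0r addr0.
have dphi : differentiable phi 0.
  by apply/derivable1_diffP/derivable_line; rewrite scale0r addr0.
have Dphi : 'd phi 0 1 = 'D_v f x.
  by rewrite -deriveE// /phi derive_lineE scale0r addr0.
have dgp : differentiable g (phi 0) by rewrite phi0.
have dgphi : differentiable (g \o phi) 0 by exact: differentiable_comp.
split.
  have /derivable1_diffP : differentiable (g \o phi) 0 by [].
  by move/(@derivable_line R U W (g \o f)); rewrite scale0r addr0.
have := @derive_lineE R U W (g \o f) x v 0; rewrite scale0r addr0 => <-.
rewrite -[fun t => _]/(g \o phi) deriveE// diff_comp//=.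
by rewrite Dphi phi0.
Qed.

Lemma derive_linear V W {fV : finDim V} {fW : finDim W} (O : set V) (f : V -> W) x :
  open O -> Ck 1 O f -> O x -> linear (fun v => 'D_v f x).
Proof.
move=> oO Cf Ox a u v.
have df : differentiable f x by exact: C1_differentiable Ox.
by rewrite !deriveE// linearP.
Qed.

Lemma linear_continuous_findim V W {fV : finDim V} (l : V -> W) :
  linear l -> continuous l.
Proof.
move=> ll x; have [[n [b [c [cc bc]]]]] := fV.
have El v : l v = \sum_i c i v *: l (b i).
  rewrite -[LHS]/(linear_of ll v) {1}(bc v) linear_sum.
  by apply: eq_bigr => i _; exact: (linearZ_LR (linear_of ll)).
have -> : l = (fun v => \sum_i c i v *: l (b i)) by apply/funext.
apply: (@Ck_continuous R V W 0 setT _) => //.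
apply: Ck_sum => [|i]; first exact: openT.
apply: Ck_scale; [exact: openT| |exact: Ck_cst].
exact: (Ck_linear _ (cc i) openT).
Qed.

Lemma is_derive_linearf U V W {fV : finDim V} (l : V -> W) (f : U -> V) x v df :
  linear l -> is_derive x v f df -> is_derive x v (fun y => l (f y)) (l df).
Proof.
move=> ll; apply: (is_derive_linear (l := linear_of ll)).
exact: linear_continuous_findim.
Qed.

(** The differential of [g] is applied to the moving vector ['D_v f x]. Expanding that vector in a
    basis gives a sum of products of [C^k] factors in which [g] is differentiated only in fixed
    directions, so the induction on [k] closes. *)
Lemma Ck_comp U V W {fV : finDim V} {fW : finDim W} k (O : set U) (O' : set V)
  (g : V -> W) (f : U -> V) :
  open O -> open O' -> (forall x, O x -> O' (f x)) ->
  Ck k O f -> Ck k O' g -> Ck k O (g \o f).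
Proof.
move=> oO oO' ff; elim: k g f ff => [|k IH] g f ff Cf Cg.
  split=> // x Ox; apply: continuous_comp; first exact: Ck_continuous Cf _ Ox.
  by apply: (Ck_continuous Cg); exact: ff.
have [[n [b [c [cc bc]]]]] := fV.
have H x v : O x -> is_derive x v (g \o f)
    (\sum_i c i ('D_v f x) *: 'D_(b i) g (f x)).
  move=> Ox; have dg : differentiable g (f x).
    apply: (C1_differentiable oO') (ff _ Ox).
    by apply: (@Ck_le R V W 1 k.+1).
  have := is_derive_comp dg (derivableP (Ck_derivable (v:=v) Cf Ox)).
  rewrite {1}(bc ('D_v f x)) linear_sum; congr is_derive.
  by apply: eq_bigr => i _; rewrite linearZ (deriveE (b i) dg).
split=> [x Ox|v].
  apply: continuous_comp; first exact: Ck_continuous Cf _ Ox.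
  by apply: (Ck_continuous Cg); exact: ff.
split=> [x Ox|]; first by have [] := H x v Ox.
apply: (@Ck_eq R U W _ O (fun x => \sum_i c i ('D_v f x) *: 'D_(b i) g (f x))) => //.
  by move=> x Ox; have [] := H x v Ox.
apply: Ck_sum => // i; apply: Ck_scale => //.
  exact: (Ck_lincomp (cc i) oO (Ck_derive v Cf)).
exact: (IH ('D_(b i) g) f ff (CkS Cf) (Ck_derive (b i) Cg)).
Qed.

Lemma Ck_pair U V W k (O : set U) (f : U -> V) (g : U -> W) :
  open O -> Ck k O f -> Ck k O g -> Ck k O (fun x => (f x, g x)).
Proof.
move=> oO Cf Cg.
have l1 : linear (fun v : V => (v, 0 : W)).
  by move=> a u v; congr pair => /=; rewrite scaler0 addr0.
have l2 : linear (fun w : W => (0 : V, w)).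
  by move=> a u v; congr pair => /=; rewrite scaler0 addr0.
have c1 : continuous (linear_of l1).
  by move=> v; apply: cvg_pair; [exact: cvg_id|exact: cvg_cst].
have c2 : continuous (linear_of l2).
  by move=> v; apply: cvg_pair; [exact: cvg_cst|exact: cvg_id].
apply: Ck_eq (CkD oO (Ck_lincomp c1 oO Cf) (Ck_lincomp c2 oO Cg)) => // x _.
by congr pair => /=; rewrite ?addr0 ?add0r.
Qed.

Lemma Ck_fst U V k (O : set (U * V)%type) : open O -> Ck k O fst.
Proof.
move=> oO; have l : linear (@fst U V) by [].
by apply: (@Ck_linear R _ _ k O (linear_of l)) => // x; exact: cvg_fst.
Qed.

Lemma Ck_snd U V k (O : set (U * V)%type) : open O -> Ck k O snd.
Proof.
move=> oO; have l : linear (@snd U V) by [].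
by apply: (@Ck_linear R _ _ k O (linear_of l)) => // x; exact: cvg_snd.
Qed.

End ChainRule.

(** * Smooth families in manifolds *)

Section Plots.
Context (R : realType).

(** A C^k family in [M] parametrised by an open set of a normed space, read in all charts. Unlike
    [smooth_map], the source is linear and the order finite, so derivatives of families can be
    counted. *)
Definition plot (E V : normedModType R) (M : manifoldType E) (k : nat)
    (O : set V) (f : V -> M) : Prop :=
  (forall x, O x -> {for x, continuous f}) /\
  forall c : chart E M, atlas c ->
    Ck k [set x | O x /\ cdom c (f x)] (Defs.coord c \o f).

(** The differential of a plot at [x], with values in the tangent space at [f x] as identified by
    the preferred chart there. *)
Definition pd (E V : normedModType R) (M : manifoldType E)
    (f : V -> M) (x u : V) : E :=
  'D_u (Defs.coord (chart_at (f x)) \o f) x.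

Section Charts.
Context (E : normedModType R) (M : manifoldType E).
Implicit Types c d : chart E M.

Lemma atlas_open c : atlas c -> open (cdom c).
Proof. by move=> /atlas_chart[]. Qed.

Lemma atlas_open_image c : atlas c -> open (cimage c).
Proof. by move=> /atlas_chart[]. Qed.

Lemma atlas_coordK c x : atlas c -> cdom c x -> param c (Defs.coord c x) = x.
Proof. by move=> /atlas_chart[_ _ + _ _]; exact. Qed.

Lemma atlas_coord_continuous c x : atlas c -> cdom c x ->
  {for x, continuous (Defs.coord c)}.
Proof. by move=> /atlas_chart[_ _ _ + _]; exact. Qed.

Lemma atlas_param_continuous c y : atlas c -> cimage c y ->
  {for y, continuous (param c)}.
Proof. by move=> /atlas_chart[_ _ _ _]; exact. Qed.

Lemma cimage_coord c x : cdom c x -> cimage c (Defs.coord c x).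
Proof. by exists x. Qed.

Lemma cdom_param c y : atlas c -> cimage c y -> cdom c (param c y).
Proof. by move=> ac [x cx <-]; rewrite atlas_coordK. Qed.

Lemma coord_paramK c y : atlas c -> cimage c y -> Defs.coord c (param c y) = y.
Proof. by move=> ac [x cx <-]; rewrite atlas_coordK. Qed.

End Charts.

Lemma open_preimage (V T : topologicalType) (O : set V) (Q : set T) (f : V -> T) :
  open O -> open Q -> (forall x, O x -> {for x, continuous f}) ->
  open [set x | O x /\ Q (f x)].
Proof.
move=> oO oQ cf; rewrite openE => x [Ox Qx] /=.
apply: filterI; first exact: open_nbhs_nbhs.
by apply: cf => //; exact: open_nbhs_nbhs.
Qed.

Section PlotTheory.
Context (E V : normedModType R) (M : manifoldType E).
Context {fE : finDim E}.
Implicit Types (O : set V) (f : V -> M).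

Lemma plot_continuous k O f : plot k O f ->
  forall x, O x -> {for x, continuous f}.
Proof. by case. Qed.

Lemma plot_open k O f (Q : set M) : open O -> open Q -> plot k O f ->
  open [set x | O x /\ Q (f x)].
Proof. by move=> oO oQ [cf _]; exact: open_preimage. Qed.

Lemma plot_coord k O f c : plot k O f -> atlas c ->
  Ck k [set x | O x /\ cdom c (f x)] (Defs.coord c \o f).
Proof. by move=> [_ +]; exact. Qed.

Lemma overlap_open (c d : chart E M) : atlas c -> atlas d -> open (overlap c d).
Proof.
move=> ac ad; apply: open_preimage; [exact: atlas_open_image|exact: atlas_open|].
by move=> x; exact: atlas_param_continuous.
Qed.

(** One chart near each point suffices because the changes of charts are smooth; continuity of [f]
    is recovered by composing its coordinates with [param]. *)
Lemma plot_intro k O f : open O ->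
  (forall x, O x -> exists P c, [/\ open P, P x, atlas c,
     (forall y, P y -> cdom c (f y)) & Ck k P (Defs.coord c \o f)]) ->
  plot k O f.
Proof.
move=> oO H.
have cf x : O x -> {for x, continuous f}.
  move=> /H[P [c [oP Px ac Pc Cf]]].
  have cp : {for x, continuous (param c \o (Defs.coord c \o f))}.
    apply: continuous_comp; first exact: Ck_continuous Cf _ Px.
    by apply: atlas_param_continuous => //; apply: cimage_coord; exact: Pc.
  rewrite /prop_for /continuous_at -(atlas_coordK ac (Pc _ Px)).
  apply: cvg_trans cp; apply: near_eq_cvg.
  near=> y; rewrite /= atlas_coordK//; apply: Pc; near: y.
  exact: open_near.
split=> // d ad; apply: Ck_local => x [Ox dfx].
have [P [c [oP Px ac Pc Cf]]] := H x Ox.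
exists [set y | (O `&` P) y /\ cdom d (f y)]; split=> //.
have oOP : open [set y | (O `&` P) y /\ cdom d (f y)].
  apply: open_preimage; [exact: openI|exact: atlas_open|].
  by move=> y [Oy _]; exact: cf.
apply: (@Ck_eq _ _ _ _ _ ((Defs.coord d \o param c) \o (Defs.coord c \o f))) => //.
  by move=> y [[_ Py] dy] /=; rewrite atlas_coordK//; exact: Pc.
apply: (@Ck_comp _ _ _ _ _ _ _ _ (overlap c d)) => //.
- exact: overlap_open.
- move=> y [[_ Py] dy]; split; first by apply: cimage_coord; exact: Pc.
  by rewrite /= atlas_coordK//; exact: Pc.
- by apply: Ck_sub Cf => y [[]].
- exact: atlas_smooth.
Unshelve. all: by end_near. Qed.

Lemma plot_intro_chart k O f c : open O -> atlas c ->
  (forall y, O y -> cdom c (f y)) -> Ck k O (Defs.coord c \o f) -> plot k O f.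
Proof. by move=> oO ac Oc Cf; apply: plot_intro => // x Ox; exists O, c. Qed.

Lemma plot_sub k O P f : P `<=` O -> plot k O f -> plot k P f.
Proof.
move=> PO [cf Cf]; split=> [x /PO|c ac]; first exact: cf.
by apply: Ck_sub (Cf c ac) => x [/PO].
Qed.

Lemma plot_le j k O f : (j <= k)%N -> plot k O f -> plot j O f.
Proof.
move=> jk [cf Cf]; split=> // c ac; apply: Ck_le jk _; exact: Cf.
Qed.

Lemma plot_at k O f x : open O -> plot k O f -> O x ->
  let c := chart_at (f x) in
  [/\ open [set y | O y /\ cdom c (f y)], O x /\ cdom c (f x), atlas c
    & Ck k [set y | O y /\ cdom c (f y)] (Defs.coord c \o f)].
Proof.
move=> oO pf Ox c; have ac : atlas c by exact: chart_at_atlas.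
split=> //; last exact: plot_coord.
- by apply: (plot_open oO _ pf); exact: atlas_open.
- by split=> //; exact: chart_at_dom.
Qed.

Lemma plot_cst k O (m : M) : open O -> plot k O (cst m).
Proof.
move=> oO; apply: (plot_intro_chart oO (chart_at_atlas m)).
  by move=> y _; exact: chart_at_dom.
exact: (Ck_cst k O (Defs.coord (chart_at m) m)).
Qed.

Lemma plot_precomp (V' : normedModType R) {fV : finDim V} k O (O' : set V') f
    (phi : V' -> V) :
  open O -> open O' -> (forall x, O' x -> O (phi x)) ->
  Ck k O' phi -> plot k O f -> plot k O' (f \o phi).
Proof.
move=> oO oO' pO Cphi pf; split=> [x O'x|c ac].
  apply: continuous_comp; first exact: Ck_continuous Cphi _ O'x.
  by apply: (plot_continuous pf); exact: pO.
apply: (@Ck_comp _ _ _ _ _ _ _ _ [set x | O x /\ cdom c (f x)] (Defs.coord c \o f)).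
- rewrite -/(comp _ _); apply: open_preimage => //; first exact: atlas_open.
  move=> x O'x; apply: continuous_comp; first exact: Ck_continuous Cphi _ O'x.
  by apply: (plot_continuous pf); exact: pO.
- by apply: (plot_open oO _ pf); exact: atlas_open.
- by move=> x [Px cx]; split=> //; exact: pO.
- by apply: Ck_sub Cphi => x [].
- exact: plot_coord.
Qed.

End PlotTheory.

Lemma plot_param (E : normedModType R) {fE : finDim E} (M : manifoldType E)
  k (c : chart E M) : atlas c -> plot k (cimage c) (param c).
Proof.
move=> ac; have oc := atlas_open_image ac; apply: (plot_intro_chart oc ac).
  by move=> y; exact: cdom_param.
by apply: Ck_eq (Ck_id k (cimage c)) => // y cy /=; rewrite coord_paramK.
Qed.

Section PlotMaps.
Context (E F D V : normedModType R).
Context {fE : finDim E} {fF : finDim F} {fD : finDim D} {fV : finDim V}.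
Context (M : manifoldType E) (N : manifoldType F) (P : manifoldType D).

Lemma plot_smooth_map_on k (O : set V) (Q : set M) (f : V -> M) (h : M -> N) :
  open O -> open Q -> smooth_map_on Q h -> plot k O f ->
  (forall x, O x -> Q (f x)) -> plot k O (h \o f).
Proof.
move=> oO oQ [ch Ch] pf fQ; apply: plot_intro => // x Ox.
have [oc [_ cx] ac Cc] := plot_at oO pf Ox.
set c := chart_at (f x) in oc cx ac Cc; set d := chart_at (h (f x)).
have ad : atlas d by exact: chart_at_atlas.
exists [set y | (O y /\ cdom c (f y)) /\ cdom d (h (f y))], d.
have oS : open [set y | (O y /\ cdom c (f y)) /\ cdom d (h (f y))].
  apply: (@open_preimage _ _ _ _ (h \o f)) => //; first exact: atlas_open.
  move=> y [Oy _]; apply: continuous_comp; first exact: plot_continuous pf _ Oy.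
  by apply: ch; exact: fQ.
split=> //; first by do 2?split=> //; exact: chart_at_dom.
  by move=> y [].
have K y : cdom c (f y) -> param c (Defs.coord c (f y)) = f y.
  by move=> cy; rewrite atlas_coordK.
apply: (@Ck_eq _ _ _ _ _ ((fun y => Defs.coord d (h (param c y))) \o (Defs.coord c \o f))) => //.
  by move=> y [[_ cy] _] /=; rewrite K.
apply: (@Ck_comp _ _ _ _ _ _ _ _
  [set y | [/\ cimage c y, Q (param c y) & cdom d (h (param c y))]]) => //.
- rewrite (_ : mkset _ =
      [set y | [set y | cimage c y /\ Q (param c y)] y /\ cdom d (h (param c y))]).
    apply: (@open_preimage _ _ _ _ (h \o param c)); last 2 first.
    + exact: atlas_open.
    + move=> y [cy Qy]; apply: continuous_comp; first exact: atlas_param_continuous.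
      exact: ch.
    apply: open_preimage => //; first exact: atlas_open_image.
    by move=> y; exact: atlas_param_continuous.
  by apply/seteqP; split=> y; [case|case; case].
- move=> y [[Oy cy] dy]; rewrite /= K//; split=> //.
    exact: cimage_coord.
  exact: fQ.
- by apply: Ck_sub Cc => y [].
- exact: Ch.
Qed.

Lemma plot_smooth_map k (O : set V) (f : V -> M) (h : M -> N) :
  open O -> smooth_map h -> plot k O f -> plot k O (h \o f).
Proof. by move=> oO sh pf; exact: (plot_smooth_map_on oO openT sh pf). Qed.

Lemma Ck_smooth_fun k (O : set V) (f : V -> M) (h : M -> R) :
  open O -> smooth_fun h -> plot k O f -> Ck k O (h \o f).
Proof.
move=> oO sh pf; apply: Ck_local => x Ox.
have [oc Pcx ac Cc] := plot_at oO pf Ox.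
set c := chart_at (f x) in oc Pcx ac Cc; exists [set y | O y /\ cdom c (f y)].
split=> //.
apply: (@Ck_eq _ _ _ _ _ ((h \o param c) \o (Defs.coord c \o f))) => //.
  by move=> y [_ cy] /=; rewrite atlas_coordK.
apply: (@Ck_comp _ _ _ _ _ _ _ _ (cimage c)) => //.
- exact: atlas_open_image.
- by move=> y [_ cy]; exact: cimage_coord.
- exact: sh.
Qed.

(** Smoothness is tested on the inverse charts, themselves plots, so that translations, conjugations
    and orbit maps become smooth by the closure properties of plots. *)
Lemma smooth_map_plot (h : M -> N) :
  (forall k (c : chart E M), atlas c -> plot k (cimage c) (h \o param c)) ->
  smooth_map h.
Proof.
move=> H; split=> [x _|c d ac ad k].
  have ac := chart_at_atlas x; set c := chart_at x in ac.
  have cx : cdom c x by exact: chart_at_dom.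
  have C : {for x, continuous ((h \o param c) \o Defs.coord c)}.
    apply: continuous_comp; first exact: atlas_coord_continuous.
    by apply: (plot_continuous (H 0%N c ac)); exact: cimage_coord.
  rewrite /prop_for /continuous_at -[in X in _ --> X](atlas_coordK ac cx).
  apply: cvg_trans C; apply: near_eq_cvg; near=> y.
  rewrite /= atlas_coordK//; near: y; apply: open_nbhs_nbhs; split=> //.
  exact: atlas_open.
apply: Ck_sub (plot_coord (H k c ac) ad) => y [cy _ dy]; exact: conj.
Unshelve. all: by end_near. Qed.

Lemma plot_smooth_map2 k (O : set V) (f : V -> M) (g : V -> N) (h : M -> N -> P) :
  open O -> smooth_map2 h -> plot k O f -> plot k O g ->
  plot k O (fun x => h (f x) (g x)).
Proof.
move=> oO [ch Ch] pf pg; apply: plot_intro => // x Ox.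
have [oc [_ cx] ac Cc] := plot_at oO pf Ox.
have [od [_ dx] ad Cd] := plot_at oO pg Ox.
set c := chart_at (f x) in oc cx ac Cc; set d := chart_at (g x) in od dx ad Cd.
pose e := chart_at (h (f x) (g x)); have ae : atlas e by exact: chart_at_atlas.
pose Q := [set y | (O y /\ cdom c (f y)) /\ (O y /\ cdom d (g y))].
have oQ : open Q by exact: openI.
exists [set y | Q y /\ cdom e (h (f y) (g y))], e.
have chfg y : O y -> {for y, continuous (fun x => h (f x) (g x))}.
  move=> Oy; apply: (@continuous_comp _ _ _ (fun x => (f x, g x))
    (fun p => h p.1 p.2)); last exact: ch.
  by apply: cvg_pair; [exact: plot_continuous pf _ Oy
    | exact: plot_continuous pg _ Oy].
have oS : open [set y | Q y /\ cdom e (h (f y) (g y))].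
  apply: (@open_preimage _ _ _ _ (fun x => h (f x) (g x))) => //.
    exact: atlas_open.
  by move=> y [[Oy _] _]; exact: chfg.
split=> //; first by do 2?split=> //; exact: chart_at_dom.
  by move=> y [].
pose S := [set y : E * F | [/\ cimage c y.1, cimage d y.2
                         & cdom e (h (param c y.1) (param d y.2))]].
apply: (@Ck_eq _ _ _ _ _
  ((fun y : E * F => Defs.coord e (h (param c y.1) (param d y.2))) \o
   (fun y => (Defs.coord c (f y), Defs.coord d (g y))))) => //.
  by move=> y [[[_ cy] [_ dy]] _] /=; rewrite !atlas_coordK.
apply: (@Ck_comp _ _ _ _ _ _ _ _ S) => //.
- rewrite (_ : S = [set y | [set y : E * F | (fst @^-1` cimage c `&` snd @^-1` cimage d) y] y /\
        cdom e (h (param c y.1) (param d y.2))]); last first.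
    by apply/seteqP; split=> y; [case|case; case].
  apply: (@open_preimage _ _ _ _ (fun y : E * F => h (param c y.1) (param d y.2))).
  + apply: openI; apply: open_comp; try exact: atlas_open_image.
      by move=> y _; exact: cvg_fst.
    by move=> y _; exact: cvg_snd.
  + exact: atlas_open.
  + move=> y [cy dy]; apply: (@continuous_comp _ _ _
      (fun y : E * F => (param c y.1, param d y.2)) (fun p => h p.1 p.2)); last exact: ch.
    apply: cvg_pair.
      by apply: (@continuous_comp _ _ _ fst (param c)); [exact: cvg_fst
        | exact: atlas_param_continuous].
    by apply: (@continuous_comp _ _ _ snd (param d)); [exact: cvg_snd
      | exact: atlas_param_continuous].
- move=> y [[[_ cy] [_ dy]] ey]; split=> /=; [exact: cimage_coord
    | exact: cimage_coord|by rewrite !atlas_coordK].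
- apply: Ck_pair => //.
    by apply: Ck_sub Cc => y [[]].
  by apply: Ck_sub Cd => y [[]].
- exact: Ch.
Qed.

End PlotMaps.

(** * Differentials of plots *)

Section Tangent1.
Context (E V : normedModType R) {fE : finDim E} {fV : finDim V}.
Context (M : manifoldType E).
Implicit Types (O : set V).

Lemma pd_derivable O (f : V -> M) x u : open O -> plot 1 O f -> O x ->
  is_derive x u (Defs.coord (chart_at (f x)) \o f) (pd f x u).
Proof.
move=> oO pf Ox; have [oc cx ac Cc] := plot_at oO pf Ox.
by apply: derivableP; apply: (Ck_derivable Cc); exact: cx.
Qed.

Lemma pd_linear O (f : V -> M) x : open O -> plot 1 O f -> O x ->
  linear (pd f x).
Proof.
move=> oO pf Ox; have [oc cx ac Cc] := plot_at oO pf Ox.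
exact: derive_linear Cc cx.
Qed.

Lemma pd_near (f g : V -> M) x u : (\forall y \near x, f y = g y) ->
  pd f x u = pd g x u.
Proof.
move=> fg; rewrite /pd (nbhs_singleton fg); apply: near_eq_derive.
by apply: filterS fg => y /= ->.
Qed.

Lemma pd_cst (m : M) (x u : V) : pd (cst m) x u = 0.
Proof. by rewrite /pd (derive_cst (Defs.coord (chart_at m) m)). Qed.

End Tangent1.

Section Tangent.
Context (E F D V : normedModType R).
Context {fE : finDim E} {fF : finDim F} {fD : finDim D} {fV : finDim V}.
Context (M : manifoldType E) (N : manifoldType F) (P : manifoldType D).
Implicit Types (O : set V).

Lemma pd_smooth_map_on O (Q : set M) (f : V -> M) (h : M -> N) x u :
  open O -> open Q -> smooth_map_on Q h -> plot 1 O f -> O x -> Q (f x) ->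
  pd (h \o f) x u = mfderiv h (f x) (pd f x u).
Proof.
move=> oO oQ [ch Ch] pf Ox Qx.
have [oc cx ac Cc] := plot_at oO pf Ox.
set c := chart_at (f x) in oc cx ac Cc.
pose d := chart_at (h (f x)); have ad : atlas d by exact: chart_at_atlas.
pose S := [set y | [/\ cimage c y, Q (param c y) & cdom d (h (param c y))]].
have oS : open S.
  rewrite (_ : S =
      [set y | [set y | cimage c y /\ Q (param c y)] y /\ cdom d (h (param c y))]).
    apply: (@open_preimage _ _ _ _ (h \o param c)); last 2 first.
    + exact: atlas_open.
    + move=> y [cy Qy]; apply: continuous_comp; first exact: atlas_param_continuous.
      exact: ch.
    apply: open_preimage => //; first exact: atlas_open_image.
    by move=> y; exact: atlas_param_continuous.
  by apply/seteqP; split=> y; [case|case; case].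
have Sx : S (Defs.coord c (f x)).
  rewrite /S /= atlas_coordK//; last exact: chart_at_dom.
  by split=> //; [apply: cimage_coord; exact: chart_at_dom|exact: chart_at_dom].
have dh : differentiable (fun y => Defs.coord d (h (param c y)))
    ((Defs.coord c \o f) x).
  exact: (C1_differentiable oS (Ch c d ac ad 1%N)).
have [_ E1] := is_derive_comp dh (pd_derivable u oO pf Ox).
rewrite /mfderiv deriveE// -E1 /pd; apply: near_eq_derive.
near=> y; rewrite /= atlas_coordK//.
have : O y /\ cdom c (f y) by near: y; exact: open_near.
by case.
Unshelve. all: by end_near. Qed.

Lemma pd_smooth_map O (f : V -> M) (h : M -> N) x u :
  open O -> smooth_map h -> plot 1 O f -> O x ->
  pd (h \o f) x u = mfderiv h (f x) (pd f x u).
Proof. by move=> oO sh pf Ox; exact: (pd_smooth_map_on _ oO openT). Qed.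

Lemma derive_smooth_fun O (f : V -> M) (h : M -> R) x u :
  open O -> smooth_fun h -> plot 1 O f -> O x ->
  is_derive x u (h \o f) (mfdiff h (f x) (pd f x u)).
Proof.
move=> oO sh pf Ox.
have [oc cx ac Cc] := plot_at oO pf Ox.
set c := chart_at (f x) in oc cx ac Cc.
have dh : differentiable (fun y => h (param c y)) ((Defs.coord c \o f) x).
  apply: (C1_differentiable (atlas_open_image ac) (sh c ac 1%N)).
  exact/cimage_coord/chart_at_dom.
have E1 := is_derive_comp dh (pd_derivable u oO pf Ox).
rewrite /mfdiff deriveE//; apply: near_eq_is_derive E1.
near=> y; rewrite /= atlas_coordK//.
have : O y /\ cdom c (f y) by near: y; exact: open_near.
by case.
Unshelve. all: by end_near. Qed.

(** Since [pd] uses a chart that varies with the point, comparing derivatives at different points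
    needs this passage to one fixed chart. *)
Lemma derive_chart O (f : V -> M) (c : chart E M) x u :
  open O -> plot 1 O f -> O x -> atlas c -> cdom c (f x) ->
  'D_u (Defs.coord c \o f) x =
  'D_(pd f x u) (Defs.coord c \o param (chart_at (f x)))
     (Defs.coord (chart_at (f x)) (f x)).
Proof.
move=> oO pf Ox ac cx; set d := chart_at (f x).
have ad : atlas d by exact: chart_at_atlas.
have dx : cdom d (f x) by exact: chart_at_dom.
have oQ : open (overlap d c) by exact: overlap_open.
have dh : differentiable (Defs.coord c \o param d) ((Defs.coord d \o f) x).
  have Qx : overlap d c (Defs.coord d (f x)).
    by split; [exact: cimage_coord|rewrite /= atlas_coordK].
  exact: (C1_differentiable oQ (atlas_smooth d c ad ac 1%N) Qx).
have [_ E1] := is_derive_comp dh (pd_derivable u oO pf Ox).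
rewrite [RHS]deriveE// -E1; apply: near_eq_derive.
have [od' dx' _ _] := plot_at oO pf Ox.
near=> y; rewrite /= atlas_coordK//.
have : O y /\ cdom d (f y) by near: y; exact: open_near.
by case.
Unshelve. all: by end_near. Qed.

(** The differential of [h] in product charts is linear and a tangent vector of the product splits
    as (u1, 0) + (0, u2). Applied to the group law, this yields the differentials of inverses and
    quotients at the identity. *)
Lemma pd_map2 O (f : V -> M) (g : V -> N) (h : M -> N -> P) x u :
  open O -> smooth_map2 h -> plot 1 O f -> plot 1 O g -> O x ->
  pd (fun y => h (f y) (g y)) x u =
  pd (fun y => h (f y) (g x)) x u + pd (fun y => h (f x) (g y)) x u.
Proof.
move=> oO [ch Ch] pf pg Ox.
have [oc cx ac Cc] := plot_at oO pf Ox.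
have [od dx ad Cd] := plot_at oO pg Ox.
have fx := chart_at_dom (f x); have gx := chart_at_dom (g x).
set c := chart_at (f x) in oc cx ac Cc fx; set d := chart_at (g x) in od dx ad Cd gx.
pose e := chart_at (h (f x) (g x)); have ae : atlas e by exact: chart_at_atlas.
pose S := [set y : E * F | [/\ cimage c y.1, cimage d y.2
                         & cdom e (h (param c y.1) (param d y.2))]].
pose H (y : E * F) := Defs.coord e (h (param c y.1) (param d y.2)).
have oS : open S.
  rewrite (_ : S = [set y | [set y : E * F | (fst @^-1` cimage c `&` snd @^-1` cimage d) y] y /\
        cdom e (h (param c y.1) (param d y.2))]); last first.
    by apply/seteqP; split=> y; [case|case; case].
  apply: (@open_preimage _ _ _ _ (fun y : E * F => h (param c y.1) (param d y.2))).
  + apply: openI; apply: open_comp; try exact: atlas_open_image.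
      by move=> y _; exact: cvg_fst.
    by move=> y _; exact: cvg_snd.
  + exact: atlas_open.
  + move=> y [cy dy]; apply: (@continuous_comp _ _ _
      (fun y : E * F => (param c y.1, param d y.2)) (fun p => h p.1 p.2)); last exact: ch.
    apply: cvg_pair.
      by apply: (@continuous_comp _ _ _ fst (param c)); [exact: cvg_fst
        | exact: atlas_param_continuous].
    by apply: (@continuous_comp _ _ _ snd (param d)); [exact: cvg_snd
      | exact: atlas_param_continuous].
pose a := (Defs.coord c (f x), Defs.coord d (g x)).
have Sa : S a.
  split=> /=; [exact: cimage_coord|exact: cimage_coord|].
  by rewrite !atlas_coordK//; exact: chart_at_dom.
have dH : differentiable H a by exact: (C1_differentiable oS (Ch c d e ac ad ae 1%N)).
have nc : \forall y \near x, cdom c (f y).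
  have : \forall y \near x, [set y | O y /\ cdom c (f y)] y by exact: open_near.
  by apply: filterS => y [].
have nd : \forall y \near x, cdom d (g y).
  have : \forall y \near x, [set y | O y /\ cdom d (g y)] y by exact: open_near.
  by apply: filterS => y [].
have dpair u1 u2 (f1 : V -> E) (g1 : V -> F) : is_derive x u f1 u1 ->
    is_derive x u g1 u2 -> is_derive x u (fun y => (f1 y, g1 y)) (u1, u2).
  move=> [f1d <-] [g1d <-].
  have C : (fun h : R => (h^-1 *: ((f1 \o shift x) (h *: u) - f1 x),
         h^-1 *: ((g1 \o shift x) (h *: u) - g1 x))) @ 0^' -->
      ('D_u f1 x, 'D_u g1 x) by exact: cvg_pair.
  by split; [apply/cvg_ex; eexists; exact: C|apply: cvg_lim => //; exact: C].
have D1 := pd_derivable u oO pf Ox; have D2 := pd_derivable u oO pg Ox.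
have [_ E0] := is_derive_comp (f := fun y => (Defs.coord c (f y), Defs.coord d (g y)))
  dH (dpair _ _ _ _ D1 D2).
have [_ E1] := is_derive_comp (f := fun y => (Defs.coord c (f y), Defs.coord d (g x)))
  dH (dpair _ _ _ _ D1 (is_derive_cst (Defs.coord d (g x)) x u)).
have [_ E2] := is_derive_comp (f := fun y => (Defs.coord c (f x), Defs.coord d (g y)))
  dH (dpair _ _ _ _ (is_derive_cst (Defs.coord c (f x)) x u) D2).
have K (f' : V -> M) (g' : V -> N) : f' x = f x -> g' x = g x ->
    (\forall y \near x, cdom c (f' y)) -> (\forall y \near x, cdom d (g' y)) ->
    pd (fun y => h (f' y) (g' y)) x u =
    'D_u (H \o (fun y => (Defs.coord c (f' y), Defs.coord d (g' y)))) x.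
  move=> f'x g'x nc' nd'; rewrite /pd f'x g'x; apply: near_eq_derive.
  by near=> y; rewrite /H /= !atlas_coordK//; near: y.
rewrite K// [in RHS]K//; last by near=> y; exact: chart_at_dom.
rewrite [X in _ = _ + X]K//; last by near=> y; exact: chart_at_dom.
rewrite E0 E1 E2 -linearD; congr ('d H a _).
by congr pair => /=; rewrite ?addr0 ?add0r.
Unshelve. all: by end_near. Qed.

Lemma pd_precomp (V' : normedModType R) O (f : V -> M) (phi : V' -> V) x u du :
  open O -> plot 1 O f -> O (phi x) -> is_derive x u phi du ->
  pd (f \o phi) x u = pd f (phi x) du.
Proof.
move=> oO pf Ox dphi; have [oc cx ac Cc] := plot_at oO pf Ox.
have df : differentiable (Defs.coord (chart_at (f (phi x))) \o f) (phi x).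
  exact: C1_differentiable Cc cx.
have [_ E1] := is_derive_comp df dphi.
by rewrite [RHS]deriveE// -E1.
Qed.

Lemma velocityE (f : R -> M) (t : R) : velocity f t = pd (f : R^o -> M) t 1.
Proof. by rewrite /velocity derive1E. Qed.

Lemma mfderivE (h : M -> N) (x : M) (v : E) :
  mfderiv h x v = pd (h \o param (chart_at x)) (Defs.coord (chart_at x) x) v.
Proof. by rewrite /mfderiv /pd /= (atlas_coordK (chart_at_atlas x) (chart_at_dom x)). Qed.

Lemma pd_param (x : M) (v : E) :
  pd (param (chart_at x)) (Defs.coord (chart_at x) x) v = v.
Proof.
have ac := chart_at_atlas x; have cx := chart_at_dom x.
rewrite /pd atlas_coordK// -[RHS](derive_id (Defs.coord (chart_at x) x) v).
apply: near_eq_derive; near=> y; rewrite /= coord_paramK//; near: y.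
apply: open_near; first exact: atlas_open_image.
exact: cimage_coord.
Unshelve. all: by end_near. Qed.

Lemma mfderiv_linear (h : M -> N) (x : M) : smooth_map h -> linear (mfderiv h x).
Proof.
move=> sh a u v; rewrite !mfderivE; have ac := chart_at_atlas x.
have oc := atlas_open_image ac.
apply: (pd_linear oc); last exact/cimage_coord/chart_at_dom.
exact: (plot_smooth_map oc sh (plot_param 1 ac)).
Qed.

End Tangent.
End Plots.

(** * Lie groups *)

Section Constancy.
Context (R : realType) (E : normedModType R) {fE : finDim E} (M : manifoldType E).

(** In the chart at [f t0] each coordinate of [f] is a real function with zero derivative, to which
    the mean value theorem applies. *)
Lemma pd0_locally_constant (f : R^o -> M) : plot 1 setT f ->
  (forall t, pd f t 1 = 0) -> forall t0, \forall t \near t0, f t = f t0.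
Proof.
move=> pf f0 t0; have [oP Pt ac Cc] := plot_at openT pf (I : setT t0).
set c := chart_at (f t0) in oP Pt ac Cc; set P := [set y | _] in oP Pt Cc.
have /nbhs_ballP[del /= del0 Hd] := open_near oP Pt.
apply/nbhs_ballP; exists del => //= t tdel.
have [[n [b [co [cc bc]]]]] := fE.
suff : Defs.coord c (f t) = Defs.coord c (f t0).
  have [_ ct] := Hd _ tdel; have [_ ct0] := Pt.
  by move/(congr1 (param c)); rewrite !atlas_coordK.
rewrite (bc (Defs.coord c (f t))) [RHS]bc; apply: eq_bigr => i _; congr (_ *: _).
have H (s : R) : `|s| <= `|t - t0| ->
    is_derive (t0 + s *: (1 : R^o)) 1 ((co i) \o (Defs.coord c \o f)) 0.
  move=> st; have Ps : P (t0 + s *: (1 : R^o)).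
    apply: Hd; rewrite -ball_normE /ball_/= opprD addNKr normrN [_ *: _]mulr1.
    by apply: le_lt_trans st _; rewrite distrC; move: tdel; rewrite -ball_normE.
  have -> : 0 = co i ('D_1 (Defs.coord c \o f) (t0 + s *: (1 : R^o))).
    rewrite (derive_chart (1 : R^o) openT pf)//; last by case: Ps.
    by rewrite f0 derive0 linear0.
  by apply: is_derive_linear => //; apply: derivableP; apply: (Ck_derivable Cc).
have [s st E1] := mvt_line (fun s st => @ex_derive _ _ _ _ _ _ _ (H s st)).
move: E1; have [_ ->] := H s st; rewrite mulr0 => /eqP; rewrite subr_eq0 => /eqP.
by rewrite [_ *: _]mulr1 addrC subrK.
Qed.

(** By local constancy the set where [f t = f 0] is open and closed in the connected line. *)
Lemma pd0_constant (f : R^o -> M) : plot 1 setT f ->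
  (forall t, pd f t 1 = 0) -> forall t, f t = f 0.
Proof.
move=> pf f0 t; have lc := pd0_locally_constant pf f0.
have cR : connected [set: R] by apply/connected_intervalP.
pose A := [set t : R | f t = f 0].
suff : A = setT by move=> AT; have : A t by rewrite AT.
apply: cR; first by exists 0.
  exists A; last by rewrite setTI.
  rewrite openE => s As /=.
  by apply: filterS (lc s) => r; rewrite /A /= => ->.
exists A; last by rewrite setTI.
rewrite -openC openE => s As /=.
by apply: filterS (lc s) => r; rewrite /A /= => ->.
Qed.

End Constancy.

Section MapCalculus.
Context (R : realType) (E F D : normedModType R).
Context {fE : finDim E} {fF : finDim F} {fD : finDim D}.
Context (M : manifoldType E) (N : manifoldType F) (P : manifoldType D).

Lemma smooth_map_comp (h : N -> P) (f : M -> N) :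
  smooth_map h -> smooth_map f -> smooth_map (h \o f).
Proof.
move=> sh sf; apply: smooth_map_plot => k c ac.
have oc := atlas_open_image ac.
apply: (plot_smooth_map oc sh (f := f \o param c)).
exact: plot_smooth_map oc sf (plot_param k ac).
Qed.

Lemma mfderiv_comp (h : N -> P) (f : M -> N) x v :
  smooth_map h -> smooth_map f ->
  mfderiv (h \o f) x v = mfderiv h (f x) (mfderiv f x v).
Proof.
move=> sh sf; rewrite mfderivE [mfderiv f x v]mfderivE.
have ac := chart_at_atlas x; have oc := atlas_open_image ac.
have cx := cimage_coord (chart_at_dom x).
have := pd_smooth_map v oc sh (plot_smooth_map oc sf (plot_param 1 ac)) cx.
by rewrite /= (atlas_coordK ac (chart_at_dom x)) => <-.
Qed.

Lemma mfderiv_id (x : M) v : mfderiv id x v = v.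
Proof. by rewrite mfderivE pd_param. Qed.

End MapCalculus.

Section LieGroup.
Context (R : realType) (d : nat) (G : lieGroupType R d).
Context (V : normedModType R) {fV : finDim V}.
Implicit Types (O : set V) (f g : V -> G).

Lemma plot_div k O f g : open O -> plot k O f -> plot k O g ->
  plot k O (fun x => f x * (g x)^-1)%g.
Proof. by move=> oO; exact: plot_smooth_map2 divg_smooth. Qed.

Lemma plot_inv k O f : open O -> plot k O f -> plot k O (fun x => (f x)^-1)%g.
Proof.
move=> oO pf.
have -> : (fun x => (f x)^-1)%g = (fun x => cst 1%g x * (f x)^-1)%g.
  by apply/funext => x; rewrite mul1g.
by apply: plot_div => //; exact: plot_cst.
Qed.

Lemma plot_mul k O f g : open O -> plot k O f -> plot k O g ->
  plot k O (fun x => f x * g x)%g.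
Proof.
move=> oO pf pg.
have -> : (fun x => f x * g x)%g = (fun x => f x * ((g x)^-1)^-1)%g.
  by apply/funext => x; rewrite invgK.
by apply: plot_div => //; exact: plot_inv.
Qed.

Lemma plot_lexp k : plot k setT (lexp : 'rV[R]_d -> G).
Proof.
have [ce Ce] := @lexp_smooth R d G; split=> [x _|c ac]; first exact: ce.
by apply: Ck_sub (Ce c ac k) => x [].
Qed.

Lemma pd_div_sum O f g x u : open O -> plot 1 O f -> plot 1 O g -> O x ->
  pd (fun y => f y * (g y)^-1)%g x u =
  pd (fun y => f y * (g x)^-1)%g x u + pd (fun y => f x * (g y)^-1)%g x u.
Proof. by move=> oO; exact: pd_map2 divg_smooth. Qed.

Lemma pd_inv O g x u : open O -> plot 1 O g -> O x -> g x = 1%g ->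
  pd (fun y => (g y)^-1)%g x u = - pd g x u.
Proof.
move=> oO pg Ox gx; have := pd_div_sum u oO pg pg Ox.
have -> : (fun y => g y * (g y)^-1)%g = cst 1%g.
  by apply/funext => y; rewrite mulgV.
have -> : (fun y => g y * (g x)^-1)%g = g.
  by apply/funext => y; rewrite gx invg1 mulg1.
have -> : (fun y => g x * (g y)^-1)%g = (fun y => (g y)^-1)%g.
  by apply/funext => y; rewrite gx mul1g.
by rewrite pd_cst => /eqP; rewrite eq_sym addrC addr_eq0 => /eqP.
Qed.

Lemma pd_div O f g x u : open O -> plot 1 O f -> plot 1 O g -> O x ->
  f x = 1%g -> g x = 1%g ->
  pd (fun y => f y * (g y)^-1)%g x u = pd f x u - pd g x u.
Proof.
move=> oO pf pg Ox fx gx; rewrite (pd_div_sum u oO pf pg Ox).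
rewrite -(pd_inv u oO pg Ox gx).
have -> : (fun y => f y * (g x)^-1)%g = f.
  by apply/funext => y; rewrite gx invg1 mulg1.
have -> // : (fun y => f x * (g y)^-1)%g = (fun y => (g y)^-1)%g.
by apply/funext => y; rewrite fx mul1g.
Qed.

End LieGroup.

Section LieMaps.
Context (R : realType) (d : nat) (G : lieGroupType R d).

Lemma smooth_lmul (g : G) : smooth_map (fun h : G => (g * h)%g).
Proof.
apply: smooth_map_plot => k c ac; have oc := atlas_open_image ac.
exact: (plot_mul oc (plot_cst k g oc) (plot_param k ac)).
Qed.

Lemma smooth_rmul (g : G) : smooth_map (fun h : G => (h * g)%g).
Proof.
apply: smooth_map_plot => k c ac; have oc := atlas_open_image ac.
exact: (plot_mul oc (plot_param k ac) (plot_cst k g oc)).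
Qed.

Lemma smooth_conj (g : G) : smooth_map (fun h : G => (g * h * g^-1)%g).
Proof.
exact: (smooth_map_comp (smooth_rmul g^-1%g) (smooth_lmul g)).
Qed.

Lemma lexp0 : lexp 0 = 1%g :> G.
Proof.
have := @lexpD R d G 0 0 0; rewrite addr0 !scale0r => H.
by apply: (@mulgI G (lexp 0)); rewrite -H mulg1.
Qed.

Lemma plot_lexp_line k (v : 'rV[R]_d) :
  plot k setT (fun t : R^o => lexp (t *: v) : G).
Proof.
apply: (@plot_precomp _ _ _ _ _ _ _ k setT setT lexp (fun t : R^o => t *: v)).
- exact: openT.
- exact: openT.
- by [].
- apply: Ck_scale; [exact: openT|exact: Ck_id|exact: Ck_cst].
- exact: plot_lexp.
Qed.

Lemma pd_lexp_line (v : 'rV[R]_d) :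
  pd (fun t : R^o => lexp (t *: v) : G) 0 1 = v.
Proof. by rewrite -velocityE; exact: lexp_velocity. Qed.

Lemma hom1 (phi : R -> G) :
  (forall s t, phi (s + t) = (phi s * phi t)%g) -> phi 0 = 1%g.
Proof.
move=> /(_ 0 0); rewrite addr0 => H.
by apply: (@mulgI G (phi 0)); rewrite -H mulg1.
Qed.

(** The quotient [kap] satisfies kap(y) = phi(s) kap(y - s) psi(s)^-1, so its derivative at [s] is
    the image of the one at 0, which is the difference of the two velocities and vanishes. *)
Lemma one_param_unique (phi psi : R^o -> G) :
  plot 1 setT phi -> plot 1 setT psi ->
  (forall s t, phi (s + t) = (phi s * phi t)%g) ->
  (forall s t, psi (s + t) = (psi s * psi t)%g) ->
  pd phi 0 1 = pd psi 0 1 -> forall t, phi t = psi t.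
Proof.
move=> pphi ppsi hphi hpsi E1 t.
have phi0 := hom1 hphi; have psi0 := hom1 hpsi.
pose kap (t : R^o) := (phi t * (psi t)^-1)%g.
have pk : plot 1 setT kap by exact: (plot_div openT pphi ppsi).
have k0 : kap 0 = 1%g by rewrite /kap phi0 psi0 mulgV.
suff : forall s, kap s = kap 0.
  by move=> /(_ t); rewrite k0 /kap => /eqP; rewrite mulg_eq1 invgK => /eqP.
apply: pd0_constant => // s.
pose L (g : G) := (phi s * g * (psi s)^-1)%g.
have sL : smooth_map L.
  exact: (smooth_map_comp (smooth_rmul (psi s)^-1%g) (smooth_lmul (phi s))).
have -> : kap = (L \o kap) \o (fun y : R^o => y - s).
  apply/funext => y; rewrite /L /kap /=.
  have -> : phi y = (phi s * phi (y - s))%g by rewrite -hphi addrC subrK.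
  have -> : psi y = (psi s * psi (y - s))%g by rewrite -hpsi addrC subrK.
  by rewrite invgM !mulgA.
have pLk : plot 1 setT (L \o kap) by exact: (plot_smooth_map openT sL pk).
have dshift : is_derive s (1 : R^o) (fun y : R^o => y - s) (1 : R^o).
  have := is_deriveB (is_derive_id s (1 : R^o)) (is_derive_cst s s (1 : R^o)).
  by rewrite subr0.
rewrite (pd_precomp openT pLk I dshift).
rewrite subrr (pd_smooth_map _ openT sL pk)// (pd_div _ openT pphi ppsi)//.
rewrite E1 subrr.
exact: (linf0 (mfderiv_linear (kap 0) sL)).
Qed.

End LieMaps.

Section LieHoms.
Context (R : realType) (d e : nat) (G : lieGroupType R d) (H : lieGroupType R e).
Context (f : G -> H) (lf : lie_hom f).

Lemma lie_hom1 : f 1%g = 1%g.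
Proof.
have [hf _] := lf; have := hf 1%g 1%g; rewrite mulg1 => E1.
by apply: (@mulgI H (f 1%g)); rewrite -E1 mulg1.
Qed.

Lemma lie_homV g : f g^-1%g = (f g)^-1%g.
Proof.
have [hf _] := lf; apply: (@mulgI H (f g)).
by rewrite -hf !mulgV lie_hom1.
Qed.

Lemma lie_diff_linear : linear (lie_diff f).
Proof. by have [_ sf] := lf; exact: mfderiv_linear. Qed.

Lemma lie_hom_lexp v : f (lexp v) = lexp (lie_diff f v).
Proof.
have [hf sf] := lf.
have := @one_param_unique R e H (fun t : R^o => f (lexp (t *: v)))
  (fun t : R^o => lexp (t *: lie_diff f v)).
move=> /(_ _ _ _ _ _ 1); rewrite !scale1r; apply.
- exact: (plot_smooth_map openT sf (plot_lexp_line G 1 v)).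
- exact: plot_lexp_line.
- by move=> s t; rewrite lexpD hf.
- by move=> s t; rewrite lexpD.
- rewrite pd_lexp_line.
  rewrite (pd_smooth_map _ openT sf (plot_lexp_line G 1 v))//.
  by rewrite pd_lexp_line scale0r lexp0.
Qed.

End LieHoms.

Lemma derive_pair2 (R : realType) (V W D : normedModType R) (h : V * W -> D) x y v :
  'D_(0, v) h (x, y) = 'D_v (fun z => h (x, z)) y.
Proof.
have E1 : (fun t : R => t^-1 *: ((h \o shift (x, y)) (t *: (0, v)) - h (x, y))) =
    (fun t : R => t^-1 *: (((fun z => h (x, z)) \o shift y) (t *: v) - h (x, y))).
  apply/funext => t; congr (_ *: (h _ - _)).
  by congr pair; rewrite /= scaler0 add0r.
by rewrite /derive E1.
Qed.

Lemma linear_derivative (R : realType) (V W : normedModType R) (K : V -> R^o -> W)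
    (b : V -> W) x : (forall t, linear (K^~ t)) ->
  (forall v, is_derive x (1 : R^o) (K v) (b v)) -> linear b.
Proof.
move=> lK dK a v w; have [_ <-] := dK (a *: v + w).
have -> : K (a *: v + w) = a *: K v + K w by apply/funext => t; exact: lK.
by have [_ ->] := is_deriveD (is_deriveZ a (dK v)) (dK w).
Qed.

(** * The adjoint representation and the bracket *)

Section Adjoint.
Context (R : realType) (d : nat) (G : lieGroupType R d).

Lemma lie_hom_conj (g : G) : lie_hom (fun h : G => (g * h * g^-1)%g).
Proof. by split; [move=> x y; rewrite !mulgA mulgVK|exact: smooth_conj]. Qed.

Lemma Ad_linear (g : G) : linear (Ad g).
Proof. exact: (lie_diff_linear (lie_hom_conj g)). Qed.

Lemma AdVK (g : G) v : Ad g (Ad g^-1%g v) = v.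
Proof.
pose proof (mfderiv_comp 1%g v (smooth_conj g) (smooth_conj g^-1%g)) as E1.
move: E1; have -> : (fun h : G => (g * h * g^-1)%g) \o (fun h : G => (g^-1 * h * g^-1^-1)%g) = id.
  by apply/funext => h /=; rewrite invgK !mulgA mulgV mul1g mulgK.
by rewrite mfderiv_id mulg1 mulgV /Ad => E1; exact: esym.
Qed.

Lemma Ad_lexp_self (t : R) u : Ad (lexp (t *: u) : G) u = u.
Proof.
have p := plot_lexp_line G 1 u.
pose proof (pd_smooth_map (1 : R^o) openT (smooth_conj (lexp (t *: u))) p (I : setT 0)) as E1.
move: E1; rewrite pd_lexp_line scale0r lexp0 -/(Ad _ u) => <-.
set k := _ \o _; have -> : k = (fun s : R^o => lexp (s *: u)).
  by apply/funext => s; rewrite /k /= -lexpD addrC lexpD mulgK.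
exact: pd_lexp_line.
Qed.

(** [Ad (f x) v] is the partial derivative in direction (0, v) of (x, y) |-> f(x) param(y) f(x)^-1
    over the identity; this costs one order of differentiability. *)
Lemma Ck_Ad (V : normedModType R) {fV : finDim V} k (O : set V) (f : V -> G) v :
  open O -> plot k.+1 O f -> Ck k O (fun x => Ad (f x) v).
Proof.
move=> oO pf; set c := chart_at (1%g : G); have ac : atlas c by exact: chart_at_atlas.
have c1 : cdom c 1%g by exact: chart_at_dom.
pose W := [set p : V * 'rV[R]_d | (fst @^-1` O `&` snd @^-1` cimage c) p].
have oW : open W.
  apply: openI; apply: open_comp => //; try exact: atlas_open_image.
    by move=> y _; exact: cvg_fst.
  by move=> y _; exact: cvg_snd.
pose Q (p : V * 'rV[R]_d) := (f p.1 * param c p.2 * (f p.1)^-1)%g.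
have pf1 : plot k.+1 W (f \o fst).
  apply: (plot_precomp oO oW _ (Ck_fst _ oW) pf).
  by move=> p [].
have pQ : plot k.+1 W Q.
  have pc : plot k.+1 W (param c \o snd).
    apply: (plot_precomp (atlas_open_image ac) oW _ (Ck_snd _ oW) (plot_param _ ac)).
    by move=> p [].
  exact: (plot_mul oW (plot_mul oW pf1 pc) (plot_inv oW pf1)).
have C := Ck_derive (0, v) (plot_coord pQ ac).
have oS : open [set x | W x /\ cdom c (Q x)].
  by apply: (plot_open oW _ pQ); exact: atlas_open.
pose j (x : V) := (x, Defs.coord c 1%g).
have jS x : O x -> [set x | W x /\ cdom c (Q x)] (j x).
  move=> Ox; split; first by split=> //; exact: cimage_coord.
  by rewrite /Q /= atlas_coordK// mulg1 mulgV.
have Cj : Ck k O j by exact: Ck_pair oO (Ck_id _ _) (Ck_cst _ _ _).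
have C2 : Ck k O ('D_(0, v) (Defs.coord c \o Q) \o j).
  exact: (@Ck_comp _ _ _ _ _ _ _ _ _ _ _ oO oS jS Cj C).
apply: (Ck_eq oO _ C2) => x Ox.
rewrite [LHS]derive_pair2 /Ad /mfderiv.
have E1 : (f x * 1 * (f x)^-1 = 1)%g by rewrite mulg1 mulgV.
by rewrite E1.
Qed.

Lemma is_derive_Ad (u v : 'rV[R]_d) : is_derive (0 : R^o) 1
  (fun t : R^o => Ad (lexp (t *: u) : G) v) (lbracket G u v).
Proof.
have C : Ck 1 setT (fun t : R^o => Ad (lexp (t *: u) : G) v).
  exact: (Ck_Ad v openT (plot_lexp_line G 2%N u)).
rewrite /lbracket derive1E; apply: derivableP.
by apply: (Ck_derivable C).
Qed.

(** Written as a directional derivative in the direction [u], the bracket is linear in [u] because a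
    C^1 map has a linear differential. *)
Lemma lbracketE u v : lbracket G u v = 'D_u (fun w => Ad (lexp w : G) v) 0.
Proof.
have := derive_lineE (fun w => Ad (lexp w : G) v) 0 u 0.
rewrite scale0r add0r => <-; rewrite /lbracket derive1E.
have -> : (fun t : R => Ad (lexp (t *: u) : G) v) =
    (fun t : R => Ad (lexp (0 + t *: u) : G) v).
  by apply/funext => t; rewrite add0r.
by [].
Qed.

Lemma lbracket_linear_l v : linear (fun u => lbracket G u v).
Proof.
move=> a u w; rewrite !lbracketE.
apply: (derive_linear openT); last by [].
exact: (Ck_Ad v openT (plot_lexp G 2%N)).
Qed.

Lemma lbracket_linear_r u : linear (lbracket G u).
Proof.
apply: (linear_derivative (K := fun v t => Ad (lexp (t *: u) : G) v)) => [t|v].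
  exact: Ad_linear.
exact: is_derive_Ad.
Qed.

Lemma lbracket_self u : lbracket G u u = 0.
Proof.
rewrite /lbracket (_ : (fun t => _) = cst u) ?derive1_cst//.
by apply/funext => t; exact: Ad_lexp_self.
Qed.

Lemma lbracketC u v : lbracket G u v = - lbracket G v u.
Proof.
have := lbracket_self (u + v).
rewrite (linfD (lbracket_linear_r (u + v))).
rewrite (linfD (lbracket_linear_l u)) (linfD (lbracket_linear_l v)) !lbracket_self.
move: (lbracket G u v) (lbracket G v u) => x y.
by rewrite add0r addr0 addrC => /eqP; rewrite addr_eq0 => /eqP.
Qed.

Lemma lbracketN u v : lbracket G (- u) v = - lbracket G u v.
Proof. exact: (linfN (lbracket_linear_l v)). Qed.

(** Invariance moves exp(t w) from the first argument to the second as exp(-t w); the two sides are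
    the derivatives at 0 of one and the same function of t. *)
Lemma invariant_form_lbracket (B : 'rV[R]_d -> 'rV[R]_d -> R) w u v :
  (forall u, scalar (B u)) -> (forall u v, B u v = B v u) ->
  (forall (h : G) u v, B (Ad h u) (Ad h v) = B u v) ->
  B (lbracket G w u) v = - B u (lbracket G w v).
Proof.
move=> lB sB iB.
have lBu : linear (B u) by exact: lB.
have lBv : linear (fun u => B u v) by move=> a x y; rewrite !(sB _ v); exact: lB.
have [_ <-] := is_derive_linearf lBv (is_derive_Ad w u).
have [_ E1] := is_derive_linearf lBu (is_derive_Ad (- w) v).
rewrite -[RHS](linfN lBu) -lbracketN -E1.
set k1 := fun t => _; set k2 := fun t => _; suff -> : k1 = k2 by [].
apply/funext => t; rewrite /k1 /k2 -(iB (lexp (t *: - w))); congr B.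
have -> : lexp (t *: w) = (lexp (t *: - w))^-1%g :> G.
  apply: (@mulgI G (lexp (t *: - w))); rewrite mulgV scalerN -scaleNr -lexpD.
  by rewrite addNr scale0r lexp0.
by rewrite AdVK.
Qed.

End Adjoint.

Section Naturality.
Context (R : realType) (d e : nat) (G : lieGroupType R d) (H : lieGroupType R e).
Context (f : G -> H) (lf : lie_hom f).

Lemma lie_diff_Ad g v : lie_diff f (Ad g v) = Ad (f g) (lie_diff f v).
Proof.
have [hf sf] := lf; rewrite /lie_diff /Ad.
pose proof (mfderiv_comp 1%g v sf (smooth_conj g)) as E1.
pose proof (mfderiv_comp 1%g v (smooth_conj (f g)) sf) as E2.
move: E1 E2; rewrite mulg1 mulgV (lie_hom1 lf) => <- <-.
set k1 := _ \o _; set k2 := _ \o _; suff -> : k1 = k2 by [].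
by apply/funext => h; rewrite /k1 /k2 /= !hf (lie_homV lf).
Qed.

Lemma lie_diff_lbracket u v :
  lie_diff f (lbracket G u v) = lbracket H (lie_diff f u) (lie_diff f v).
Proof.
have [_ <-] := is_derive_linearf (lie_diff_linear lf) (is_derive_Ad G u v).
rewrite /lbracket derive1E.
set k1 := fun t => _; set k2 := fun t => _; suff -> : k1 = k2 by [].
apply/funext => t; rewrite /k1 /k2 lie_diff_Ad (lie_hom_lexp lf).
by rewrite (linfZ (lie_diff_linear lf)).
Qed.

End Naturality.

(** * Complex bilinearity of the bracket *)

Section ComplexLie.
Context (R : realType) (n : nat) (G : complexLieGroupType R n).

Lemma Jmx_linear : linear (@Jmx R n).
Proof.
move=> a u v; rewrite /Jmx scale_row_mx add_row_mx.
have -> : rsubmx (a *: u + v) = a *: rsubmx u + rsubmx v.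
  by apply/matrixP => i j; rewrite !mxE.
have -> : lsubmx (a *: u + v) = a *: lsubmx u + lsubmx v.
  by apply/matrixP => i j; rewrite !mxE.
by rewrite opprD scalerN.
Qed.

Lemma JmxK (v : 'rV[R]_(n + n)) : Jmx (Jmx v) = - v.
Proof. by rewrite /Jmx row_mxKl row_mxKr -[in RHS](hsubmxK v) opp_row_mx. Qed.

Lemma JmxN (v : 'rV[R]_(n + n)) : Jmx (- v) = - Jmx v.
Proof. exact: (linfN Jmx_linear). Qed.

(** Conjugation by g is the map h |-> g h^-1 applied twice, since g (g h^-1)^-1 = g h g^-1, and the
    holomorphy axiom says that this map has a complex linear differential. *)
Lemma Ad_Jmx (g : G) v : Ad g (Jmx v) = Jmx (Ad g v).
Proof.
have [_ H _] := @divg_holomorphic R n G.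
have sd : smooth_map (fun h : G => (g * h^-1)%g).
  apply: smooth_map_plot => k c ac; have oc := atlas_open_image ac.
  exact: (plot_div oc (plot_cst k g oc) (plot_param k ac)).
have Hg (x : G) (w : 'rV[R]_(n + n)) :
    mfderiv (fun h : G => (g * h^-1)%g) x (Jmx w) =
    Jmx (mfderiv (fun h : G => (g * h^-1)%g) x w) := H g x w.
have E1 w : Ad g w = mfderiv (fun h : G => (g * h^-1)%g) (g * 1^-1)%g
     (mfderiv (fun h : G => (g * h^-1)%g) 1%g w).
  pose proof (mfderiv_comp (1%g : G) w sd sd) as E2; rewrite /Ad -E2.
  set k1 := fun h => _; set k2 := _ \o _; suff -> : k1 = k2 by [].
  by apply/funext => h; rewrite /k1 /k2 /= invgM invgK mulgA.
by rewrite E1 Hg Hg -E1.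
Qed.

Lemma lbracket_Jr (u v : 'rV[R]_(n + n)) :
  lbracket G u (Jmx v) = Jmx (lbracket G u v).
Proof.
have [_ <-] := is_derive_linearf Jmx_linear (is_derive_Ad G u v).
rewrite /lbracket derive1E.
set k1 := fun t => _; set k2 := fun t => _; suff -> : k1 = k2 by [].
apply/funext => t; exact: Ad_Jmx.
Qed.

Lemma lbracket_Jl (u v : 'rV[R]_(n + n)) :
  lbracket G (Jmx u) v = Jmx (lbracket G u v).
Proof. by rewrite lbracketC lbracket_Jr (lbracketC _ v u) JmxN opprK. Qed.

End ComplexLie.

(** * Borel probabilities and the weak topology *)

Lemma continuous_sum_ord (R : realType) (T : topologicalType) (V : normedModType R)
  n (f : 'I_n -> T -> V) (x : T) : (forall i, {for x, continuous (f i)}) ->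
  {for x, continuous (fun x => \sum_i f i x)}.
Proof.
elim: n f => [|n IH] f cf.
  have -> : (fun x => \sum_(i < 0) f i x) = cst 0.
    by apply/funext => y; rewrite big_ord0.
  exact: cvg_cst.
have -> : (fun x => \sum_(i < n.+1) f i x) =
    (fun x => \sum_(i < n) f (widen_ord (leqnSn n) i) x + f ord_max x).
  by apply/funext => y; rewrite big_ord_recr.
by apply: cvgD; [apply: IH => i; exact: cf|exact: cf].
Qed.

Section ContinuousFunctions.
Context (R : realType) (T : ptopologicalType).

Definition bint (nu : borel_prob R T) (f : T -> R) : R :=
  \int[bp_measure nu]_x (f x).

Lemma open_borel (A : set T) : open A -> measurable (A : set (borelType T)).
Proof. by move=> oA; exact: sub_sigma_algebra. Qed.

Lemma closed_borel (A : set T) : closed A -> measurable (A : set (borelType T)).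
Proof.
move=> cA; rewrite -[A]setCK; apply: measurableC.
by apply: open_borel; exact: closed_openC.
Qed.

Lemma continuous_borel (f : T -> R) : continuous f ->
  measurable_fun setT (f : borelType T -> R).
Proof.
move=> /continuousP cf; apply: (measurability _ (RGenOpens.measurableE R)).
move=> _ [_ [a [b ->] <-]]; rewrite setTI; apply: open_borel.
exact/cf/interval_open.
Qed.

Lemma continuous_borel_map (f : T -> T) : continuous f ->
  measurable_fun setT (f : borelType T -> borelType T).
Proof.
move=> /continuousP cf; apply: (@measurability _ _ (borelType T) (borelType T) setT f (@open T) erefl).
by move=> _ [A oA <-]; rewrite setTI; apply: open_borel; exact: cf.
Qed.

Context (cT : compact [set: T]).

Lemma continuous_bounded (f : T -> R) : continuous f ->
  exists C, forall x, `|f x| <= C.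
Proof.
move=> cf.
have ne : [set: T] !=set0 by exists point.
have cn : {within [set: T], continuous (fun x => `|f x|)}.
  apply: continuous_subspaceT => x.
  by apply: continuous_comp; [exact: cf|exact: norm_continuous].
have [x _ xM] := compact_EVT_max ne cT cn.
by exists `|f x| => y; apply: xM; rewrite inE.
Qed.

Lemma bint_integrable (nu : borel_prob R T) (f : T -> R) : continuous f ->
  (bp_measure nu).-integrable setT (EFin \o f).
Proof.
move=> cf; apply: measurable_bounded_integrable => //.
- by rewrite [X in (X < _)%E](_ : _ = 1%E) ?ltry//; exact: probability_setT.
- exact: (@continuous_borel f cf).
- have [C fC] := continuous_bounded cf.
  exists C; split; first exact: num_real.
  by move=> M CM x _; apply: le_trans (fC x) (ltW CM).
Qed.

Lemma bint_EFin (nu : borel_prob R T) (f : T -> R) : continuous f ->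
  (\int[bp_measure nu]_x (f x)%:E)%E = (bint nu f)%:E.
Proof.
move=> cf; rewrite /bint /Rintegral fineK//.
exact: integrable_fin_num (bint_integrable nu cf).
Qed.

Lemma bint_cst (nu : borel_prob R T) c : bint nu (fun=> c) = c.
Proof.
rewrite /bint Rintegral_cst// [X in fine X](_ : _ = 1%E) ?mulr1//.
exact: probability_setT.
Qed.

Lemma bintD (nu : borel_prob R T) (f g : T -> R) : continuous f -> continuous g ->
  bint nu (fun x => f x + g x) = bint nu f + bint nu g.
Proof. by move=> cf cg; apply: RintegralD => //; exact: bint_integrable. Qed.

Lemma bintB (nu : borel_prob R T) (f g : T -> R) : continuous f -> continuous g ->
  bint nu (fun x => f x - g x) = bint nu f - bint nu g.
Proof. by move=> cf cg; apply: RintegralB => //; exact: bint_integrable. Qed.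

Lemma bintZ (nu : borel_prob R T) a (f : T -> R) : continuous f ->
  bint nu (fun x => a * f x) = a * bint nu f.
Proof. by move=> cf; apply: RintegralZl => //; exact: bint_integrable. Qed.

Lemma bint_sum (nu : borel_prob R T) n (f : 'I_n -> T -> R) :
  (forall i, continuous (f i)) ->
  bint nu (fun x => \sum_i f i x) = \sum_i bint nu (f i).
Proof.
elim: n f => [|n IH] f cf.
  rewrite big_ord0 -[RHS](bint_cst nu); congr bint.
  by apply/funext => x; rewrite big_ord0.
rewrite big_ord_recr /= -IH// -bintD//.
  by congr bint; apply/funext => x; rewrite big_ord_recr.
by move=> x; apply: continuous_sum_ord => i; exact: cf.
Qed.

Lemma bint_le (nu : borel_prob R T) (f g : T -> R) : continuous f -> continuous g ->
  (forall x, f x <= g x) -> bint nu f <= bint nu g.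
Proof.
by move=> cf cg fg; apply: le_Rintegral => //; exact: bint_integrable.
Qed.

Lemma bint_norm_le (nu : borel_prob R T) (f : T -> R) C : continuous f ->
  (forall x, `|f x| <= C) -> `|bint nu f| <= C.
Proof.
move=> cf fC; rewrite ler_norml -[X in X <= _ <= _](bint_cst nu).
rewrite -[X in _ <= _ <= X](bint_cst nu).
have fC' x : - C <= f x <= C by rewrite -ler_norml.
have cc (c : R) : continuous (fun _ : T => c) by move=> x; exact: cvg_cst.
by apply/andP; split; apply: bint_le => // x; have /andP[] := fC' x.
Qed.

End ContinuousFunctions.

Section BorelProb.
Context (R : realType) (T : ptopologicalType).

Lemma borel_prob_eq (nu nu' : borel_prob R T) :
  (forall A : set (borelType T), measurable A ->
    bp_measure nu A = bp_measure nu' A) -> nu = nu'.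
Proof.
case: nu nu' => [m mo] [m' mo'] /= H.
have E : (m : set _ -> \bar R) = (m' : set _ -> \bar R).
  apply/funext => A; have [mA|nA] := pselect (measurable A); first exact: H.
  by rewrite mo// mo'.
(* The remaining components of a probability are proofs, so equality of the underlying functions is
   enough. *)
have E' : m = m'.
  clear -E; case: m m' E => [m cm] [m' cm'] /= E; subst m'.
  congr Probability.Pack.
  case: cm => [[a1 a2] [a3] [a4] [a5] [a6] [a7] [a8]].
  case: cm' => [[b1 b2] [b3] [b4] [b5] [b6] [b7] [b8]].
  by rewrite (Prop_irrelevance a1 b1) (Prop_irrelevance a2 b2)
    (Prop_irrelevance a3 b3) (Prop_irrelevance a4 b4) (Prop_irrelevance a5 b5)
    (Prop_irrelevance a6 b6) (Prop_irrelevance a7 b7) (Prop_irrelevance a8 b8).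
by subst m'; congr BorelProb; exact: Prop_irrelevance.
Qed.

(* set to 0 outside the Borel sets as [bp_outside] requires *)
Definition borel_push (nu : borel_prob R T) (f : T -> T) (cf : continuous f)
    (A : set (borelType T)) : \bar R :=
  if `[< measurable A >] then bp_measure nu (f @^-1` A) else 0%E.

Section Push.
Context (nu : borel_prob R T) (f : T -> T) (cf : continuous f).

Lemma borel_pushE (A : set (borelType T)) : measurable A ->
  borel_push nu cf A = bp_measure nu (f @^-1` A).
Proof. by move=> mA; rewrite /borel_push; case: asboolP. Qed.

Let push0 : borel_push nu cf set0 = 0%E.
Proof. by rewrite borel_pushE// preimage_set0 measure0. Qed.

Let push_ge0 A : (0 <= borel_push nu cf A)%E.
Proof. by rewrite /borel_push; case: asboolP => // mA; exact: measure_ge0. Qed.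

Let push_sigma_additive : semi_sigma_additive (borel_push nu cf).
Proof.
have mpre (A : set (borelType T)) : measurable A ->
    measurable (f @^-1` A : set (borelType T)).
  move=> mA; rewrite -[X in measurable X]setTI.
  exact: (continuous_borel_map cf).
move=> F mF tF mUF; rewrite borel_pushE// preimage_bigcup.
under eq_fun do under eq_bigr do rewrite borel_pushE//.
apply: measure_semi_sigma_additive.
- by move=> n; exact: mpre.
- apply/trivIsetP => /= i j _ _ ij; rewrite -preimage_setI.
  by move/trivIsetP : tF => /(_ _ _ _ _ ij) ->//; rewrite preimage_set0.
- by rewrite -preimage_bigcup; exact: mpre.
Qed.

HB.instance Definition _ := isMeasure.Build _ _ _ (borel_push nu cf)
  push0 push_ge0 push_sigma_additive.

Let push_setT : borel_push nu cf setT = 1%E.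
Proof. by rewrite borel_pushE// preimage_setT; exact: probability_setT. Qed.

HB.instance Definition _ := Measure_isProbability.Build _ _ _ (borel_push nu cf)
  push_setT.

Lemma borel_push_outside (A : set (borelType T)) :
  ~ measurable A -> borel_push nu cf A = 0%E.
Proof. by move=> nA; rewrite /borel_push; case: asboolP. Qed.

Lemma bp_push_exists : exists nu' : borel_prob R T,
  forall A : set (borelType T), measurable A ->
    bp_measure nu' A = bp_measure nu (f @^-1` A).
Proof.
exists (@BorelProb R T (borel_push nu cf) borel_push_outside) => A mA.
exact: borel_pushE.
Qed.

End Push.

(** The choice in [bp_push] falls back on [nu] if no push-forward exists; for continuous [f] one
    does, and the default is never taken. *)
Lemma bp_pushE (nu : borel_prob R T) (f : T -> T) : continuous f ->
  forall A : set (borelType T), measurable A ->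
  bp_measure (bp_push f nu) A = bp_measure nu (f @^-1` A).
Proof.
move=> cf; have [nu' H] := bp_push_exists nu cf.
rewrite /bp_push; case: xgetP => [nu'' _ H''|/(_ nu') H''].
  by move=> A mA; rewrite H''.
by exfalso; apply: H'' => A mA; rewrite H.
Qed.

Lemma bint_push (nu : borel_prob R T) (f : T -> T) (phi : T -> R) :
  compact [set: T] -> continuous f -> continuous phi ->
  bint (bp_push f nu) phi = bint nu (fun x => phi (f x)).
Proof.
move=> cT cf cphi; rewrite /bint /Rintegral; congr fine.
have cphif : continuous (phi \o f).
  by move=> x; apply: continuous_comp; [exact: cf|exact: cphi].
have mf := continuous_borel_map cf.
transitivity (\int[pushforward (bp_measure nu) (f : borelType T -> borelType T)]_x (phi x)%:E)%E.
  by apply: eq_measure_integral => A mA _; exact: bp_pushE.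
rewrite (integral_pushforward mf)//.
- by apply/measurable_EFinP; exact: (@continuous_borel R T phi).
- by rewrite preimage_setT; exact: (bint_integrable cT nu cphif).
Qed.

End BorelProb.

(** * The weak topology: continuity of evaluations and separation *)

Section WeakTopology.
Context (R : realType) (T : ptopologicalType).

Lemma continuous_prod_topology (Y : topologicalType) (I : Type)
    (h : Y -> prod_topology (fun _ : I => R)) :
  (forall i, continuous (fun y => h y i)) -> continuous h.
Proof.
move=> ch x; apply/cvg_sup => i.
move: x; apply/(@continuousP _ (initial_topology (@^~ i))) => A [B oB <-].
have -> : h @^-1` ((@^~ i) @^-1` B) = (fun y => h y i) @^-1` B by [].
by move/continuousP: (ch i); exact.
Qed.

Lemma bint_continuous (f : T -> R) : continuous f ->
  continuous (fun nu : borel_prob R T => bint nu f).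
Proof.
move=> cf; pose i : {f : T -> R | continuous f} := exist _ f cf.
have -> : (fun nu : borel_prob R T => bint nu f) =
    (fun w : prod_topology (fun _ : {f : T -> R | continuous f} => R) => w i) \o
    @bp_eval R T by [].
move=> nu; apply: continuous_comp.
  exact: (@initial_continuous _ _ (@bp_eval R T)).
have /cvg_sup/(_ i) H : nbhs (bp_eval nu) --> bp_eval nu by exact: cvg_id.
move=> A nA; apply: H.
exact: (@initial_continuous _ _ (fun w : forall _ : {f : T -> R | continuous f}, R => w i) (bp_eval nu) A nA).
Qed.

Lemma continuous_borel_prob (Y : topologicalType) (g : Y -> borel_prob R T) :
  (forall f, continuous f -> continuous (fun y => bint (g y) f)) -> continuous g.
Proof.
move=> cg; apply: (@continuous_comp_initial _ _ _ (@bp_eval R T)).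
by apply: continuous_prod_topology => -[f cf]; exact: cg.
Qed.

Context (cT : compact [set: T]) (hT : hausdorff_space T) (sT : @second_countable T).

(** A compact Hausdorff space is normal, so each point of [U] has a basic neighbourhood whose
    closure stays in [U]; a countable base leaves countably many such closures. *)
Lemma open_closed_exhaustion (U : set T) : open U ->
  exists F : nat -> set T, [/\ forall n, closed (F n), nondecreasing_seq F
    & \bigcup_n F n = U].
Proof.
move=> oU; have [B cB [oB bB]] := sT.
have /countable_injP [f finj] := cB.
(* The injection [f] numbers the base; a number that is not hit, or whose basic set has a closure
   leaving [U], contributes the empty set. *)
pose D n := [set x | exists b, [/\ B b, f b = n, closure b `<=` U & closure b x]].
have cD n : closed (D n).
  have [[b [Bb fb bU]]|nb] := pselect (exists b, [/\ B b, f b = n & closure b `<=` U]).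
    have -> : D n = closure b; last exact: closed_closure.
    apply/seteqP; split=> x; last by move=> bx; exists b.
    move=> [b' [Bb' fb' _]]; suff -> : b' = b by [].
    by apply: finj; rewrite ?inE// fb.
  have -> : D n = set0; last exact: closed0.
  by apply/seteqP; split=> x // [b [Bb fb bU _]]; apply: nb; exists b.
exists (fun n => \big[setU/set0]_(i < n.+1) D i); split.
- by move=> n; apply: closed_bigsetU.
- by move=> m n mn; apply/subsetPset/subset_bigsetU.
- rewrite bigcup_bigsetU_bigcup; apply/seteqP; split=> x.
    by move=> [n _ [b [_ _ bU bx]]]; exact: bU.
  move=> Ux; have nT := compact_normal hT cT.
  have [V [Vx VU]] : exists V, nbhs x V /\ closure V `<=` U.
    have c1 : closed [set x] by exact: accessible_closed_set1 (hausdorff_accessible hT) _.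
    have [|V sV VU] := nT [set x] c1 U.
      by move=> y ->; exact: open_nbhs_nbhs.
    by exists V; split=> //; apply: sV.
  have [b [Bb bx] bV] := bB x V Vx.
  exists (f b) => //; exists b; split=> //.
    exact: subset_trans (closureS bV) VU.
  exact: subset_closure.
Qed.

(** A Urysohn function squeezed between the indicators of a closed [F n] and of [U] gives nu(F n) <=
    nu'(U), and the closed sets exhaust [U]. *)
Lemma measure_open_le (nu nu' : borel_prob R T) :
  (forall f, continuous f -> bint nu f = bint nu' f) ->
  forall U : set T, open U -> (bp_measure nu U <= bp_measure nu' U)%E.
Proof.
move=> H U oU; have [F [cF ndF FU]] := open_closed_exhaustion oU.
have mF n : measurable (F n : set (borelType T)) by exact: closed_borel.
have mU : measurable (U : set (borelType T)) by exact: open_borel.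
have cv : bp_measure nu \o F @ \oo --> bp_measure nu U.
  by rewrite -FU; apply: nondecreasing_cvg_mu => //; rewrite FU.
rewrite -(cvg_lim _ cv)//; apply: lime_le; first by apply/cvg_ex; eexists; exact: cv.
apply: nearW => n /=.
have sep : uniform_separator (~` U) (F n).
  apply: (normal_separatorP.1 (compact_normal hT cT)) => //; first exact: open_closedC.
  by apply/disjoints_subset; apply: subsetC; rewrite -FU; exact: bigcup_sup.
pose f : T -> R := Urysohn (~` U) (F n).
have cf : continuous f by exact: Urysohn_continuous.
have f01 x : 0 <= f x <= 1.
  have := @Urysohn_range T R (~` U) (F n) (f x); rewrite /= in_itv/=; apply.
  by exists x.
have f0 x : ~ U x -> f x = 0.
  by move=> nUx; have := Urysohn_sub0 sep; apply; exists x.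
have f1 x : F n x -> f x = 1.
  by move=> Fx; have := Urysohn_sub1 sep; apply; exists x.
have mf := @continuous_borel R T f cf.
apply: (@le_trans _ _ (\int[bp_measure nu]_x (f x)%:E)%E).
  rewrite -[X in (bp_measure nu X <= _)%E]setIT -integral_indic//.
  apply: ge0_le_integral => //.
  - by apply/measurable_EFinP; exact: measurable_indic.
  - exact/measurable_EFinP.
  - move=> x _; rewrite lee_fin indicE; case: (boolP (x \in F n)) => [|_].
      by rewrite inE => /f1 ->.
    by have /andP[] := f01 x.
rewrite bint_EFin// H// -bint_EFin//.
rewrite -[X in (_ <= bp_measure nu' X)%E]setIT -integral_indic//.
apply: ge0_le_integral => //.
- by move=> x _; rewrite lee_fin; have /andP[] := f01 x.
- exact/measurable_EFinP.
- by apply/measurable_EFinP; exact: measurable_indic.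
- move=> x _; rewrite lee_fin indicE; case: (boolP (x \in U)) => [_|].
    by have /andP[] := f01 x.
  by rewrite notin_setE => /f0 ->.
Qed.

(** The two measures agree on open sets, which are stable under intersection and generate the Borel
    sets. *)
Lemma bint_inj (nu nu' : borel_prob R T) :
  (forall f, continuous f -> bint nu f = bint nu' f) -> nu = nu'.
Proof.
move=> H; apply: borel_prob_eq => A mA.
apply: (@measure_unique _ R (borelType T) (@open T) (fun=> setT)) => //.
- by move=> U V oU oV; exact: openI.
- by move=> _; exact: openT.
- by rewrite bigcup_const.
- move=> U oU; apply/eqP; rewrite eq_le; apply/andP; split.
    exact: measure_open_le.
  by apply: measure_open_le => // f cf; rewrite H.
- move=> _; rewrite [X in (X < _)%E](_ : _ = 1%E) ?ltry//.
  exact: probability_setT.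
Qed.

Lemma borel_prob_hausdorff : hausdorff_space (borel_prob R T).
Proof.
move=> p q pq; apply: bint_inj => f cf; apply: (@Rhausdorff R).
move=> A B nA nB.
have [nu [Anu Bnu]] := pq _ _ (bint_continuous cf nA) (bint_continuous cf nB).
by exists (bint nu f).
Qed.

End WeakTopology.

(** * Differentiation under the integral sign *)

Section JointlySmooth.
Context (R : realType) (T : topologicalType) (V : normedModType R).
Implicit Types (O : set V) (Phi Psi : T -> V -> R).

Definition jcont (x : T) (y : V) Phi : Prop :=
  {for (x, y), continuous (fun p : T * V => Phi p.1 p.2)}.

(** C^k in the second variable, uniformly enough to integrate: the first variable is a parameter in
    a bare topological space, where only continuity makes sense. *)
Fixpoint jCk (k : nat) O Phi : Prop :=
  (forall x y, O y -> jcont x y Phi) /\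
  (if k is k'.+1 then
     forall v, (forall x y, O y -> derivable (Phi x) y v) /\
       jCk k' O (fun x => 'D_v (Phi x))
   else True).

Lemma jCk_jcont k O Phi : jCk k O Phi -> forall x y, O y -> jcont x y Phi.
Proof. by case: k => [|k] []. Qed.

Lemma jCk_derivable k O Phi : jCk k.+1 O Phi ->
  forall x y v, O y -> derivable (Phi x) y v.
Proof. by move=> [_ H] x y v; exact: (H v).1. Qed.

Lemma jCk_derive k O Phi v : jCk k.+1 O Phi -> jCk k O (fun x => 'D_v (Phi x)).
Proof. by move=> [_ H]; exact: (H v).2. Qed.

Lemma jCkS k O Phi : jCk k.+1 O Phi -> jCk k O Phi.
Proof.
elim: k Phi => [|k IH] Phi C; first by split=> //; exact: jCk_jcont C.
split=> [|v]; first exact: jCk_jcont C.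
split=> [x y Oy|]; first exact: (jCk_derivable C).
exact/IH/jCk_derive.
Qed.

Lemma jcontl x y Phi : jcont x y Phi -> {for x, continuous (fun x => Phi x y)}.
Proof.
move=> C; apply: (@continuous_comp _ _ _ (fun x => (x, y))
  (fun p : T * V => Phi p.1 p.2)); last exact: C.
by apply: cvg_pair => /=; [exact: cvg_id|exact: cvg_cst].
Qed.

Lemma jcont_const x y (b : V -> R) : {for y, continuous b} -> jcont x y (fun=> b).
Proof.
move=> cb; apply: (@continuous_comp _ _ _ snd b); last exact: cb.
exact: cvg_snd.
Qed.

Lemma jcont_eq O x y Phi Psi : open O -> O y ->
  (forall x y, O y -> Phi x y = Psi x y) -> jcont x y Phi -> jcont x y Psi.
Proof.
move=> oO Oy E; rewrite /jcont /prop_for /continuous_at /= -E//.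
apply: cvg_trans; apply: near_eq_cvg.
have : \forall p \near (x, y), (O \o snd) p.
  by apply: (@cvg_snd _ _ (nbhs x) (nbhs y) _); exact: open_near.
by apply: filterS => -[a b] /= Ob; rewrite E.
Qed.

Lemma jCk_eq k O Phi Psi : open O -> (forall x y, O y -> Phi x y = Psi x y) ->
  jCk k O Phi -> jCk k O Psi.
Proof.
move=> oO; elim: k Phi Psi => [|k IH] Phi Psi E C.
  by split=> // x y Oy; exact: jcont_eq oO Oy E (jCk_jcont C Oy).
have nE x y : O y -> \forall z \near y, Phi x z = Psi x z.
  by move=> Oy; apply: filterS (open_near oO Oy) => z; exact: E.
split=> [x y Oy|v]; first exact: jcont_eq oO Oy E (jCk_jcont C Oy).
split=> [x y Oy|].
  apply: near_eq_derivable (nE x y Oy) _; exact: (jCk_derivable C).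
apply: IH (jCk_derive v C) => x y Oy.
exact/near_eq_derive/nE.
Qed.

Lemma jCk_const k O (b : V -> R) : Ck k O b -> jCk k O (fun=> b).
Proof.
elim: k b => [|k IH] b Cb.
  by split=> // x y Oy; apply: jcont_const; exact: Ck_continuous Cb _ Oy.
split=> [x y Oy|v]; first by apply: jcont_const; exact: Ck_continuous Cb _ Oy.
split=> [x y Oy|]; first by apply: (Ck_derivable Cb).
exact/IH/Ck_derive.
Qed.

Lemma jCkD k O Phi Psi : open O -> jCk k O Phi -> jCk k O Psi ->
  jCk k O (fun x y => Phi x y + Psi x y).
Proof.
move=> oO; elim: k Phi Psi => [|k IH] Phi Psi C D.
  by split=> // x y Oy; apply: cvgD; [exact: (jCk_jcont C)|exact: (jCk_jcont D)].
split=> [x y Oy|v].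
  by apply: cvgD; [exact: (jCk_jcont C)|exact: (jCk_jcont D)].
split=> [x y Oy|].
  by apply: derivableD; [exact: (jCk_derivable C)|exact: (jCk_derivable D)].
apply: jCk_eq (IH _ _ (jCk_derive v C) (jCk_derive v D)) => // x y Oy.
by rewrite deriveD//; [exact: (jCk_derivable C)|exact: (jCk_derivable D)].
Qed.

Lemma jCkM k O Phi Psi : open O -> jCk k O Phi -> jCk k O Psi ->
  jCk k O (fun x y => Phi x y * Psi x y).
Proof.
move=> oO; elim: k Phi Psi => [|k IH] Phi Psi C D.
  by split=> // x y Oy; apply: cvgM; [exact: (jCk_jcont C)|exact: (jCk_jcont D)].
have H x y v : O y -> is_derive y v (fun y => Phi x y * Psi x y)
    (Phi x y * 'D_v (Psi x) y + 'D_v (Phi x) y * Psi x y).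
  move=> Oy; apply: is_derive_scale; apply: derivableP.
    exact: (jCk_derivable C).
  exact: (jCk_derivable D).
split=> [x y Oy|v].
  by apply: cvgM; [exact: (jCk_jcont C)|exact: (jCk_jcont D)].
split=> [x y Oy|]; first by have [] := H x y v Oy.
apply: jCk_eq (jCkD oO (IH _ _ (jCkS C) (jCk_derive v D))
  (IH _ _ (jCk_derive v C) (jCkS D))) => // x y Oy.
by have [] := H x y v Oy.
Qed.

Lemma jCk_sum k O n (Phi : 'I_n -> T -> V -> R) : open O ->
  (forall i, jCk k O (Phi i)) -> jCk k O (fun x y => \sum_i Phi i x y).
Proof.
move=> oO; elim: n Phi => [|n IH] Phi C.
  apply: jCk_eq (jCk_const (Ck_cst k O 0)) => // x y _.
  by rewrite big_ord0.
apply: jCk_eq (jCkD oO (IH (fun i => Phi (widen_ord (leqnSn n) i)) _) (C ord_max)) => //.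
by move=> x y _; rewrite big_ord_recr.
Qed.

(** Continuity in [x] at the single value [y0] is enough: near (x0, y0) the partial derivatives in y
    are bounded, so the mean value theorem controls the change from [y0] to [y] for all nearby [x]
    at once. *)
Lemma jcont_of_derive {fV : finDim V} O Phi x0 y0 : open O -> O y0 ->
  (forall x, Ck 1 O (Phi x)) -> {for x0, continuous (fun x => Phi x y0)} ->
  (forall v, jcont x0 y0 (fun x => 'D_v (Phi x))) -> jcont x0 y0 Phi.
Proof.
move=> oO Oy0 C1 cx cD; have [[n [b [c [cc bc]]]]] := fV.
apply/cvgrPdist_le => /= _/posnumP[eps].
(* Joint continuity with tolerance 1 bounds each partial derivative near the point by its value
   there plus 1. *)
pose K := \sum_i (`|'D_(b i) (Phi x0) y0| + 1).
have K0 : 0 <= K by apply: sumr_ge0 => i _; rewrite addr_ge0.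
have H : \forall p \near (x0, y0), O p.2 /\
    forall i : 'I_n, `|'D_(b i) (Phi p.1) p.2| <= `|'D_(b i) (Phi x0) y0| + 1.
  apply: filterI.
    by apply: (@cvg_snd _ _ (nbhs x0) (nbhs y0) _); exact: open_near.
  have Hi i : \forall p \near (x0, y0),
      `|'D_(b i) (Phi p.1) p.2| <= `|'D_(b i) (Phi x0) y0| + 1.
    have /cvgrPdist_le/(_ 1 ltr01) := cD (b i); apply: filterS => p /= Hp.
    by rewrite -lerBlDl; apply: le_trans Hp; rewrite distrC lerB_dist.
  exact: (@filter_forall _ _ _ _ (nbhs_filter (x0, y0)) Hi).
have [[A B] /= [nA nB] AB] := H.
have /nbhs_ballP[del /= del0 Hd] := nB.
have nx : \forall x \near x0, `|Phi x0 y0 - Phi x y0| <= eps%:num / 2.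
  by move/cvgrPdist_le : cx; apply.
have ny : \forall y \near y0, forall i : 'I_n,
    `|c i (y - y0)| <= eps%:num / 2 / (K + 1).
  apply: filter_forall => i.
  have e2 : 0 < eps%:num / 2 / (K + 1) by rewrite !divr_gt0// ltr_wpDl.
  have cy : {for y0, continuous (fun y => c i (y - y0))}.
    apply: (@continuous_comp _ _ _ (fun y => y - y0) (c i)); last exact: cc.
    by apply: cvgB; [exact: cvg_id|exact: cvg_cst].
  move/cvgrPdist_le : cy => /(_ _ e2); rewrite subrr linear0.
  by apply: filterS => y; rewrite sub0r normrN.
exists ((A `&` [set x | `|Phi x0 y0 - Phi x y0| <= eps%:num / 2]),
  (ball y0 del `&` [set y | forall i : 'I_n, `|c i (y - y0)| <= eps%:num / 2 / (K + 1)])).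
  split=> /=; first exact: filterI.
  by apply: filterI => //; exact: nbhsx_ballx.
move=> [x y] /= [[Ax xe] [yd yc]].
have inB (s : R) : `|s| <= `|1 : R| -> B (y0 + s *: (y - y0)).
  rewrite normr1 => s1; apply: Hd; move: yd; rewrite -ball_normE /ball_/=.
  rewrite opprD addNKr normrN normrZ -normrN opprB => yd.
  by apply: le_lt_trans yd; rewrite ler_piMl.
have dP (s : R) : `|s| <= `|1 : R| -> derivable (Phi x) (y0 + s *: (y - y0)) (y - y0).
  move=> s1; have [Os _] := AB (x, y0 + s *: (y - y0)) (conj Ax (inB s s1)).
  by apply: (Ck_derivable (C1 x)).
have [s s1] := mvt_line dP.
rewrite scale1r [y0 + _]addrC subrK mul1r => E.
have [Os Ds] := AB (x, y0 + s *: (y - y0)) (conj Ax (inB s s1)).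
move: E Os Ds; set z := y0 + s *: (y - y0) => E Os Ds.
have lD : linear (fun v => 'D_v (Phi x) z) by exact: (derive_linear oO (C1 x) Os).
have -> : Phi x0 y0 - Phi x y = (Phi x0 y0 - Phi x y0) - (Phi x y - Phi x y0).
  by rewrite opprB addrA subrK.
apply: (le_trans (ler_normB _ _)); rewrite [leRHS]splitr lerD// E.
rewrite (bc (y - y0)) (linf_sum lD); apply: (le_trans (ler_norm_sum _ _ _)).
apply: (@le_trans _ _ (\sum_i (eps%:num / 2 / (K + 1)) * (`|'D_(b i) (Phi x0) y0| + 1))).
  apply: ler_sum => i _; rewrite (linfZ lD) normrM.
  by apply: ler_pM => //; exact: Ds.
rewrite -mulr_sumr -/K -mulrA ler_piMr ?divr_ge0//.
by rewrite mulrC ler_pdivrMr ?ltr_wpDl// mul1r lerDl.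
Qed.

End JointlySmooth.

Section CompactParameter.
Context (R : realType) (T : topologicalType) (cT : compact [set: T]).

(** Each point (x, y0) has a box on which [Phi] stays within [eps / 2] of [Phi x y0]; by compactness
    finitely many boxes cover the fibre over [y0]. *)
Lemma compact_uniform (Y : topologicalType) (Phi : T -> Y -> R) y0 eps :
  (forall x, {for (x, y0), continuous (fun p : T * Y => Phi p.1 p.2)}) ->
  0 < eps -> \forall y \near y0, forall x, `|Phi x y - Phi x y0| <= eps.
Proof.
move=> C e0; have e2 : 0 < eps / 2 by rewrite divr_gt0.
have /compact_near_coveringP/(_ _ (nbhs y0)
  (fun y x => `|Phi x y - Phi x y0| <= eps) _) H := cT.
have : \forall y \near y0, [set: T] `<=` (fun x => `|Phi x y - Phi x y0| <= eps).
  apply: H => x _; have /cvgrPdist_le/(_ _ e2) [[A B] /= [nA nB] AB] := C x.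
  exists (A, B) => // -[x' y'] /= [Ax' By'].
  have -> : Phi x' y' - Phi x' y0 =
    (Phi x y0 - Phi x' y0) - (Phi x y0 - Phi x' y') by rewrite opprB [RHS]addrC subrKA.
  apply: (le_trans (ler_normB _ _)); rewrite [leRHS]splitr; apply: lerD.
    by apply: (AB (x', y0)); split=> //=; exact: nbhs_singleton.
  exact: (AB (x', y')).
by apply: filterS => y Hy x; exact: Hy.
Qed.

End CompactParameter.

Section DifferentiationUnderIntegral.
Context (R : realType) (T : ptopologicalType) (cT : compact [set: T]).
Context (V : normedModType R) (O : set V) (oO : open O) (nu : borel_prob R T).

Lemma bint_continuous_param (Y : topologicalType) (Phi : T -> Y -> R) y0 :
  (\forall y \near y0, continuous (fun x => Phi x y)) ->
  (forall x, {for (x, y0), continuous (fun p : T * Y => Phi p.1 p.2)}) ->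
  {for y0, continuous (fun y => bint nu (fun x => Phi x y))}.
Proof.
move=> cx C; apply/cvgrPdist_le => eps e0; near=> y.
rewrite distrC -bintB//; last 2 first.
- by near: y.
- exact: (nbhs_singleton cx).
apply: bint_norm_le => //.
  move=> x; apply: cvgB; last exact: (nbhs_singleton cx).
  by move: x; near: y.
near: y; exact: compact_uniform.
Unshelve. all: by end_near. Qed.

(** The mean value theorem turns the difference quotient into a derivative at an intermediate point,
    and [compact_uniform] makes its convergence uniform in x; the integral of a probability
    preserves the bound. *)
Lemma bint_is_derive (Phi : T -> V -> R) y v : O y ->
  (forall x y, O y -> derivable (Phi x) y v) ->
  (forall y, O y -> continuous (fun x => Phi x y)) ->
  (forall x y, O y -> jcont x y (fun x => 'D_v (Phi x))) ->
  is_derive y v (fun y => bint nu (fun x => Phi x y))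
    (bint nu (fun x => 'D_v (Phi x) y)).
Proof.
move=> Oy dP cP cD.
have cDy z : O z -> continuous (fun x => 'D_v (Phi x) z).
  by move=> Oz x; exact: (jcontl (cD x z Oz)).
pose q (t : R) := t^-1 *: (bint nu (fun x => Phi x (t *: v + y)) -
  bint nu (fun x => Phi x y)).
have C : q @ 0^' --> bint nu (fun x => 'D_v (Phi x) y).
  apply/cvgrPdist_le => eps e0.
  have : \forall z \near y, O z /\
      forall x, `|'D_v (Phi x) z - 'D_v (Phi x) y| <= eps.
    apply: filterI; first exact: open_near.
    by apply: (@compact_uniform R T cT V (fun x => 'D_v (Phi x))) => // x; exact: cD.
  move=> /nbhs_ballP[del /= del0 Hd].
  near=> t.
  have t0 : t != 0 by near: t; exact: nbhs_dnbhs_neq.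
  have tv : `|t| * `|v| < del.
    apply: (@le_lt_trans _ _ (`|t| * (`|v| + 1))); first by rewrite ler_wpM2l// lerDl.
    rewrite -ltr_pdivlMr ?ltr_wpDl//.
    by near: t; apply: dnbhs0_lt; rewrite divr_gt0// ltr_wpDl.
  have inB (s : R) : `|s| <= `|t| -> ball y del (y + s *: v).
    move=> st; rewrite -ball_normE /ball_/= opprD addNKr normrN normrZ.
    by apply: le_lt_trans tv; rewrite ler_wpM2r.
  have Ot : O (t *: v + y) by rewrite addrC; have [] := Hd _ (inB t (lexx _)).
  have -> : q t = bint nu (fun x => t^-1 * (Phi x (t *: v + y) - Phi x y)).
    rewrite bintZ//; last by move=> x; apply: cvgB; exact: cP.
    by rewrite bintB//; exact: cP.
  have cq : continuous (fun x => t^-1 * (Phi x (t *: v + y) - Phi x y)).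
    move=> x; apply: cvgMl_tmp; apply: cvgB; exact: cP.
  rewrite -bintB//; last exact: cDy.
  apply: bint_norm_le => //.
    by move=> x; apply: cvgB; [exact: cDy|exact: cq].
  move=> x.
  have [s st E] := @mvt_line R V (Phi x) y v t
    (fun s st => dP x _ (Hd _ (inB s st)).1).
  rewrite [t *: v + y]addrC E mulrA mulVf// mul1r distrC.
  exact: (Hd _ (inB s st)).2.
by split; rewrite /derivable /derive; [apply/cvg_ex; eexists; exact: C
  |apply: cvg_lim => //; exact: C].
Unshelve. all: by end_near. Qed.

Lemma jCk_slice k (Phi : T -> V -> R) : jCk k O Phi ->
  forall y, O y -> continuous (fun x => Phi x y).
Proof. by move=> C y Oy x; apply: jcontl; exact: (jCk_jcont C). Qed.

Lemma jCk_is_derive k (Phi : T -> V -> R) y v : jCk k.+1 O Phi -> O y ->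
  is_derive y v (fun y => bint nu (fun x => Phi x y))
    (bint nu (fun x => 'D_v (Phi x) y)).
Proof.
move=> C Oy; apply: bint_is_derive => //.
- by move=> x z Oz; exact: (jCk_derivable C).
- exact: jCk_slice C.
- by move=> x z Oz; exact: (jCk_jcont (jCk_derive v C)).
Qed.

Lemma Ck_bint k (Phi : T -> V -> R) : jCk k O Phi ->
  Ck k O (fun y => bint nu (fun x => Phi x y)).
Proof.
have cb j (Psi : T -> V -> R) y : jCk j O Psi -> O y ->
    {for y, continuous (fun y => bint nu (fun x => Psi x y))}.
  move=> C Oy; apply: bint_continuous_param.
    by apply: filterS (open_near oO Oy) => z; exact: jCk_slice C z.
  by move=> x; exact: (jCk_jcont C).
elim: k Phi => [|k IH] Phi C; first by split=> // y; exact: cb C.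
split=> [y|v]; first exact: cb C.
split=> [y Oy|]; first by have [] := jCk_is_derive v C Oy.
apply: Ck_eq (IH _ (jCk_derive v C)) => // y Oy.
by have [] := jCk_is_derive v C Oy.
Qed.

End DifferentiationUnderIntegral.

(** * Subspaces, actions and right logarithmic derivatives *)

Section Subtype.
Context (X : topologicalType) (A : set X).

Lemma set_val_continuous : continuous (set_val : A -> X).
Proof. exact: initial_continuous. Qed.

Lemma compact_set_type : compact A -> compact [set: A].
Proof.
move=> cA F PF _.
have FA : F (set_val @^-1` A) by apply: filterS filterT => x _; exact: set_valP.
have [p [Ap clp]] := cA (set_val @ F) _ FA.
exists (exist _ p (mem_set Ap)); split=> // U V FU [W [/= [W' oW' <-] W'p W'V]].
have FU' : (set_val @ F) (set_val @` U).
  have FU'' : F (set_val @^-1` (set_val @` U)).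
    by apply: filterS FU => x Ux; exists x.
  exact: FU''.
have nW' : nbhs p W' by exact: open_nbhs_nbhs.
have [_ [[x Ux <-] W'x]] := clp _ _ FU' nW'.
by exists x; split=> //; exact: W'V.
Qed.

Lemma second_countable_set_type : @second_countable X -> @second_countable A.
Proof.
move=> [B cB [oB bB]]; exists ((fun U => set_val @^-1` U) @` B).
  exact: (card_le_trans (card_image_le _ _)).
split=> [_ [U BU <-]|x].
  by apply: open_comp; [move=> ? _; exact: set_val_continuous|exact: oB].
move=> V [W [/= [W' oW' <-] W'x W'V]].
have [U [BU Ux] UW'] := bB (set_val x) W' (open_nbhs_nbhs (conj oW' W'x)).
exists (set_val @^-1` U); first by split=> //; exists U.
by move=> y /UW' W'y; exact: W'V.
Qed.

End Subtype.

(** * Joint smoothness for points moved by a smooth action *)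

Section JointlySmoothManifold.
Context (R : realType) (F V : normedModType R).
Context (Z : manifoldType F) (T : topologicalType) (i : T -> Z) (ci : continuous i).
Context (O : set V).
Implicit Types (f : Z -> V -> R).

Let dom (c : chart F Z) := [set p : V * F | O p.1 /\ cimage c p.2].

Let read f (c : chart F Z) (p : V * F) := f (param c p.2) p.1.

Lemma derivable_pair1 (W : normedModType R) (h : V * F -> W) x y v :
  derivable h (x, y) (v, 0) <-> derivable (fun z => h (z, y)) x v.
Proof.
have E1 : (fun t : R => t^-1 *: ((h \o shift (x, y)) (t *: (v, 0)) - h (x, y))) =
    (fun t : R => t^-1 *: (((fun z => h (z, y)) \o shift x) (t *: v) - h (x, y))).
  apply/funext => t; congr (_ *: (h _ - _)).
  by congr pair; rewrite /= scaler0 add0r.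
by rewrite /derivable E1.
Qed.

Lemma derive_pair1 (W : normedModType R) (h : V * F -> W) x y v :
  'D_(v, 0) h (x, y) = 'D_v (fun z => h (z, y)) x.
Proof.
have E1 : (fun t : R => t^-1 *: ((h \o shift (x, y)) (t *: (v, 0)) - h (x, y))) =
    (fun t : R => t^-1 *: (((fun z => h (z, y)) \o shift x) (t *: v) - h (x, y))).
  apply/funext => t; congr (_ *: (h _ - _)).
  by congr pair; rewrite /= scaler0 add0r.
by rewrite /derive E1.
Qed.

Lemma jcont_manifold f : (forall c, atlas c -> Ck 0 (dom c) (read f c)) ->
  forall x y, O y -> jcont x y (fun x => f (i x)).
Proof.
move=> H x y Oy; have ac := chart_at_atlas (i x); set c := chart_at (i x) in ac.
have cx : cdom c (i x) by exact: chart_at_dom.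
have C : {for (x, y), continuous (fun p : T * V =>
    read f c (p.2, Defs.coord c (i p.1)))}.
  apply: (@continuous_comp _ _ _
    (fun p : T * V => (p.2, Defs.coord c (i p.1))) (read f c)); last first.
    by apply: (Ck_continuous (H c ac)); split=> //=; exact: cimage_coord.
  apply: cvg_pair; first exact: cvg_snd.
  apply: (@continuous_comp _ _ _ (i \o fst) (Defs.coord c)) => /=; last first.
    exact: atlas_coord_continuous.
  by apply: continuous_comp; [exact: cvg_fst|exact: ci].
rewrite /jcont /prop_for /continuous_at /=.
rewrite -[X in _ --> f X y](atlas_coordK ac cx); apply: cvg_trans C.
apply: near_eq_cvg.
have : \forall p \near (x, y), ((fun x => cdom c (i x)) \o fst) p.
  apply: (@cvg_fst _ _ (nbhs x) (nbhs y) _); apply: ci.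
  by apply: open_nbhs_nbhs; split=> //; exact: atlas_open.
by apply: filterS => -[a b] /= ca; rewrite /read/= atlas_coordK.
Qed.

(** Deriving in [v] commutes with reading in a chart of [Z], where it is the derivative in direction
    (v, 0); the hypothesis thus passes to the derivative. The map [i] is only continuous, so [T] may
    be any subset of [Z]. *)
Lemma jCk_manifold k f : (forall c, atlas c -> Ck k (dom c) (read f c)) ->
  jCk k O (fun x => f (i x)).
Proof.
elim: k f => [|k IH] f H; first by split=> //; exact: jcont_manifold.
have H0 c (ac : atlas c) : Ck 0 (dom c) (read f c) by exact: Ck_le (H c ac).
split=> [|v]; first exact: jcont_manifold.
split=> [x y Oy|].
  have ac := chart_at_atlas (i x); set c := chart_at (i x) in ac.
  have cx : cdom c (i x) by exact: chart_at_dom.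
  have Dp : dom c (y, Defs.coord c (i x)) by split=> //=; exact: cimage_coord.
  have : derivable (read f c) (y, Defs.coord c (i x)) (v, 0).
    by apply: (Ck_derivable (H c ac)).
  by move/derivable_pair1; rewrite /read/= atlas_coordK.
apply: (IH (fun z => 'D_v (f z))) => c ac.
have -> : read (fun z => 'D_v (f z)) c = 'D_(v, 0) (read f c).
  by apply/funext => -[y w]; rewrite derive_pair1.
exact: (Ck_derive (v, 0) (H c ac)).
Qed.

End JointlySmoothManifold.

Section JointlySmoothAction.
Context (R : realType) (E F V : normedModType R).
Context {fE : finDim E} {fF : finDim F} {fV : finDim V}.
Context (H : manifoldType E) (Z : manifoldType F).
Context (act : H -> Z -> Z) (sact : smooth_map2 act).
Context (T : topologicalType) (i : T -> Z) (ci : continuous i).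

Lemma jCk_action k (O : set V) (g : V -> H) (phi : Z -> R) : open O ->
  plot k O g -> smooth_fun phi -> jCk k O (fun x y => phi (act (g y) (i x))).
Proof.
move=> oO pg sphi.
pose f z y := phi (act (g y) z).
suff : jCk k O (fun x => f (i x)) by [].
apply: (jCk_manifold ci) => c ac; rewrite /f {f}.
set D := [set p : V * F | _].
have oD : open D.
  apply: openI; apply: open_comp => //; try exact: atlas_open_image.
    by move=> y _; exact: cvg_fst.
  by move=> y _; exact: cvg_snd.
apply: (Ck_smooth_fun (f := fun p : V * F => act (g p.1) (param c p.2)) oD sphi).
apply: plot_smooth_map2 => //.
  apply: (plot_precomp oO oD _ (Ck_fst _ oD) pg).
  by move=> p [].
apply: (plot_precomp (atlas_open_image ac) oD _ (Ck_snd _ oD) (plot_param _ ac)).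
by move=> p [].
Qed.

End JointlySmoothAction.

Section RightLogarithmicDerivative.
Context (R : realType) (d : nat) (G : lieGroupType R d).
Context (V : normedModType R) {fV : finDim V}.

(** The right logarithmic derivative df f^-1. Translating to the identity before differentiating
    keeps all values in the Lie algebra, seen through the single chart at 1. *)
Definition rlog (f : V -> G) (v y : V) : 'rV[R]_d :=
  pd (fun z => f z * (f y)^-1)%g y v.

(** It is the partial derivative of (x, y) |-> f(x) f(y)^-1 in the first variable, restricted to the
    diagonal. *)
Lemma Ck_rlog k (O : set V) (f : V -> G) v :
  open O -> plot k.+1 O f -> Ck k O (rlog f v).
Proof.
move=> oO pf; set c := chart_at (1%g : G); have ac : atlas c by exact: chart_at_atlas.
have c1 : cdom c 1%g by exact: chart_at_dom.
pose W := [set p : V * V | (fst @^-1` O `&` snd @^-1` O) p].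
have oW : open W.
  apply: openI; apply: open_comp => //.
    by move=> y _; exact: cvg_fst.
  by move=> y _; exact: cvg_snd.
pose Q (p : V * V) := (f p.1 * (f p.2)^-1)%g.
have pQ : plot k.+1 W Q.
  have p1 : plot k.+1 W (f \o fst).
    by apply: (plot_precomp oO oW _ (Ck_fst _ oW) pf) => p [].
  have p2 : plot k.+1 W (f \o snd).
    by apply: (plot_precomp oO oW _ (Ck_snd _ oW) pf) => p [].
  exact: (plot_div oW p1 p2).
have C := Ck_derive (v, 0) (plot_coord pQ ac).
have oS : open [set x | W x /\ cdom c (Q x)].
  by apply: (plot_open oW _ pQ); exact: atlas_open.
pose j (x : V) := (x, x).
have jS x : O x -> [set x | W x /\ cdom c (Q x)] (j x).
  by move=> Ox; split=> //; rewrite /Q /= mulgV.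
have Cj : Ck k O j by exact: Ck_pair oO (Ck_id _ _) (Ck_id _ _).
have C2 : Ck k O ('D_(v, 0) (Defs.coord c \o Q) \o j).
  exact: (@Ck_comp _ _ _ _ _ _ _ _ _ _ _ oO oS jS Cj C).
apply: (Ck_eq oO _ C2) => x Ox.
by rewrite [LHS]derive_pair1 /rlog /pd mulgV.
Qed.

Lemma rlogE (O : set V) (f : V -> G) v y : open O -> plot 1 O f -> O y ->
  rlog f v y = mfderiv (fun g : G => (g * (f y)^-1)%g) (f y) (pd f y v).
Proof.
by move=> oO pf Oy; exact: (pd_smooth_map v oO (smooth_rmul (f y)^-1%g) pf Oy).
Qed.

End RightLogarithmicDerivative.

Section AlmostEverywhere.
Context (R : realType) (T : ptopologicalType) (cT : compact [set: T]).
Context (nu : borel_prob R T).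

Lemma open_nonzero (f : T -> R) : continuous f -> open [set x | f x != 0].
Proof.
move=> cf; apply: (@open_comp _ _ f [set x | x != 0]); last exact: open_neq.
by move=> x _; exact: cf.
Qed.

Lemma bint_eq0_null (f : T -> R) : continuous f -> (forall x, 0 <= f x) ->
  bint nu f = 0 -> bp_measure nu [set x | f x != 0] = 0%E.
Proof.
move=> cf f0 I0.
have /integrableP[mf _] := bint_integrable cT nu cf.
have : (\int[bp_measure nu]_x `|(EFin \o f) x| = 0)%E.
  rewrite -[RHS]/(0%:E) -I0 -(bint_EFin cT nu cf); apply: eq_integral => x _ /=.
  by rewrite ger0_norm.
move/(ae_eq_integral_abs _ measurableT mf) => [N [mN N0 sN]].
apply: (@subset_measure0 _ _ _ (bp_measure nu) _ N) => //.
  by apply: open_borel; exact: open_nonzero.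
by move=> x /= /eqP fx; apply: sN => /= H; apply: fx; have := H I => -[].
Qed.

Lemma borel_preimage (f : T -> T) (A : set (borelType T)) : continuous f ->
  measurable A -> measurable (f @^-1` A : set (borelType T)).
Proof.
by move=> cf mA; rewrite -[_ @^-1` _]setTI; exact: (continuous_borel_map cf).
Qed.

(** A Borel set and its preimage under [f] coincide outside [N]. *)
Lemma bp_push_ae_id (f : T -> T) (N : set (borelType T)) :
  continuous f -> measurable N -> bp_measure nu N = 0%E ->
  (forall x, ~ N x -> f x = x) -> bp_push f nu = nu.
Proof.
move=> cf mN N0 fN; apply: borel_prob_eq => A mA; rewrite bp_pushE//.
have mfA := borel_preimage cf mA.
have E1 (C : set (borelType T)) : measurable C ->
    bp_measure nu C = bp_measure nu (C `\` N).
  move=> mC; rewrite (measureDI (bp_measure nu) mC mN).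
  rewrite [X in (_ + X)%E](_ : _ = 0%E) ?adde0//.
  apply: (@subset_measure0 _ _ _ (bp_measure nu) _ N) => //.
  exact: measurableI.
rewrite (E1 _ mfA) (E1 _ mA); congr (bp_measure nu _).
by apply/seteqP; split=> x [/= Ax Nx]; split=> //=; move: Ax; rewrite (fN x Nx).
Qed.

End AlmostEverywhere.

(** * Compatible subgroups *)

Lemma linfunE (K : fieldType) (V W : vectType K) (f : V -> W) v :
  linear f -> linfun f v = f v.
Proof. by move=> lf; exact: (lfunE (linear_of lf)). Qed.

Lemma linfZs (R : realType) (V : lmodType R) (l : V -> R) (ll : linear l) a v :
  l (a *: v) = a * l v.
Proof. exact: (linfZ ll). Qed.

Lemma row_linear_sum (R : realType) d (V : lmodType R) (l : 'rV[R]_d -> V)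
    (ll : linear l) v :
  l v = \sum_j v 0 j *: l (delta_mx 0 j).
Proof.
rewrite [in LHS](row_sum_delta v) (linf_sum ll).
by apply: eq_bigr => j _; rewrite (linfZ ll).
Qed.

(** The last hypothesis is the value of c + 2 t a + t^2 b at its minimiser t = - a / b. *)
Lemma cauchy_schwarz_discriminant (R : realType) (c a b : R) : 0 < b ->
  0 <= c -> 0 <= c + - (a / b) * a + - (a / b) * (a + - (a / b) * b) ->
  `|a| <= Num.sqrt c * Num.sqrt b.
Proof.
move=> b0 c0; rewrite -sqrtrM// -sqrtr_sqr ler_sqrt ?mulr_ge0 ?(ltW b0)//. rewrite [- (a / b) * b]mulNr divfK ?gt_eqF// subrr mulr0 addr0.
by rewrite mulNr mulrAC -expr2 subr_ge0 ler_pdivrMr.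
Qed.

Lemma linear_row (K : realType) (V : lmodType K) n (f : 'I_n -> V -> K) :
  (forall j, linear (f j)) -> linear (fun u => \row_j f j u : 'rV[K]_n).
Proof. by move=> lf a u v; apply/rowP => j; rewrite !mxE lf. Qed.

(** The subspace is given as the range of an idempotent [pr]: a pseudo-inverse of [r \o pr] finds a
    preimage, [pr] brings it back into the subspace, and injectivity there identifies it. *)
Lemma linear_left_inverse (K : fieldType) (V W : vectType K) (r : V -> W)
    (pr : V -> V) (lr : linear r) (lpr : linear pr) :
  (forall v, pr (pr v) = pr v) ->
  (forall u v, pr u = u -> pr v = v -> r u = r v -> u = v) ->
  exists2 l : W -> V, linear l & forall u, pr u = u -> u = l (r u).
Proof.
move=> prK rinj; have lrp : linear (r \o pr) by move=> a u v /=; rewrite lpr lr.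
pose f := linfun (r \o pr).
exists (fun w => pr ((f^-1)%VF w)); first by move=> a u v; rewrite linearP lpr.
move=> u up; apply: rinj => //.
have fu : f u = r u by rewrite (linfunE _ lrp) /= up.
have fE : f ((f^-1)%VF (r u)) = r u by rewrite limg_lfunVK// -fu memv_img ?memvf.
by rewrite -[LHS]fE (linfunE _ lrp).
Qed.

Section CompatibleGroup.
Context (R : realType) (dU n d : nat) (U : lieGroupType R dU).
Context (UC : complexLieGroupType R n) (G : lieGroupType R d).
Context (iU : U -> UC) (iG : G -> UC) (hU : lie_hom iU) (hG : lie_hom iG).
Context (injG : injective (lie_diff iG)) (cG : compatible iU iG).
Context (B : 'rV[R]_(n + n) -> 'rV[R]_(n + n) -> R) (B_form : invariant_form iU B).

Local Notation p := (lie_p iU iG).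
Local Notation ipB := (ip iG B).

Let dU_linear : linear (lie_diff iU). Proof. exact: lie_diff_linear. Qed.
Let dG_linear : linear (lie_diff iG). Proof. exact: lie_diff_linear. Qed.

Let JdU_linear : linear (fun xi => Jmx (lie_diff iU xi)).
Proof. by move=> a u v; rewrite dU_linear Jmx_linear. Qed.

Lemma lie_pP beta :
  beta \in p <-> exists b, lie_diff iG beta = Jmx (lie_diff iU b).
Proof.
rewrite /lie_p -memv_preim (linfunE _ dG_linear); split.
  by move=> /memv_imgP[b _]; rewrite (linfunE _ JdU_linear); exists b.
move=> [b ->]; apply/memv_imgP; exists b; first exact: memvf.
by rewrite (linfunE _ JdU_linear).
Qed.

Lemma lie_kP kappa :
  kappa \in lie_k iU iG <-> exists b, lie_diff iG kappa = lie_diff iU b.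
Proof.
rewrite /lie_k -memv_preim (linfunE _ dG_linear); split.
  by move=> /memv_imgP[b _]; rewrite (linfunE _ dU_linear); exists b.
move=> [b ->]; apply/memv_imgP; exists b; first exact: memvf.
by rewrite (linfunE _ dU_linear).
Qed.

Lemma proj_p_linear : linear (proj_p iU iG).
Proof. by move=> a u v; rewrite /proj_p linearP. Qed.

Lemma proj_p_in v : proj_p iU iG v \in p.
Proof. exact: memv_pi. Qed.

Lemma pk_cap : (p :&: lie_k iU iG = 0)%VS.
Proof. by have [_ _] := cG; rewrite capvC. Qed.

Lemma proj_p_id v : v \in p -> proj_p iU iG v = v.
Proof. by move=> vp; apply: daddv_pi_id => //; exact: pk_cap. Qed.

Lemma proj_p_decomp v : exists2 k, k \in lie_k iU iG & v = proj_p iU iG v + k.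
Proof.
exists (daddv_pi (lie_k iU iG) p v); first exact: memv_pi.
rewrite daddv_pi_add//; first exact: pk_cap.
by have [_ + _] := cG; rewrite addvC => ->; exact: memvf.
Qed.

Lemma B_linear_r u : linear (B u).
Proof. by have [[lB _] _ _ _ _] := B_form; exact: lB. Qed.

Lemma B_sym u v : B u v = B v u.
Proof. by have [[_ sB] _ _ _ _] := B_form. Qed.

Lemma ip_linear_r u : linear (ipB u).
Proof. by move=> a v w; rewrite /ip dG_linear B_linear_r. Qed.

Lemma ip_sym u v : ipB u v = ipB v u.
Proof. exact: B_sym. Qed.

Lemma ip_linear_l v : linear (ipB^~ v).
Proof. by move=> a u w; rewrite !(ip_sym _ v) ip_linear_r. Qed.

Lemma ip_gt0 u : u \in p -> u != 0 -> 0 < ipB u u.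
Proof.
move=> /lie_pP[b E] u0; have [_ _ _ H _] := B_form.
have [|_] := H b; last by rewrite /ip E.
apply: contra_neq u0 => b0; apply: injG; rewrite E b0.
by rewrite (linf0 dG_linear) (linf0 (@Jmx_linear R n)).
Qed.

Lemma ip_ge0 u : u \in p -> 0 <= ipB u u.
Proof.
move=> up; have [->|u0] := eqVneq u 0; first by rewrite (linf0 (ip_linear_r 0)).
exact/ltW/ip_gt0.
Qed.

Lemma ip_CS u v : u \in p -> v \in p ->
  `|ipB u v| <= Num.sqrt (ipB u u) * Num.sqrt (ipB v v).
Proof.
move=> up vp; have [->|v0] := eqVneq v 0.
  by rewrite (linf0 (ip_linear_r u)) normr0 mulr_ge0 ?sqrtr_ge0.
have vv := ip_gt0 vp v0; have uu := ip_ge0 up.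
pose t := ipB u v / ipB v v.
have E : ipB (u + - t *: v) (u + - t *: v) =
    ipB u u + - t * ipB u v + - t * (ipB u v + - t * ipB v v).
  rewrite (linfD (ip_linear_l _)) (linfD (ip_linear_r u)).
  rewrite (linfZs (ip_linear_l _)) (linfD (ip_linear_r v)).
  by rewrite (linfZs (ip_linear_r u)) (linfZs (ip_linear_r v)) (ip_sym v u).
have : 0 <= ipB (u + - t *: v) (u + - t *: v).
  by apply: ip_ge0; rewrite memvD ?memvZ.
rewrite E /t; exact: (cauchy_schwarz_discriminant vv uu).
Qed.

(* The Riesz map of the scalar product is injective on [p], so it has a linear left
   inverse there. *)
Lemma ip_coordinates : exists2 l : 'rV[R]_d -> 'rV[R]_d, linear l &
  forall u, u \in p ->
    u = l (\row_j ipB u (proj_p iU iG (delta_mx 0 j))).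
Proof.
pose r (u : 'rV[R]_d) : 'rV[R]_d := \row_j ipB u (proj_p iU iG (delta_mx 0 j)).
have lr : linear r.
  apply: (@linear_row _ _ _ (fun j u => ipB u (proj_p iU iG (delta_mx 0 j)))) => j.
  exact: ip_linear_l.
have rinj u v : u \in p -> v \in p -> r u = r v -> u = v.
  move=> up vp ruv; apply/eqP; rewrite -subr_eq0; apply/negPn/negP => uv0.
  have wp : u - v \in p by rewrite memvB.
  have rw : r (u - v) = 0 by rewrite (linfD lr) (linfN lr) ruv subrr.
  move: (u - v) uv0 wp rw => x x0 xp rx.
  have lin : linear (fun y => ipB x (proj_p iU iG y)).
    by move=> a y z; rewrite proj_p_linear ip_linear_r.
  have E1 : ipB x (proj_p iU iG x) = 0.
    apply: (etrans (row_linear_sum lin x)); apply: big1 => j _.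
    by move/rowP/(_ j) : rx; rewrite !mxE => ->; exact: scaler0.
  by move: (ip_gt0 xp x0); rewrite -[X in ipB x X](proj_p_id xp) E1 ltxx.
have rinj' u v : proj_p iU iG u = u -> proj_p iU iG v = v -> r u = r v -> u = v.
  by move=> <- <-; apply: rinj; exact: proj_p_in.
have [l ll lP] := linear_left_inverse lr proj_p_linear
  (fun v => proj_p_id (proj_p_in v)) rinj'.
by exists l => // u up; apply: lP; exact: proj_p_id.
Qed.

End CompatibleGroup.

(** * Kempf-Ness functions of measures *)

Lemma rlog_lexp_line (R : realType) d (G : lieGroupType R d) (v : 'rV[R]_d) :
  rlog (fun t : R^o => lexp (t *: v) : G) (1 : R^o) (0 : R^o) = v.
Proof.
rewrite /rlog; set f := fun z => _.
have -> : f = (fun t : R^o => lexp (t *: v) : G).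
  by apply/funext => z; rewrite /f scale0r lexp0 invg1 mulg1.
exact: pd_lexp_line.
Qed.

(** All difference quotients of an additive function agree with those at 0, so its derivative is
    constant. *)
Lemma derive1_additive (R : realType) (g : R -> R) :
  (forall s t, g (s + t) = g s + g t) -> derive1 (derive1 g) 0 = 0.
Proof.
move=> gD; have g0 : g 0 = 0 by apply: (@addrI _ (g 0)); rewrite -gD !addr0.
suff -> : derive1 g = fun=> derive1 g 0 by rewrite derive1_cst.
apply/funext => t; rewrite /derive1.
have -> : (fun h => h^-1 *: (g (h + t) - g t)) = (fun h => h^-1 *: (g (h + 0) - g 0)).
  by apply/funext => h; rewrite addr0 gD g0 subr0 addrK.
by [].
Qed.

Section IntegralsOfFamilies.
Context (R : realType) (T : ptopologicalType) (cT : compact [set: T]).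
Implicit Types (nu : borel_prob R T) (Phi : T -> R^o -> R).

Lemma bint_derive1 nu Phi (t : R) : jCk 1 [set: R^o] Phi ->
  derive1 (fun s => bint nu (Phi^~ s)) t = bint nu (fun x => derive1 (Phi x) t).
Proof.
move=> J; rewrite derive1E.
have [_ ->] := @jCk_is_derive R T cT R^o setT openT nu 0 _ t 1 J I.
by congr bint; apply/funext => x; rewrite derive1E.
Qed.

Lemma jCk_derive1 k Phi : jCk k.+1 [set: R^o] Phi ->
  jCk k [set: R^o] (fun x t => derive1 (Phi x) t).
Proof.
move=> J; rewrite (_ : (fun x t => _) = fun x => 'D_1 (Phi x)); first exact: jCk_derive.
by apply/funext => x; apply/funext => s; rewrite derive1E.
Qed.

Lemma bint_derive2 nu Phi (t : R) : jCk 2 [set: R^o] Phi ->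
  derive1n 2 (fun s => bint nu (Phi^~ s)) t = bint nu (fun x => derive1n 2 (Phi x) t).
Proof.
move=> J; have J1 := jCk_derive1 J.
have E1 : derive1 (fun s => bint nu (Phi^~ s)) =
    fun s => bint nu (fun x => derive1 (Phi x) s).
  by apply/funext => s; apply: bint_derive1; exact: jCkS.
by rewrite -[LHS]/(derive1 (derive1 (fun s => bint nu (Phi^~ s))) t) E1 bint_derive1.
Qed.

Lemma jCk_derive2_continuous Phi (t : R) : jCk 2 [set: R^o] Phi ->
  continuous (fun x => derive1n 2 (Phi x) t).
Proof. by move=> J; exact: (jCk_slice (jCk_derive1 (jCk_derive1 J)) I). Qed.

End IntegralsOfFamilies.

(* [phi x w] stands for the pairing of the gradient map at [x] with the [p]-part
   of [w]. *)
Section AbstractKempfNess.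
Context (R : realType) (d : nat) (G : lieGroupType R d) (K : set G).
Context (p : {vspace 'rV[R]_d}) (T : ptopologicalType).
Context (act : G -> T -> T) (Psi : T -> G -> R) (kn : kempf_ness K p act Psi).
Context (cart : forall g : G, exists k v, [/\ K k, v \in p & g = (k * lexp v)%g]).
Context (Psi1 : forall x, Psi x 1%g = 0).
Context (phi : T -> 'rV[R]_d -> R) (phi_linear : forall x, linear (phi x)).
Context (dPsi : forall x g v,
  mfdiff (Psi x) g v = phi (act g x) (mfderiv (fun g' : G => (g' * g^-1)%g) g v)).
Context (jphi : forall (V : normedModType R), finDim V -> forall k (O : set V)
  (f : V -> G) w, open O -> plot k O f -> jCk k O (fun x y => phi (act (f y) x) w)).

Section Plots.
Context (V : normedModType R) {fV : finDim V} (O : set V) (oO : open O).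
Context (f : V -> G).

Lemma is_derive_Psi x y v : plot 1 O f -> O y ->
  is_derive y v (fun z => Psi x (f z)) (phi (act (f y) x) (rlog f v y)).
Proof.
move=> pf Oy; rewrite (rlogE v oO pf Oy) -dPsi.
exact: (derive_smooth_fun v oO (kn_P1 kn x) pf Oy).
Qed.

(** Expanding the logarithmic derivative in the standard basis separates a function of y alone from
    the jointly smooth [phi]. Only the first derivative is computed; the product rule supplies all
    higher ones. *)
Lemma jCk_dPsi k v : plot k.+1 O f ->
  jCk k O (fun x => 'D_v (fun y => Psi x (f y))).
Proof.
move=> pf; have pf1 : plot 1 O f by exact: plot_le pf.
apply: (@jCk_eq _ _ _ _ _ (fun x y =>
    \sum_j (rlog f v y) 0 j * phi (act (f y) x) (delta_mx 0 j))) => //.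
  move=> x y Oy; have [_ ->] := is_derive_Psi x v pf1 Oy.
  rewrite {2}(row_sum_delta (rlog f v y)) (linf_sum (phi_linear _)).
  by apply: eq_bigr => j _; rewrite (linfZ (phi_linear _)).
apply: jCk_sum => // j; apply: jCkM => //; last first.
  by apply: jphi => //; exact: (plot_le (leqnSn _) pf).
apply: jCk_const.
have lj : linear (fun u : 'rV[R]_d => u 0 j : R^o) by move=> a u w; rewrite !mxE.
exact: (@Ck_lincomp R V 'rV[R]_d R^o k O (linear_of lj) _
  (linear_continuous_findim lj) oO (Ck_rlog v oO pf)).
Qed.

End Plots.

(* Continuity in [x] is not part of the definition of a Kempf-Ness function; it follows
   from the mean value theorem on [0, 1] because [Psi] vanishes at 1 and its derivative
   along [exp (t v)] is jointly continuous. *)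
Lemma Psi_continuous g : continuous (Psi^~ g).
Proof.
have [k [v [Kk vp ->]]] := cart g.
have -> : Psi^~ (k * lexp v)%g = Psi^~ (lexp v).
  by apply/funext => x; rewrite (kn_P2 kn).
pose Phi x (t : R^o) := Psi x (lexp (t *: v)).
have pf : plot 2 [set: R^o] (fun t : R^o => lexp (t *: v) : G).
  exact: plot_lexp_line.
have pf1 := plot_le (isT : 1 <= 2)%N pf.
have oT : open [set: R^o] by exact: openT.
have J := @jCk_dPsi R^o _ setT oT _ 1%N (1 : R^o) pf.
(* The mean value theorem will yield a point with [|s| <= 1], so uniformity is needed on the whole
   of [-1, 1]. *)
pose S : set R := [set` `[-1, 1]%R]; move=> x0.
have U (eps : R) : 0 < eps -> \forall x \near x0, forall s : S,
    `|'D_1 (Phi x) (set_val s) - 'D_1 (Phi x0) (set_val s)| <= eps.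
  move=> e0; apply: (@compact_uniform _ S _ _
    (fun s x => 'D_1 (Phi x) (set_val s)) x0 eps _ e0).
    exact/compact_set_type/segment_compact.
  move=> s; apply: (@continuous_comp _ _ _
    (fun q : S * T => (q.2, set_val q.1)) (fun q => 'D_1 (Phi q.1) q.2)).
    apply: (@cvg_pair _ _ _ _ (nbhs x0) (nbhs (set_val s)) _ _ _ snd (set_val \o fst)).
      exact: cvg_snd.
    apply: (@cvg_comp _ _ _ fst set_val _ (nbhs s)); first exact: cvg_fst.
    exact: set_val_continuous.
  exact: (jCk_jcont (J _)).
apply/cvgrPdist_le => eps e0; near=> x; rewrite distrC.
have dv y (s : R^o) : derivable (Phi y) s (1 : R^o).
  by have [] := @is_derive_Psi R^o setT oT _ y s (1 : R^o) pf1 I.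
have dB (s : R) : `|s| <= `|1 : R| ->
    derivable (fun t : R^o => Phi x t - Phi x0 t) (0 + s *: (1 : R^o)) (1 : R^o).
  by move=> _; apply: derivableB; exact: dv.
have [s s1] := mvt_line dB.
rewrite add0r scale1r /Phi !scale0r !lexp0 !Psi1 subr0 subr0 scale1r mul1r.
have -> : (0 + s *: (1 : R^o)) = s by rewrite add0r; exact: mulr1.
move=> ->; rewrite deriveB; [|exact: dv|exact: dv].
have Ss : S s.
  by rewrite /S /= in_itv /= -ler_norml; move: s1; rewrite normr1.
have : forall s : S, `|'D_1 (Phi x) (set_val s) - 'D_1 (Phi x0) (set_val s)| <= eps.
  by near: x; exact: U.
by move=> /(_ (exist _ s (mem_set Ss))).
Unshelve. all: by end_near. Qed.

(** The loss of orders is harmless: the families it is applied to, inverse charts and exponential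
    lines, are plots of every order. *)
Lemma jCk_Psi (V : normedModType R) (fV : finDim V) k (O : set V) (f : V -> G) :
  open O -> plot k.+2 O f -> jCk k O (fun x y => Psi x (f y)).
Proof.
move=> oO pf; have pf1 : plot 1 O f by exact: plot_le pf.
have jc x y : O y -> jcont x y (fun x y => Psi x (f y)).
  move=> Oy; apply: (@jcont_of_derive _ _ _ _ O) => //.
  - by move=> x'; exact: (Ck_smooth_fun oO (kn_P1 kn x') pf1).
  - exact: Psi_continuous.
  - by move=> v; exact: (jCk_jcont (jCk_dPsi oO v pf)).
case: k pf => [|k] pf; split=> // v; split=> [x y Oy|].
  by have [] := is_derive_Psi oO x v pf1 Oy.
by apply: jCk_dPsi => //; exact: (plot_le (leqW (leqnSn _)) pf).
Qed.

Lemma act_continuous g : continuous (act g).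
Proof.
move=> x; apply: (@continuous_comp _ _ _ (fun y => (g, y)) (fun gy => act gy.1 gy.2)).
  by apply: cvg_pair; [exact: cvg_cst|exact: cvg_id].
exact: (kn_action_continuous kn).
Qed.

Lemma jCk_Psi_line k v :
  jCk k [set: R^o] (fun x (t : R^o) => Psi x (lexp (t *: v))).
Proof. by apply: jCk_Psi; [exact: openT|exact: plot_lexp_line]. Qed.

Lemma derive1_Psi_line x v t :
  derive1 (fun s : R => Psi x (lexp (s *: v))) t =
  'D_1 (fun s : R^o => Psi x (lexp (s *: v))) t.
Proof. by rewrite derive1E. Qed.

Lemma kn_gradientE x v : kn_gradient Psi x v = phi x v.
Proof.
rewrite /kn_gradient derive1_Psi_line.
have pf : plot 1 [set: R^o] (fun t : R^o => lexp (t *: v) : G).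
  exact: plot_lexp_line.
have [_ ->] := @is_derive_Psi R^o setT openT _ x (0 : R^o) (1 : R^o) pf I.
rewrite scale0r lexp0 (kn_action kn).1; congr (phi x _).
exact: rlog_lexp_line.
Qed.

(** * Passage from points to measures *)

Section Measures.
Context (cT : compact [set: T]) (sT : @second_countable T).
Implicit Types (nu : borel_prob R T) (v : 'rV[R]_d) (t : R).

Local Notation actP := (fun g nu => bp_push (act g) nu).
Local Notation PsiP := (Psi_prob Psi).

Lemma PsiP_smooth nu : smooth_fun (PsiP nu).
Proof.
move=> c ac k; have oc := atlas_open_image ac.
exact: (Ck_bint cT oc nu (jCk_Psi _ oc (plot_param k.+2 ac))).
Qed.

Lemma PsiP_mul nu g h : PsiP nu g + PsiP (actP g nu) h = PsiP nu (h * g)%g.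
Proof.
rewrite /Psi_prob -!/(bint _ _) bint_push//; last 2 first.
- exact: act_continuous.
- exact: Psi_continuous.
rewrite -(bintD cT); last 2 first.
- exact: Psi_continuous.
- by move=> x; apply: (@continuous_comp _ _ _ (act g) (Psi^~ h));
    [exact: act_continuous|exact: Psi_continuous].
by congr bint; apply/funext => x; rewrite (kn_P4 kn).
Qed.

Lemma derive1_PsiP nu v t :
  derive1 (fun s : R => PsiP nu (lexp (s *: v))) t =
  bint nu (fun x => derive1 (fun s : R => Psi x (lexp (s *: v))) t).
Proof. exact: (bint_derive1 cT nu t (jCk_Psi_line 1 v)). Qed.

Lemma derive2_PsiP nu v t :
  derive1n 2 (fun s : R => PsiP nu (lexp (s *: v))) t =
  bint nu (fun x => derive1n 2 (fun s : R => Psi x (lexp (s *: v))) t).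
Proof. exact: (bint_derive2 cT nu t (jCk_Psi_line 2 v)). Qed.

Lemma derive2_Psi_continuous v t :
  continuous (fun x => derive1n 2 (fun s : R => Psi x (lexp (s *: v))) t).
Proof. exact: (jCk_derive2_continuous (jCk_Psi_line 2 v)). Qed.

(** A nonnegative continuous function with zero integral vanishes off a null set, where (P3) for
    points applies. The null set itself is kept because the centralizer argument also works point by
    point. *)
Lemma exp_fixed_null nu v : v \in p ->
  derive1n 2 (fun s : R => PsiP nu (lexp (s *: v))) 0 = 0 ->
  exists N : set (borelType T), [/\ measurable N, bp_measure nu N = 0%E
    & forall x, ~ N x -> forall t : R, act (lexp (t *: v)) x = x].
Proof.
move=> vp; rewrite derive2_PsiP => D0.
have c2 := @derive2_Psi_continuous v 0.
have N0 := bint_eq0_null cT c2 (fun x => (kn_P3 kn x vp).1 0) D0.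
eexists; split; last 2 first.
- exact: N0.
- move=> x /= /negP; rewrite negbK => /eqP; exact: (kn_P3 kn x vp).2.1.
exact: (open_borel (open_nonzero c2)).
Qed.

Lemma exp_stabilizer_null nu v : v \in p ->
  (forall t : R, actP (lexp (t *: v)) nu = nu) ->
  derive1n 2 (fun s : R => PsiP nu (lexp (s *: v))) 0 = 0.
Proof.
move=> vp fix_nu; rewrite /derive1n/=; set g := fun s => _.
have gD t s : g (s + t) = g s + g t.
  by rewrite /g addrC lexpD -PsiP_mul fix_nu.
exact: derive1_additive.
Qed.

Lemma kempf_ness_prob : kempf_ness K p actP PsiP.
Proof.
have hT := kn_hausdorff kn; split.
- exact: borel_prob_hausdorff.
- have [a1 aM] := kn_action kn; split=> [nu|g h nu]; apply: borel_prob_eq => A mA.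
    rewrite bp_pushE//; last exact: act_continuous.
    by congr (bp_measure nu _); apply/seteqP; split=> x /=; rewrite a1.
  have mgA := borel_preimage (@act_continuous g) mA.
  rewrite !bp_pushE//; try exact: act_continuous.
  by congr (bp_measure nu _); apply/seteqP; split=> x /=; rewrite aM.
(* Against a test function the error splits in two: the change of measure for the fixed function
   [f \o act g0], small in the weak topology, and the change of group element, small uniformly in x
   and hence for every measure. *)
- apply: continuous_borel_prob => f cf -[g0 nu0].
  apply/cvgrPdist_le => eps e0; have e2 : 0 < eps / 2 by rewrite divr_gt0.
  have cfa g : continuous (f \o act g).
    by move=> x; apply: continuous_comp; [exact: act_continuous|exact: cf].
  have U : \forall g \near g0, forall x, `|f (act g x) - f (act g0 x)| <= eps / 2.
    apply: (compact_uniform cT (Phi := fun x g => f (act g x))) => // x.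
    apply: (@continuous_comp _ _ _ (fun q : T * G => act q.2 q.1) f); last exact: cf.
    apply: (@continuous_comp _ _ _ (fun q : T * G => (q.2, q.1))
      (fun q : G * T => act q.1 q.2)); last exact: (kn_action_continuous kn).
    by apply: cvg_pair; [exact: cvg_snd|exact: cvg_fst].
  have /cvgrPdist_le/(_ _ e2) W := @bint_continuous R T _ (cfa g0) nu0.
  have W2 : \forall q \near (g0, nu0),
      `|bint nu0 (f \o act g0) - bint q.2 (f \o act g0)| <= eps / 2.
    exact: (@cvg_snd _ _ (nbhs g0) (nbhs nu0) _ _ W).
  have U2 : \forall q \near (g0, nu0), forall x, `|f (act q.1 x) - f (act g0 x)| <= eps / 2.
    exact: (@cvg_fst _ _ (nbhs g0) (nbhs nu0) _ _ U).
  near=> q; rewrite /= !bint_push//; try exact: act_continuous.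
  have -> : bint nu0 (fun x => f (act g0 x)) - bint q.2 (fun x => f (act q.1 x)) =
    (bint nu0 (f \o act g0) - bint q.2 (f \o act g0)) -
    bint q.2 (fun x => f (act q.1 x) - f (act g0 x)).
    by rewrite (bintB cT); [rewrite opprB addrA subrK|exact: cfa|exact: cfa].
  apply: (le_trans (ler_normB _ _)); rewrite [leRHS]splitr; apply: lerD.
    by near: q; exact: W2.
  apply: bint_norm_le => //.
    by move=> x; apply: cvgB; exact: cfa.
  by near: q; exact: U2.
- exact: PsiP_smooth.
- move=> nu k g Kk; rewrite /Psi_prob; congr (Rintegral _ _ _).
  by apply/funext => x; rewrite (kn_P2 kn).
- move=> nu v vp; split=> [t|].
    rewrite derive2_PsiP -[leLHS](bint_cst nu) bint_le//.
    + by move=> x; exact: cvg_cst.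
    + exact: derive2_Psi_continuous.
    + by move=> x; exact: (kn_P3 kn x vp).1.
  split=> [D0 t|]; last exact: exp_stabilizer_null.
  have [N [mN N0 fN]] := exp_fixed_null vp D0.
  apply: (bp_push_ae_id _ mN N0); first exact: act_continuous.
  by move=> x Nx; exact: fN.
- by move=> nu g h; exact: PsiP_mul.
- move=> v vp nu.
  rewrite (_ : (fun nu => _) = fun nu => bint nu (fun x => kn_gradient Psi x v)).
    by apply: bint_continuous => //; exact: (kn_P5 kn).
  by apply/funext => nu'; rewrite /kn_gradient derive1_PsiP.
Unshelve. all: by end_near. Qed.

Lemma kn_gradient_PsiP nu v : kn_gradient PsiP nu v = bint nu (phi^~ v).
Proof.
rewrite /kn_gradient derive1_PsiP; congr bint; apply/funext => x.
exact: kn_gradientE.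
Qed.

Lemma mfdiff_PsiP nu g w : mfdiff (PsiP nu) g w =
  bint nu (fun x => phi (act g x) (mfderiv (fun g' : G => (g' * g^-1)%g) g w)).
Proof.
have ac := chart_at_atlas g; have oc := atlas_open_image ac.
have pc : plot 3 (cimage (chart_at g)) (param (chart_at g)) by exact: plot_param.
have J : jCk 1 (cimage (chart_at g)) (fun x y => Psi x (param (chart_at g) y)).
  exact: jCk_Psi.
have [_ E1] := jCk_is_derive cT oc nu w J (cimage_coord (chart_at_dom g)).
apply: (etrans E1); suff -> : (fun x => 'D_w (fun y => Psi x (param (chart_at g) y))
    (Defs.coord (chart_at g) g)) =
  fun x => phi (act g x) (mfderiv (fun g' : G => (g' * g^-1)%g) g w) by [].
by apply/funext => x; exact: dPsi.
Qed.

Lemma derive_PsiP nu (V : normedModType R) (O : set V) (f : V -> G) y (u : V) :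
  open O -> plot 1 O f -> O y ->
  'D_u (PsiP nu \o f) y = bint nu (fun x => phi (act (f y) x) (rlog f u y)).
Proof.
move=> oO pf Oy; have [_ ->] := derive_smooth_fun u oO (PsiP_smooth nu) pf Oy.
by rewrite mfdiff_PsiP (rlogE u oO pf Oy).
Qed.

Lemma phi_act_continuous g w : continuous (fun x => phi (act g x) w).
Proof.
have pg : plot 0 [set: R^o] (cst g : R^o -> G).
  by apply: plot_cst; exact: openT.
exact: (jCk_slice (jphi _ w openT pg) (I : setT (0 : R^o))).
Qed.

End Measures.

End AbstractKempfNess.

(** * Lipschitz functions on homogeneous spaces *)

Lemma increment_le_integral (R : realType) (f sp : R -> R) (L : R) :
  Ck 1 [set: R^o] (f : R^o -> R) -> continuous sp ->
  (forall t, `|'D_1 (f : R^o -> R) t| <= L * sp t) ->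
  `|f 1 - f 0| <= L * \int[lebesgue_measure]_(t in `[0, 1]) sp t.
Proof.
move=> Cf csp le_sp.
have cf : continuous f by move=> t; exact: (Ck_continuous Cf (I : setT (t : R^o))).
have df t : derivable f t (1 : R^o) by apply: (Ck_derivable Cf).
have E1 : derive1 f = 'D_1 (f : R^o -> R) by apply/funext => t; exact: derive1E.
have cd : continuous (derive1 f).
  by rewrite E1 => t; exact: (Ck_continuous (Ck_derive (1 : R^o) Cf) (I : setT (t : R^o))).
have intg (g : R -> R) : continuous g ->
    lebesgue_measure.-integrable `[0, 1]%classic (EFin \o g).
  move=> cg; apply: continuous_compact_integrable; first exact: segment_compact.
  exact: continuous_subspaceT.
have FTC : \int[lebesgue_measure]_(t in `[0, 1]) derive1 f t = f 1 - f 0.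
  have w01 : {within `[0, 1], continuous (derive1 f)} by exact: continuous_subspaceT.
  have d01 : derivable_oo_LRcontinuous f 0 1.
    split=> [t _||]; first exact: df.
    + by apply: cvg_at_right_filter; exact: cf.
    + by apply: cvg_at_left_filter; exact: cf.
  exact: (congr1 fine (continuous_FTC2 ltr01 w01 d01 (fun t _ => erefl))).
rewrite -FTC; apply: (le_trans (le_normr_Rintegral _ (intg _ cd))) => //.
rewrite -RintegralZl//; last exact: intg.
apply: le_Rintegral => //.
- apply: (intg (fun t => `|derive1 f t|)) => t.
  by apply: cvg_norm; exact: cd.
- apply: (intg (fun t => L * sp t)) => t.
  by apply: cvgM; [exact: cvg_cst|exact: csp].
- by move=> t _; rewrite E1.
Qed.

Lemma plot_C1_curve (R : realType) (E : normedModType R) (M : manifoldType E)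
  (gamma : R -> M) : C1_curve gamma <-> plot 1 [set: R^o] (gamma : R^o -> M).
Proof.
split=> [[cg Cg]|[cg Cg]].
  split=> [t _|c ac]; first exact: cg.
  by apply: Ck_sub (Cg c ac) => t [].
split=> [t|c ac]; first exact: cg.
by apply: Ck_sub (Cg c ac) => t.
Qed.

Lemma plot_local (R : realType) (E V : normedModType R) (M : manifoldType E)
  k (O : set V) (f : V -> M) :
  (forall x, O x -> exists P : set V, P x /\ plot k P f) -> plot k O f.
Proof.
move=> H; split=> [x /H[P [Px [cP _]]]|c ac]; first exact: cP.
apply: Ck_local => x [/H[P [Px [_ CP]]] cx].
by exists [set y | P y /\ cdom c (f y)]; split=> //; exact: CP.
Qed.

Lemma plot_eq (R : realType) (E V : normedModType R) (M : manifoldType E)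
    k (O : set V) (f g : V -> M) :
  open O -> (forall x, O x -> f x = g x) -> plot k O f -> plot k O g.
Proof.
move=> oO fg pf; split=> [x Ox|c ac].
  rewrite /prop_for /continuous_at -fg//.
  apply: cvg_trans (plot_continuous pf Ox).
  by apply: near_eq_cvg; near do apply: fg; exact: open_near.
have -> : [set x | O x /\ cdom c (g x)] = [set x | O x /\ cdom c (f x)].
  by apply/seteqP; split=> x [Ox /=]; rewrite fg.
apply: Ck_eq (plot_coord pf ac); first exact: (plot_open oO (atlas_open ac) pf).
by move=> x [Ox _] /=; rewrite fg.
Unshelve. all: by end_near. Qed.

Section HomogeneousCurves.
Context (R : realType) (d e : nat) (G : lieGroupType R d) (K : set G).
Context (X : manifoldType 'rV[R]_e) (q : G -> X) (quo : homogeneous_quotient K q).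
Context (p : {vspace 'rV[R]_d}) (scal : 'rV[R]_d -> 'rV[R]_d -> R).
Context (h : X -> 'rV[R]_e -> 'rV[R]_e -> R) (met : invariant_metric p scal q h).
Context (pk : 'rV[R]_d -> 'rV[R]_d) (pk_in : forall v, pk v \in p).
Context (pk_tangent : forall v (t : R), K (lexp (t *: (v - pk v)))).

Let N v := Num.sqrt (scal (pk v) (pk v)).

(* [G] acts on [X] by smooth maps; these are needed to compute the metric away from the
   base point. *)
Lemma left_translation (g0 : G) : exists2 a : X -> X,
  smooth_map a & forall g, a (q g) = q (g0 * g)%g.
Proof.
have [sq surj fib sec] := quo.
pose a x := q (g0 * xget 1%g [set g | q g = x])%g.
have aq g : a (q g) = q (g0 * g)%g.
  rewrite /a; case: xgetP => [g' _ /= /(fib _ _).1 H|/(_ g) []//].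
  by apply: (fib _ _).2; rewrite invgM mulgA mulgVK.
exists a => //; apply: smooth_map_plot => k c ac; have oc := atlas_open_image ac.
apply: plot_local => y cy; have [g gy] := surj (param c y).
(* The representatives chosen by [xget] vary without any regularity; over [W] they are replaced by
   the smooth section, so that [a] becomes x |-> q (g0 * s x). *)
have [W [s [oW Wg ss sg qs]]] := sec g.
pose P := [set y | cimage c y /\ W (param c y)].
have pc : plot k (cimage c) (param c) by exact: plot_param.
have oP : open P by exact: (plot_open oc oW pc).
exists P; split; first by split=> //; rewrite -gy.
have ps : plot k P (s \o param c).
  apply: (plot_smooth_map_on oP oW ss) => [|z []//].
  by apply: plot_sub pc => z [].
pose proof (plot_smooth_map oP sq (plot_smooth_map oP (smooth_lmul g0) ps)) as E1.
by apply: plot_eq E1 => // z [_ Wz]; rewrite /= -[in RHS](qs _ Wz) aq.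
Qed.

(** The complement [v - pk v] generates a one-parameter group inside [K], along which [q] is
    constant. *)
Lemma mfderiv_quotient_lexp v : mfderiv q 1%g v = mfderiv q 1%g (pk v).
Proof.
have [sq surj fib sec] := quo.
have ql : linear (mfderiv q 1%g) by exact: mfderiv_linear.
suff : mfderiv q 1%g (v - pk v) = 0.
  by rewrite (linfD ql) (linfN ql) => /eqP; rewrite subr_eq0 => /eqP.
have pl := plot_lexp_line G 1 (v - pk v).
pose proof (pd_smooth_map (1 : R^o) openT sq pl (I : setT (0 : R^o))) as E1.
move: E1; rewrite pd_lexp_line scale0r lexp0 => <-.
set f := q \o _; suff -> : f = cst (q 1%g) by rewrite pd_cst.
apply/funext => t; rewrite /f /=; apply/esym; apply: (fib _ _).2.
by rewrite invg1 mul1g.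
Qed.

Let scal_metric v : h (q 1%g) (mfderiv q 1%g v) (mfderiv q 1%g v) = scal (pk v) (pk v).
Proof.
have [_ _ hp] := met.
by rewrite mfderiv_quotient_lexp hp.
Qed.

Section Lift.
Context (gamma : R^o -> X) (pg : plot 1 [set: R^o] gamma).
Context (W : set X) (s : X -> G) (oW : open W) (ss : smooth_map_on W s).
Context (qs : forall x, W x -> q (s x) = x).

Let P := [set t | W (gamma t)].

Lemma lift_open : open P.
Proof.
have := plot_open openT oW pg; congr open.
by apply/seteqP; split=> t; [case|].
Qed.

(** The lift is inverted because the function on [X] takes the value [S g^-1] at [q g]: along
    [gamma] it is then [S] composed with this family. *)
Lemma lift_plot : plot 1 P (fun t => (s (gamma t))^-1)%g.
Proof.
apply: (plot_inv lift_open (f := s \o gamma)).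
apply: (plot_smooth_map_on lift_open oW ss); [exact: plot_sub pg|by []].
Qed.

(** Translation by the inverse of [g0 = s (gamma t)] is an isometry bringing the point to the base
    point, where the metric is [scal]. The translated lift [j1] passes through 1, and its velocity
    is minus the logarithmic derivative of the inverted lift. *)
Lemma lift_speed t : P t ->
  h (gamma t) (velocity gamma t) (velocity gamma t) =
  scal (pk (- rlog (fun t => (s (gamma t))^-1)%g (1 : R^o) t))
       (pk (- rlog (fun t => (s (gamma t))^-1)%g (1 : R^o) t)).
Proof.
have [sq surj fib sec] := quo; have [_ inv_h _] := met.
move=> Pt; have nP : \forall z \near t, P z by exact: open_near lift_open Pt.
pose g0 := s (gamma t); have [a sa aq] := left_translation g0.
have oP := lift_open.
have ps : plot 1 P (s \o gamma).
  apply: (plot_smooth_map_on oP oW ss); [exact: plot_sub pg|by []].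
pose j1 z := (g0^-1 * s (gamma z))%g.
have pj : plot 1 P j1 by exact: (plot_smooth_map oP (smooth_lmul g0^-1%g) ps).
have j1t : j1 t = 1%g by rewrite /j1 mulVg.
have vE : velocity gamma t = mfderiv a (q 1%g) (mfderiv q 1%g (pd j1 t 1)).
  pose proof (pd_smooth_map (1 : R^o) oP sq pj Pt) as E2.
  move: E2; rewrite j1t velocityE => <-.
  pose proof (pd_smooth_map (1 : R^o) oP sa (plot_smooth_map oP sq pj) Pt) as E1.
  move: E1; rewrite /= j1t => <-; apply: pd_near; near=> z.
  have Pz : P z by near: z; exact: nP.
  by rewrite /= aq /j1 mulVKg qs.
have gE : gamma t = a (q 1%g) by rewrite aq mulg1 qs.
rewrite vE {1}gE (inv_h g0 a aq) scal_metric.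
suff -> : - rlog (fun t => (s (gamma t))^-1)%g (1 : R^o) t = pd j1 t 1 by [].
pose proof (pd_inv (1 : R^o) oP pj Pt j1t) as E1; move: E1; rewrite -[LHS]opprK => /oppr_inj <-.
have -> : (fun z => (j1 z)^-1)%g = (fun z => (s (gamma z))^-1 * ((s (gamma t))^-1)^-1)%g.
  by apply/funext => z; rewrite /j1 invgM !invgK.
by [].
Unshelve. all: by end_near. Qed.

End Lift.

Context (F : X -> R) (S : G -> R) (FS : forall g, F (q g) = S g^-1%g).
Context (sS : smooth_fun S) (L : R) (L0 : 0 < L).
Context (cN : continuous N) (NN : forall v, N (- v) = N v).
Context (bound : forall (Q : set R^o) (f : R^o -> G) t, open Q -> plot 1 Q f -> Q t ->
  `|'D_1 (S \o f) t| <= L * N (rlog f (1 : R^o) t)).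

(** Lifts exist only locally, which suffices: being C^1 and the bound on the derivative are local
    assertions about [F \o gamma], and only the result is integrated over [0, 1]. *)
Lemma curve_increment_le gamma : C1_curve gamma ->
  `|F (gamma 1) - F (gamma 0)| <= L * curve_length h gamma.
Proof.
move=> /plot_C1_curve pg; have [sq surj fib sec] := quo.
have lift (t : R^o) : exists (P : set R^o) (j : R^o -> G),
    [/\ open P, P t, plot 1 P j, forall z, P z -> F (gamma z) = S (j z)
      & forall z, P z -> Num.sqrt (h (gamma z) (velocity gamma z) (velocity gamma z)) =
          N (rlog j (1 : R^o) z)].
  have [g gt] := surj (gamma t); have [W [s [oW Wg ss _ qs]]] := sec g.
  exists [set z | W (gamma z)], (fun z => (s (gamma z))^-1%g); split.
  - exact: lift_open.
  - by rewrite /= -gt.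
  - exact: (lift_plot pg oW ss).
  - by move=> z Wz; rewrite -FS qs.
  - by move=> z Wz; rewrite (lift_speed pg oW ss qs Wz) -NN.
have nP (P : set R^o) (t : R^o) : open P -> P t -> \forall z \near t, P z.
  exact: open_near.
apply: (increment_le_integral (f := F \o gamma)).
- apply: Ck_local => t _; have [P [j [oP Pt pj Fj _]]] := lift t.
  exists P; split=> //; apply: Ck_eq (Ck_smooth_fun oP sS pj) => //.
  by move=> z Pz /=; rewrite Fj.
- move=> t; have [P [j [oP Pt pj _ Nj]]] := lift t.
  have C : {for t, continuous (fun z => N (rlog j (1 : R^o) z))}.
    apply: continuous_comp; last exact: cN.
    exact: (Ck_continuous (Ck_rlog (1 : R^o) oP pj) Pt).
  rewrite /prop_for /continuous_at Nj//.
  apply: cvg_trans C; apply: near_eq_cvg; near=> z; apply/esym/Nj.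
  by near: z; exact: nP.
- move=> t; have [P [j [oP Pt pj Fj Nj]]] := lift t.
  rewrite Nj// (_ : 'D_1 _ t = 'D_1 (S \o j) t); first exact: (bound oP pj Pt).
  apply: near_eq_derive.
  by near=> z; rewrite /= Fj//; near: z; exact: nP.
Unshelve. all: by end_near. Qed.

Lemma pw_path_increment_le x y l : pw_path h x y l -> `|F x - F y| <= L * l.
Proof.
elim=> {x y l} [x|gamma y l Cg _ IH]; first by rewrite subrr normr0 mulr0.
rewrite mulrDr -(subrKA (F (gamma 1))) (le_trans (ler_normD _ _))//.
by rewrite lerD// distrC curve_increment_le.
Qed.

Context (cart : forall g : G, exists k v, [/\ K k, v \in p & g = (k * lexp v)%g]).

(** Needed for the infimum in the distance to run over a nonempty set. Writing g2^-1 g1 = k exp(v),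
    the curve g1 exp(-t v) K goes from g1 K to g2 k K = g2 K. *)
Lemma pw_path_exists x y : exists l, pw_path h x y l.
Proof.
have [sq surj fib sec] := quo.
have [g1 <-] := surj x; have [g2 <-] := surj y.
have [k [v [Kk vp E1]]] := cart (g2^-1 * g1)%g.
pose gamma (t : R) := q (g1 * lexp (t *: (- v)))%g.
have Cg : C1_curve gamma.
  apply/plot_C1_curve.
  pose proof (plot_smooth_map openT sq (plot_smooth_map openT (smooth_lmul g1)
    (plot_lexp_line G 1 (- v)))) as E2.
  exact: E2.
have g0 : gamma 0 = q g1 by rewrite /gamma scale0r lexp0 mulg1.
have g1' : gamma 1 = q g2.
  apply: (fib _ _).2; rewrite scale1r.
  have lN : (lexp v * lexp (- v) = 1 :> G)%g.
    by have := @lexpD R d G 1 (-1) v; rewrite subrr scale0r lexp0 scale1r scaleN1r => <-.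
  have -> : (g1 * lexp (- v) = g2 * k)%g.
    have : (g1 = g2 * (k * lexp v))%g by rewrite -E1 mulVKg.
    by move=> ->; rewrite -!mulgA lN mulg1.
  rewrite invgM -mulgA mulVg mulg1.
  have /(fib 1%g k).2/esym/(fib k 1%g).1 : K (1^-1 * k)%g by rewrite invg1 mul1g.
  by rewrite mulg1.
exists (curve_length h gamma + 0); rewrite -g0 -g1'.
exact: pw_cons Cg (pw_nil h _).
Qed.

Lemma quotient_globally_lipschitz : globally_lipschitz h F.
Proof.
(* Division by the positive [L] turns the estimate along paths into a lower bound for their
   lengths. *)
exists L => x y; rewrite -ler_pdivrMl//; apply: lb_le_inf.
  by have [l xyl] := pw_path_exists x y; exists l.
by move=> l /= xyl; rewrite ler_pdivrMl//; exact: pw_path_increment_le.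
Qed.

End HomogeneousCurves.

(** Two representatives of a coset differ by [K] on the right, their inverses by [K] on the left, so
    the chosen one does not matter. *)
Lemma kn_quotientE (R : realType) d (G : lieGroupType R d) (K : set G)
    (T : topologicalType) (Psi : T -> G -> R) e (X : manifoldType 'rV[R]_e)
    (q : G -> X) x g :
  homogeneous_quotient K q -> (forall k g, K k -> Psi x (k * g)%g = Psi x g) ->
  kn_quotient Psi q x (q g) = Psi x g^-1%g.
Proof.
move=> [_ _ fib _] PK; rewrite /kn_quotient.
case: xgetP => [g' _ /= /(fib _ _).1 Kg|/(_ g) []//].
by rewrite -(PK _ g^-1%g Kg) mulgK.
Qed.

(** * The gradient map *)

Section ContinuousCombinations.
Context (R : realType) (T : topologicalType).

Lemma continuous_mul (f g : T -> R) : continuous f -> continuous g ->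
  continuous (fun x => f x * g x).
Proof. by move=> cf cg x; exact: cvgM (cf x) (cg x). Qed.

Lemma continuous_cst (a : R) : continuous (fun _ : T => a).
Proof. by move=> x; exact: cvg_cst. Qed.

Lemma continuous_sum n (f : 'I_n -> T -> R) : (forall i, continuous (f i)) ->
  continuous (fun x => \sum_i f i x).
Proof. by move=> cf x; apply: continuous_sum_ord => i; exact: cf. Qed.

End ContinuousCombinations.

Section Setting.
Context (R : realType) (dU n d m : nat).
Context (U : lieGroupType R dU) (UC : complexLieGroupType R n) (iU : U -> UC).
Context (hU : lie_hom iU) (Z : complexManifoldType R m).
Context (act : UC -> Z -> Z) (act_action : is_action act).
Context (act_smooth : smooth_map2 act).
Context (mu : Z -> 'rV[R]_dU -> R) (mu_scalar : forall z, scalar (mu z)).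
Context (mu_smooth : forall xi, smooth_fun (mu^~ xi)).
Context (G : lieGroupType R d) (iG : G -> UC) (hG : lie_hom iG).
Context (injG : injective (lie_diff iG)) (cG : compatible iU iG).
Context (B : 'rV[R]_(n + n) -> 'rV[R]_(n + n) -> R) (B_form : invariant_form iU B).
Context (M : set Z) (M_compact : compact M).
Context (M_stable : forall g z, M z -> M (act (iG g) z)) (m0 : M).

Local Notation T := (subspace_at m0).
Local Notation aM := (sub_action M_stable : G -> T -> T).
Local Notation p := (lie_p iU iG).
Local Notation pk := (proj_p iU iG).
Local Notation ipB := (ip iG B).

Context (mup : T -> 'rV[R]_d).
Context (mup_gradient : gradient_map iU iG B (fun x : T => mu (set_val x)) mup).

Let phi (x : T) w := ipB (mup x) (pk w).

Lemma subspace_compact : compact [set: T].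
Proof. exact: compact_set_type M_compact. Qed.

Lemma subspace_second_countable : @second_countable T.
Proof. exact: second_countable_set_type (@manifold_second_countable _ _ Z). Qed.

Lemma phi_linear x : linear (phi x).
Proof.
move=> a u v; rewrite /phi (proj_p_linear iU iG).
exact: (ip_linear_r hG B_form).
Qed.

(** From beta = i b follows i beta = - b, and the sign cancels the one in the definition of the
    gradient map. *)
Lemma mup_mu beta b : lie_diff iG beta = Jmx (lie_diff iU b) ->
  forall x : T, ipB (mup x) beta = mu (set_val x) b.
Proof.
move=> E1 x; have [_ H] := mup_gradient x.
have bp : beta \in p by apply/(lie_pP hU hG); exists b.
have lU : linear (lie_diff iU) by exact: lie_diff_linear.
rewrite (H beta (- b) bp); last by rewrite E1 JmxK (linfN lU).
by rewrite (linfN (mu_scalar (set_val x))) opprK.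
Qed.

(** [mup] lives on [M] only, but its pairing with the p-part i b of [w] is the restriction of
    [mu^~ b], which is smooth on all of [Z]. *)
Lemma phi_jCk (V : normedModType R) (fV : finDim V) k (O : set V) (f : V -> G) w :
  open O -> plot k O f -> jCk k O (fun x y => phi (aM (f y) x) w).
Proof.
move=> oO pf; have /(lie_pP hU hG)[b E1] := proj_p_in iU iG w.
have -> : (fun x y => phi (aM (f y) x) w) =
    (fun x y => mu (act (iG (f y)) (set_val (x : M))) b).
  by apply/funext => x; apply/funext => y; rewrite /phi (mup_mu E1).
have pG : plot k O (iG \o f) by exact: (plot_smooth_map oO hG.2 pf).
exact: (jCk_action act_smooth (@set_val_continuous Z M) oO pG (mu_smooth b)).
Qed.

Lemma compatible_cartan (g : G) :
  exists k v, [/\ K_of iU iG k, v \in p & g = (k * lexp v)%g].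
Proof. by have [H _ _] := cG; exact: H. Qed.

Lemma proj_p_tangent v (t : R) : K_of iU iG (lexp (t *: (v - pk v))).
Proof.
have [k /(lie_kP hU hG)[b E1] {1}->] := proj_p_decomp cG v.
have lU : linear (lie_diff iU) by exact: lie_diff_linear.
have lG : linear (lie_diff iG) by exact: lie_diff_linear.
rewrite addrC addKr /K_of /= (lie_hom_lexp hG) (linfZ lG) E1 -(linfZ lU) -(lie_hom_lexp hU).
by exists (lexp (t *: b)).
Qed.

Lemma phi_continuous w : continuous (fun x => phi x w).
Proof.
have aM1 x : aM 1%g x = x.
  by apply: val_inj; rewrite /= (lie_hom1 hG) act_action.1.
have E1 : (fun x => phi x w) = (fun x => phi (aM 1%g x) w).
  by apply/funext => x; rewrite aM1.
rewrite E1; exact: (phi_act_continuous phi_jCk).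
Qed.

(** The gradient map is known through its pairings with p; [ip_coordinates] recovers its coordinates
    linearly from finitely many of them. *)
Lemma mup_coord_continuous j : continuous (fun x => mup x 0 j).
Proof.
have [l ll lE] := ip_coordinates hU hG injG cG B_form.
have -> : (fun x => mup x 0 j) = fun x => \sum_i phi x (delta_mx 0 i) * l (delta_mx 0 i) 0 j.
  apply/funext => x; rewrite {1}(lE _ (mup_gradient x).1) (row_linear_sum ll) summxE.
  by apply: eq_bigr => i _; rewrite !mxE.
apply: continuous_sum => i; apply: continuous_mul; last exact: continuous_cst.
exact: phi_continuous.
Qed.

(** The vector integral is defined by the standard coordinates of the Lie algebra, which are
    unrelated to p; this makes it available to every functional. *)
Lemma linear_vint nu (l : 'rV[R]_d -> R) : linear l ->
  l (bp_vint nu mup) = bint nu (fun x => l (mup x)).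
Proof.
move=> ll; rewrite (row_linear_sum ll).
have -> : (fun x => l (mup x)) = fun x => \sum_j l (delta_mx 0 j) * mup x 0 j.
  apply/funext => x; rewrite (row_linear_sum ll).
  by apply: eq_bigr => j _; rewrite mulrC.
rewrite (bint_sum subspace_compact); last first.
  move=> j; apply: continuous_mul; first exact: continuous_cst.
  exact: mup_coord_continuous.
apply: eq_bigr => j _; rewrite (bintZ subspace_compact); last exact: mup_coord_continuous.
by rewrite mxE mulrC.
Qed.

Lemma vint_in_p nu : bp_vint nu mup \in p.
Proof.
(* Membership in p is the equation [pk u = u], whose coordinates are linear functionals and so pass
   through the integral. *)
suff -> : bp_vint nu mup = pk (bp_vint nu mup) by exact: proj_p_in.
apply/rowP => j.
have lj : linear (fun u => pk u 0 j : R).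
  by move=> a u v; rewrite (proj_p_linear iU iG) !mxE.
rewrite (linear_vint nu lj) mxE; congr bint; apply/funext => x.
by rewrite (proj_p_id cG (mup_gradient x).1).
Qed.

Lemma ip_vint nu v : v \in p -> ipB (bp_vint nu mup) v = bint nu (fun x => phi x v).
Proof.
move=> vp; apply: (etrans (linear_vint nu (ip_linear_l hG B_form v))).
apply: (congr1 (bint nu)); apply/funext => x.
exact: (congr1 (ipB (mup x)) (esym (proj_p_id cG vp))).
Qed.

Let N v := Num.sqrt (ipB (pk v) (pk v)).

Lemma proj_norm_continuous : continuous N.
Proof.
have cl (l : 'rV[R]_d -> R^o) : linear l -> continuous l by exact: linear_continuous_findim.
move=> v; apply: (@continuous_comp _ _ _ (fun v => ipB (pk v) (pk v)) Num.sqrt); last first.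
  exact: sqrt_continuous.
have -> : (fun v => ipB (pk v) (pk v)) =
    fun v => \sum_j v 0 j * ipB (pk v) (pk (delta_mx 0 j)).
  apply/funext => u; have l1 : linear (fun y => ipB (pk u) (pk y)).
    by move=> a x y; rewrite (proj_p_linear iU iG) (ip_linear_r hG B_form).
  exact: (row_linear_sum l1 u).
suff : continuous (fun v : 'rV[R]_d => \sum_j v 0 j * ipB (pk v) (pk (delta_mx 0 j))).
  by move=> /(_ v).
apply: continuous_sum => j; apply: continuous_mul.
  by apply: (cl (fun u => u 0 j)) => a x y; rewrite !mxE.
apply: (cl (fun u => ipB (pk u) (pk (delta_mx 0 j)))) => a x y.
by rewrite (proj_p_linear iU iG) (ip_linear_l hG B_form).
Qed.

Lemma proj_normN v : N (- v) = N v.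
Proof.
rewrite /N (linfN (@proj_p_linear _ _ _ _ _ _ _ iU iG)).
by rewrite (linfN (ip_linear_l hG B_form _)) (linfN (ip_linear_r hG B_form _)) opprK.
Qed.

Lemma phi_bound : exists2 L : R, 0 < L & forall x w, `|phi x w| <= L * N w.
Proof.
have cn : continuous (fun x => ipB (mup x) (mup x)).
  have -> : (fun x => ipB (mup x) (mup x)) =
      fun x => \sum_j mup x 0 j * phi x (delta_mx 0 j).
    apply/funext => x; rewrite -{2}(proj_p_id cG (mup_gradient x).1).
    exact: (row_linear_sum (phi_linear x)).
  apply: continuous_sum => j; apply: continuous_mul.
    exact: mup_coord_continuous.
  exact: phi_continuous.
have [C HC] := continuous_bounded subspace_compact cn.
(* The square root bounds the norm of [mup], by Cauchy-Schwarz the only constant required; adding 1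
   makes it positive, as the Lipschitz estimate divides by it. *)
exists (Num.sqrt C + 1); first by rewrite ltr_wpDl ?sqrtr_ge0.
move=> x w; have mp := (mup_gradient x).1.
apply: (le_trans (ip_CS hU hG injG B_form mp (proj_p_in iU iG w))).
apply: ler_wpM2r; first exact: sqrtr_ge0.
apply: ler_wpDr => //; apply: ler_wsqrtr.
exact: le_trans (ler_norm _) (HC x).
Qed.

End Setting.

(** * The centralizer *)

Lemma bint_null (R : realType) (T : ptopologicalType) (nu : borel_prob R T)
    (f : T -> R) (N : set (borelType T)) : compact [set: T] -> continuous f ->
  measurable N -> bp_measure nu N = 0%E -> (forall x, ~ N x -> f x = 0) ->
  bint nu f = 0.
Proof.
move=> cT cf mN N0 fN; rewrite -[RHS](bint_cst nu) /bint /Rintegral; congr fine.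
have /integrableP[mf _] := bint_integrable cT nu cf.
apply: (ae_eq_integral (cst 0%E)) => //.
exists N; split=> // x /= /not_implyP[_ fx]; apply: contrapT => Nx.
by apply: fx; rewrite fN.
Qed.

Section HolomorphicOrbits.
Context (R : realType) (n m : nat) (H : complexLieGroupType R n).
Context (Z : complexManifoldType R m) (act : H -> Z -> Z) (aA : is_action act).
Context (sact : smooth_map2 act).
Context (hact : forall z, complex_linear_diff (act^~ z)).

Lemma smooth_orbit z : smooth_map (act^~ z).
Proof.
apply: smooth_map_plot => k c ac; have oc := atlas_open_image ac.
exact: (plot_smooth_map2 oc sact (plot_param k ac) (plot_cst k z oc)).
Qed.

Lemma smooth_act g : smooth_map (act g).
Proof.
apply: smooth_map_plot => k c ac; have oc := atlas_open_image ac.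
exact: (plot_smooth_map2 oc sact (plot_cst k g oc) (plot_param k ac)).
Qed.

Lemma pd_orbit v z :
  pd (fun t : R^o => act (lexp (t *: v)) z) 0 1 = mfderiv (act^~ z) 1%g v.
Proof.
pose proof (pd_smooth_map (1 : R^o) openT (smooth_orbit z) (plot_lexp_line H 1 v)
  (I : setT (0 : R^o))) as E1.
by move: E1; rewrite pd_lexp_line scale0r lexp0.
Qed.

(** The velocity of the orbit at time s is the image, under the differential of exp(s v), of the
    velocity at time 0, which vanishes. *)
Lemma orbit_constant v z : mfderiv (act^~ z) 1%g v = 0 ->
  forall t : R, act (lexp (t *: v)) z = z.
Proof.
move=> v0 t; pose f (s : R^o) := act (lexp (s *: v)) z.
have pf : plot 1 [set: R^o] f.
  exact: (plot_smooth_map openT (smooth_orbit z) (plot_lexp_line H 1 v)).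
have f0 : f 0 = z by rewrite /f scale0r lexp0 aA.1.
rewrite -[RHS]f0; apply: (pd0_constant pf) => s.
have -> : f = (act (lexp (s *: v)) \o f) \o (fun r : R^o => r - s).
  by apply/funext => r; rewrite /f /= -aA.2 -lexpD addrC subrK.
have pg : plot 1 [set: R^o] (act (lexp (s *: v)) \o f).
  exact: (plot_smooth_map openT (smooth_act _) pf).
have ds : is_derive s (1 : R^o) (fun r : R^o => r - s) (1 - 0 : R^o).
  exact: is_deriveB.
pose proof (pd_precomp openT pg I ds) as E2; move: E2.
rewrite subrr subr0 => ->.
pose proof (pd_smooth_map (1 : R^o) openT (smooth_act (lexp (s *: v))) pf
  (I : setT (0 : R^o))) as E1.
rewrite E1 pd_orbit v0; apply: linf0; apply: mfderiv_linear; exact: smooth_act.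
Qed.

(* the stabilizer of a point in a holomorphic action has a complex Lie algebra *)
Lemma exp_fixed_Jmx v z : (forall t : R, act (lexp (t *: v)) z = z) ->
  forall t : R, act (lexp (t *: Jmx v)) z = z.
Proof.
move=> fz; apply: orbit_constant; have -> : mfderiv (act^~ z) 1%g (Jmx v) =
    Jmx (mfderiv (act^~ z) 1%g v) by exact: hact.
rewrite -pd_orbit (_ : (fun t => _) = cst z); last by apply/funext => t; exact: fz.
by rewrite pd_cst; exact: (linf0 (@Jmx_linear R m)).
Qed.

End HolomorphicOrbits.

Section Centralizer.
Context (R : realType) (dU n d m : nat).
Context (U : lieGroupType R dU) (UC : complexLieGroupType R n) (iU : U -> UC).
Context (hU : lie_hom iU) (Z : complexManifoldType R m).
Context (act : UC -> Z -> Z) (act_action : is_action act).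
Context (act_smooth : smooth_map2 act).
Context (act_complex : forall z, complex_linear_diff (act^~ z)).
Context (mu : Z -> 'rV[R]_dU -> R) (mu_scalar : forall z, scalar (mu z)).
Context (mu_equivariant : forall u z xi, mu (act (iU u) z) (Ad u xi) = mu z xi).
Context (G : lieGroupType R d) (iG : G -> UC) (hG : lie_hom iG).

Lemma fixed_mu_lbracket beta b z xi : lie_diff iG beta = Jmx (lie_diff iU b) ->
  (forall t : R, act (iG (lexp (t *: beta))) z = z) -> mu z (lbracket U b xi) = 0.
Proof.
move=> E1 fz.
have lU : linear (lie_diff iU) by exact: lie_diff_linear.
have lG : linear (lie_diff iG) by exact: lie_diff_linear.
have fJ (t : R) : act (lexp (t *: Jmx (lie_diff iU b))) z = z.
  by rewrite -E1 -(linfZ lG) -(lie_hom_lexp hG).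
have fb (t : R) : act (iU (lexp (t *: b))) z = z.
  (* The complex structure sends i b to - b; the opposite time restores the sign. *)
  have := exp_fixed_Jmx act_action act_smooth act_complex fJ (- t).
  by rewrite JmxK scalerN scaleNr opprK -(linfZ lU) -(lie_hom_lexp hU).
have lmu : linear (mu z) by exact: mu_scalar.
(* The bracket is the derivative of Ad(exp(t b)) xi, along which [mu z] is constant because exp(t b)
   fixes [z]. *)
have [_ <-] := is_derive_linearf lmu (is_derive_Ad U b xi).
rewrite (_ : (fun y => _) = cst (mu z xi)); first exact: derive_cst.
by apply/funext => t; rewrite -[in LHS](fb t) mu_equivariant.
Qed.

Context (B : 'rV[R]_(n + n) -> 'rV[R]_(n + n) -> R) (B_form : invariant_form iU B).
Context (injG : injective (lie_diff iG)).

(** This is the relation [p, p] in k: the two factors i multiply to -1 and leave an element of the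
    Lie algebra of U. *)
Lemma lbracket_pp beta1 beta2 b1 b2 :
  lie_diff iG beta1 = Jmx (lie_diff iU b1) -> lie_diff iG beta2 = Jmx (lie_diff iU b2) ->
  lie_diff iG (lbracket G beta1 beta2) = lie_diff iU (- lbracket U b1 b2).
Proof.
move=> E1 E2; apply: (etrans (lie_diff_lbracket hG _ _)).
rewrite E1 E2 lbracket_Jl lbracket_Jr JmxK -(lie_diff_lbracket hU).
have lU : linear (lie_diff iU) by exact: lie_diff_linear.
by rewrite (linfN lU).
Qed.

Lemma lbracket_pk beta kappa b c :
  lie_diff iG beta = Jmx (lie_diff iU b) -> lie_diff iG kappa = lie_diff iU c ->
  lie_diff iG (lbracket G beta kappa) = Jmx (lie_diff iU (lbracket U b c)).
Proof.
move=> E1 E2; have H x y z x' z' : z = lbracket UC x y -> x = Jmx x' ->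
    z' = lbracket UC x' y -> z = Jmx z'.
  by move=> -> -> ->; exact: lbracket_Jl.
apply: (H _ _ _ _ _ (lie_diff_lbracket hG beta kappa) E1).
exact: (etrans (lie_diff_lbracket hU b c) (congr1 (lbracket UC _) (esym E2))).
Qed.

Lemma ip_lbracket u v w :
  ip iG B (lbracket G w u) v = - ip iG B u (lbracket G w v).
Proof.
have [[lB sB] _ aB _ _] := B_form.
have H x y z a b : a = lbracket UC z x -> b = lbracket UC z y -> B a y = - B x b.
  by move=> -> ->; exact: invariant_form_lbracket.
exact: (H _ _ _ _ _ (lie_diff_lbracket hG w u) (lie_diff_lbracket hG w v)).
Qed.

(* By invariance [B([beta, F], [beta, F]) = - B(F, [beta, [beta, F]])]; the left side is
   the form on the Lie algebra of [U], where it is negative definite. *)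
Lemma lbracket_eq0 beta F b : lie_diff iG beta = Jmx (lie_diff iU b) ->
  F \in lie_p iU iG ->
  (forall eta xi, lie_diff iG eta = Jmx (lie_diff iU (lbracket U b xi)) ->
     ip iG B F eta = 0) ->
  lbracket G F beta = 0.
Proof.
move=> Eb /(lie_pP hU hG)[f Ef] H.
have lG : linear (lie_diff iG) by exact: lie_diff_linear.
have [_ _ _ nB _] := B_form.
have Ek := lbracket_pp Eb Ef; have Ee := lbracket_pk Eb Ek.
have B0 : ip iG B (lbracket G beta F) (lbracket G beta F) = 0.
  by rewrite ip_lbracket (H _ _ Ee) oppr0.
rewrite lbracketC; move: (lbracket G beta F) (- lbracket U b f) Ek B0 => k c Ek B0.
suff -> : k = 0 by exact: oppr0.
apply: injG; rewrite (linf0 lG); apply/eqP/negPn/negP; rewrite Ek => /nB[+ _].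
by rewrite -Ek -[B _ _]/(ip iG B k k) B0 ltxx.
Qed.

End Centralizer.

Theorem proposition45 (R : realType) (dU n d m e : nat)
  (* U and its complexification *)
  (U : lieGroupType R dU) (UC : complexLieGroupType R n) (iU : U -> UC)
  (U_compact : compact [set: U]) (U_connected : connected [set: U])
  (UC_complexification : is_complexification iU)
  (* the Hamiltonian action on the Kaehler manifold (Z, w) *)
  (Z : complexManifoldType R m)
  (w : Z -> 'rV[R]_(m + m) -> 'rV[R]_(m + m) -> R) (w_kahler : kahler_form w)
  (act : UC -> Z -> Z) (act_action : is_action act)
  (act_holomorphic : holomorphic2 act)
  (w_invariant : forall u : U, preserves_tensor w (act (iU u)))
  (mu : Z -> 'rV[R]_dU -> R)
  (mu_momentum : momentum_map (fun u => act (iU u)) w mu)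
  (* the closed connected compatible subgroup G *)
  (G : lieGroupType R d) (iG : G -> UC) (G_closed : closed_lie_embedding iG)
  (G_connected : connected [set: G]) (G_compatible : compatible iU iG)
  (* the Ad-invariant form *)
  (B : 'rV[R]_(n + n) -> 'rV[R]_(n + n) -> R) (B_form : invariant_form iU B)
  (* X = G/K with its G-invariant Riemannian metric *)
  (X : manifoldType 'rV[R]_e) (q : G -> X)
  (X_quotient : homogeneous_quotient (K_of iU iG) q)
  (h : X -> 'rV[R]_e -> 'rV[R]_e -> R)
  (h_metric : invariant_metric (lie_p iU iG) (ip iG B) q h)
  (* the compact G-stable subset M *)
  (M : set Z) (M_compact : compact M)
  (M_stable : forall g z, M z -> M (act (iG g) z)) (m0 : M)
  (mup : subspace_at m0 -> 'rV[R]_d)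
  (mup_gradient : gradient_map iU iG B
     (fun x : subspace_at m0 => mu (set_val x)) mup)
  (* the Kempf-Ness function of (M, G, K) associated with mup *)
  (PsiM : subspace_at m0 -> G -> R)
  (PsiM_1 : forall x, PsiM x 1%g = 0)
  (PsiM_diff : forall x g v, mfdiff (PsiM x) g v =
     ip iG B (mup (sub_action M_stable g x))
       (proj_p iU iG (mfderiv (fun g' : G => (g' * g^-1)%g) g v)))
  (PsiM_kempf_ness : kempf_ness (K_of iU iG) (lie_p iU iG)
     (sub_action M_stable : G -> subspace_at m0 -> subspace_at m0) PsiM) :
  let actP := fun (g : G) (nu : borel_prob R (subspace_at m0)) =>
    bp_push (sub_action M_stable g : subspace_at m0 -> subspace_at m0) nu in
  let PsiP := Psi_prob PsiM in
  let F := fun nu : borel_prob R (subspace_at m0) => bp_vint nu mup in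
  [/\ kempf_ness (K_of iU iG) (lie_p iU iG) actP PsiP,
      kn_P6 PsiP q h,
      (forall x g, kn_quotient PsiM q x (q g) = PsiM x g^-1%g) /\
      (forall nu g,
         kn_quotient PsiP q nu (q g) = PsiP nu g^-1%g /\
         kn_quotient PsiP q nu (q g) =
           \int[bp_measure nu]_x (kn_quotient PsiM q x (q g))),
      (forall nu, F nu \in lie_p iU iG /\
         forall v, v \in lie_p iU iG ->
           kn_gradient PsiP nu v = ip iG B (F nu) v)
    & (forall nu beta, beta \in lie_p iU iG ->
         (forall t : R, actP (lexp (t *: beta)) nu = nu) ->
         p_centralizer iU iG beta (F nu))].
Proof.
move=> actP PsiP F.
have hU : lie_hom iU := UC_complexification.1.
have [hG _ injG _] := G_closed.
have [act_smooth _ act_complex] := act_holomorphic.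
have [mu_scalar mu_smooth mu_equivariant _] := mu_momentum.
have kn := PsiM_kempf_ness.
pose phi (x : subspace_at m0) w := ip iG B (mup x) (proj_p iU iG w).
have cT : compact [set: subspace_at m0] by exact: subspace_compact.
have sT : @second_countable (subspace_at m0) by exact: subspace_second_countable.
have cart := compatible_cartan G_compatible.
have phi_lin : forall x, linear (phi x) by exact: phi_linear.
have jphi : forall (V : normedModType R), finDim V -> forall k (O : set V)
    (f : V -> G) u, open O -> plot k O f ->
    jCk k O (fun (x : subspace_at m0) y => phi (sub_action M_stable (f y) x) u).
  by move=> V fV k O f u; exact: (phi_jCk hU act_smooth mu_scalar mu_smooth hG M_stable mup_gradient fV).
have KN : kempf_ness (K_of iU iG) (lie_p iU iG) actP PsiP.
  exact: (kempf_ness_prob kn cart PsiM_1 phi_lin PsiM_diff jphi cT sT).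
have Fp nu : F nu \in lie_p iU iG.
  exact: (vint_in_p hU act_action act_smooth mu_scalar mu_smooth hG injG
    G_compatible B_form M_compact M_stable mup_gradient).
have Fip nu v : v \in lie_p iU iG -> ip iG B (F nu) v = bint nu (fun x => phi x v).
  exact: (ip_vint hU act_action act_smooth mu_scalar mu_smooth hG injG
    G_compatible B_form M_compact M_stable mup_gradient).
split=> //.
- move=> nu.
  have [L L0 HL] := phi_bound hU act_action act_smooth mu_scalar mu_smooth hG injG
    G_compatible B_form M_compact M_stable mup_gradient.
  have FS g : kn_quotient PsiP q nu (q g) = PsiP nu g^-1%g.
    exact: (kn_quotientE g X_quotient (kn_P2 KN nu)).
  (* The constant [L] is uniform in the point, so it survives integration against a probability. *)
  have bound (Q : set R^o) (f : R^o -> G) t : open Q -> plot 1 Q f -> Q t ->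
      `|'D_1 (PsiP nu \o f) t| <=
      L * Num.sqrt (ip iG B (proj_p iU iG (rlog f (1 : R^o) t))
                            (proj_p iU iG (rlog f (1 : R^o) t))).
    move=> oQ pf Qt.
    rewrite (derive_PsiP kn cart PsiM_1 phi_lin PsiM_diff jphi cT nu (1 : R^o) oQ pf Qt).
    apply: (bint_norm_le cT); first exact: (phi_act_continuous jphi).
    by move=> x; exact: HL.
  exact: (quotient_globally_lipschitz X_quotient h_metric (proj_p_in iU iG)
    (proj_p_tangent hU hG G_compatible) FS (kn_P1 KN nu) L0
    (proj_norm_continuous hG B_form) (proj_normN hG B_form) bound cart).
- split=> [x g|nu g]; first exact: (kn_quotientE g X_quotient (kn_P2 kn x)).
  have E1 : kn_quotient PsiP q nu (q g) = PsiP nu g^-1%g.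
    exact: (kn_quotientE g X_quotient (kn_P2 KN nu)).
  split; first exact: E1.
  apply: (etrans E1); apply: (congr1 (bint nu)); apply/funext => x.
  by apply/esym; exact: (kn_quotientE g X_quotient (kn_P2 kn x)).
- move=> nu; split=> // v vp; rewrite Fip//.
  exact: (kn_gradient_PsiP kn cart PsiM_1 phi_lin PsiM_diff jphi cT nu v).
- move=> nu beta bp fix_nu; split=> //.
  have [b Eb] := (lie_pP hU hG beta).1 bp.
  have D0 := exp_stabilizer_null kn cart PsiM_1 phi_lin PsiM_diff jphi cT bp fix_nu.
  have [N [mN N0 fN]] := exp_fixed_null kn cart PsiM_1 phi_lin PsiM_diff jphi cT bp D0.
  (* It remains to pair [F nu] with [eta] = i [b, xi]; the pairing is the integral of
     mu(x)([b, xi]), which vanishes off the null set [N] of points not fixed. *)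
  apply: (lbracket_eq0 hU hG B_form injG Eb (Fp nu)) => eta xi Ee.
  have ep : eta \in lie_p iU iG by apply/(lie_pP hU hG); exists (lbracket U b xi).
  rewrite Fip//; apply: (bint_null cT _ mN N0).
    exact: (phi_continuous hU act_action act_smooth mu_scalar mu_smooth hG M_stable mup_gradient).
  move=> x Nx; rewrite /phi (proj_p_id G_compatible ep).
  rewrite (mup_mu hU mu_scalar hG mup_gradient Ee).
  apply: (fixed_mu_lbracket hU act_action act_smooth act_complex mu_scalar
    mu_equivariant hG xi Eb) => t.
  exact: (congr1 set_val (fN x Nx t)).
Qed.
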